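(* Let $X$ be a uniformly discrete, bounded geometry metric space. Then the $C^*$-algebras $UC^*(X)$ and $C^*_u(X)$ are strongly Morita equivalent, and the $C^*$-algebras $UC^*_{max}(X)$ and $C^*_{u,max}(X)$ are strongly Morita equivalent.
   Context: $(X,d)$ is uniformly discrete if there is $\delta>0$ with $d(x,y)\ge\delta$ for $x\ne y$; it has bounded geometry if for each $r>0$ the cardinalities of the balls of radius $r$ are uniformly bounded. An $X$-by-$X$ matrix $T=(T(x,y))_{x,y\in X}$ has finite propagation if there is $S>0$ with $T(x,y)=0$ whenever $d(x,y)\ge S$. $\mathbb{C}_u[X]$ is the $*$-algebra of $X$-by-$X$ complex matrices of finite propagation with uniformly bounded entries. $C^*_u(X)$ is its completion in the natural representation on $\ell^2(X)$; $C^*_{u,max}(X)$ is its completion in the norm given by the supremum of $\|\pi(T)\|$ over all $*$-representations $\pi$ on Hilbert spaces (finite by bounded geometry). Let $\mathcal{H}_0$ be a separable infinite-dimensional (trivially graded) Hilbert space with compact operators $\mathcal{K}(\mathcal{H}_0)$. $U\mathbb{C}_0[X]$ is the $*$-algebra of finite propagation $X$-by-$X$ matrices $(T(x,y))$ with uniformly bounded entries in $\mathcal{K}(\mathcal{H}_0)$ for which there exists $N\in\mathbb{N}$ such that every $T(x,y)$ has rank at most $N$. $U\mathbb{C}[X]$ is the $*$-algebra of $X$-by-$X$ matrices $T$ with entries in $\mathcal{K}(\mathcal{H}_0)$ (of finite propagation) such that for all $\epsilon>0$ there is $T_0\in U\mathbb{C}_0[X]$ with $\|T_0(x,y)-T(x,y)\|<\epsilon$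 for all $x,y\in X$. The uniform algebra $UC^*(X)$ is the norm closure of $U\mathbb{C}[X]$ in its natural representation by matrix multiplication on $\ell^2(X)\otimes\mathcal{H}_0$. The maximal uniform algebra $UC^*_{max}(X)$ is the completion of $U\mathbb{C}[X]$ in the norm given by the supremum over all its $*$-representations on Hilbert spaces (finite by bounded geometry). *)

(* Defs.v *)
From HB Require Import structures.
From mathcomp Require Import all_boot all_order all_algebra.
From mathcomp Require Import sesquilinear.
From mathcomp Require Import all_classical all_reals all_analysis.
From mathcomp Require Import complex.

Set Implicit Arguments.
Unset Strict Implicit.
Unset Printing Implicit Defensive.

Import Order.TTheory GRing.Theory Num.Theory.
Import numFieldNormedType.Exports.

Local Open Scope classical_set_scope.
Local Open Scope ring_scope.
Local Open Scope complex_scope.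

(* The norm of a normed module over [R[i]] takes its values in [R[i]]; [rnorm]
   is the same number seen in [R]. *)
Definition rnorm (R : realType) (V : normedZmodType R[i]) (v : V) : R :=
  complex.Re `|v|.

Definition linear_span (R : realType) (V : lmodType R[i]) (S : set V) : set V :=
  [set x | exists n (c : 'I_n -> R[i]) (v : 'I_n -> V),
     (forall i, S (v i)) /\ x = \sum_(i < n) c i *: v i].

(* As for every [{dot _ for conjC}], the inner product is linear in its first
   argument and conjugate-linear in the second one. *)
HB.mixin Record CompleteNormedModule_isHilbert (R : realType) H
    & CompleteNormedModule R[i] H := {
  hdot : {dot H for (@Num.conj R[i])} ;
  hdotE : forall x : H, hdot x x = `|x| ^+ 2 }.

#[short(type="hilbertType")]
HB.structure Definition Hilbert (R : realType) :=
  { H of CompleteNormedModule R[i] H & CompleteNormedModule_isHilbert R H }.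

Definition opnorm (R : realType) (V W : normedModType R[i]) (f : V -> W) :
    \bar R :=
  ereal_sup [set (rnorm (f x))%:E | x in [set x : V | rnorm x <= 1]].

Definition bounded_operator (R : realType) (V W : normedModType R[i])
    (f : V -> W) : Prop :=
  linear f /\ (opnorm f < +oo)%E.

Definition compact_operator (R : realType) (V W : normedModType R[i])
    (f : V -> W) : Prop :=
  linear f /\ precompact (f @` [set x : V | rnorm x <= 1]).

Definition rank_le (R : realType) (V W : lmodType R[i]) (N : nat)
    (f : V -> W) : Prop :=
  exists w : 'I_N -> W, range f `<=` linear_span (range w).

(* [adjoint f] is the Hilbert space adjoint for every bounded operator [f], and
   a default value when there is none. *)
Definition adjoint (R : realType) (H : hilbertType R) (f : H -> H) : H -> H :=
  xget 0 [set g : H -> H | forall x y, hdot (f x) y = hdot x (g y)].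

Definition separable_space (T : topologicalType) : Prop :=
  exists2 D : set T, countable D & dense D.

Definition infinite_dimensional (R : realType) (V : lmodType R[i]) : Prop :=
  forall n (v : 'I_n -> V), linear_span (range v) <> [set: V].

(* Units are not required: UC*(X) has none unless X is empty. *)
HB.mixin Record CompleteNormedModule_isCStarAlgebra (R : realType) A
    & CompleteNormedModule R[i] A := {
  cmul : A -> A -> A ;
  cstar : A -> A ;
  cmulA : associative cmul ;
  cmul_linearl : forall b, linear (cmul^~ b) ;
  cmul_linearr : forall a, linear (cmul a) ;
  cstarK : involutive cstar ;
  cstar_semilinear : forall (l : R[i]) (a b : A),
    cstar (l *: a + b) = Num.conj l *: cstar a + cstar b ;
  cstarM : forall a b, cstar (cmul a b) = cmul (cstar b) (cstar a) ;
  cnormM : forall a b : A, `|cmul a b| <= `|a| * `|b| ;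
  cnorm_star : forall a : A, `|cmul (cstar a) a| = `|a| ^+ 2 }.

#[short(type="cstarAlgType")]
HB.structure Definition CStarAlgebra (R : realType) :=
  { A of CompleteNormedModule R[i] A & CompleteNormedModule_isCStarAlgebra R A }.

Definition cpositive (R : realType) (A : cstarAlgType R) (a : A) : Prop :=
  exists c : A, a = cmul (cstar c) c.

(* The inner product is conjugate-linear in its first argument by [rip_linearr]
   and [rip_star]; it is definite, and [E] is complete for the Hilbert module
   norm, by [rip_norm]. *)
Record full_right_hilbert_module (R : realType) (B : cstarAlgType R)
    (E : completeNormedModType R[i]) (ra : E -> B -> E) (rip : E -> E -> B) :
    Prop := {
  ra_linearl : forall b, linear (ra^~ b) ;
  ra_linearr : forall x, linear (ra x) ;
  ra_mul : forall x b c, ra x (cmul b c) = ra (ra x b) c ;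
  rip_linearr : forall x, linear (rip x) ;
  rip_ra : forall x y b, rip x (ra y b) = cmul (rip x y) b ;
  rip_star : forall x y, cstar (rip x y) = rip y x ;
  rip_ge0 : forall x, cpositive (rip x x) ;
  rip_norm : forall x, `|x| ^+ 2 = `|rip x x| ;
  rip_full : dense (linear_span [set rip x y | x in [set: E] & y in [set: E]]) }.

Record full_left_hilbert_module (R : realType) (A : cstarAlgType R)
    (E : completeNormedModType R[i]) (la : A -> E -> E) (lip : E -> E -> A) :
    Prop := {
  la_linearl : forall x, linear (la^~ x) ;
  la_linearr : forall a, linear (la a) ;
  la_mul : forall a b x, la (cmul a b) x = la a (la b x) ;
  lip_linearl : forall y, linear (lip^~ y) ;
  lip_la : forall a x y, lip (la a x) y = cmul a (lip x y) ;
  lip_star : forall x y, cstar (lip x y) = lip y x ;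
  lip_ge0 : forall x, cpositive (lip x x) ;
  lip_norm : forall x, `|x| ^+ 2 = `|lip x x| ;
  lip_full : dense (linear_span [set lip x y | x in [set: E] & y in [set: E]]) }.

(* The norms defined by the two inner products of an imprimitivity bimodule
   always coincide, so that a single complete norm on [E] serves for both. *)
Record imprimitivity_bimodule (R : realType) (A B : cstarAlgType R)
    (E : completeNormedModType R[i]) (la : A -> E -> E) (ra : E -> B -> E)
    (lip : E -> E -> A) (rip : E -> E -> B) : Prop := {
  imp_left : full_left_hilbert_module la lip ;
  imp_right : full_right_hilbert_module ra rip ;
  imp_bimodule : forall a x b, ra (la a x) b = la a (ra x b) ;
  imp_rip_la : forall a x y, rip (la a x) y = rip x (la (cstar a) y) ;
  imp_lip_ra : forall x b y, lip (ra x b) y = lip x (ra y (cstar b)) ;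
  imp_lip_rip : forall x y z, la (lip x y) z = ra x (rip y z) }.

(* Strong Morita equivalence in the sense of Rieffel. *)
Definition strongly_Morita_equivalent (R : realType) (A B : cstarAlgType R) :
    Prop :=
  exists (E : completeNormedModType R[i]) (la : A -> E -> E) (ra : E -> B -> E)
    (lip : E -> E -> A) (rip : E -> E -> B), imprimitivity_bimodule la ra lip rip.

(* A *-algebra is given as the subset [sa_set] of an ambient vector space with
   total operations; only the restriction of the operations to [sa_set] matters
   (products of infinite matrices or adjoints of operators are meaningless in
   general). *)
Record starAlg (R : realType) := StarAlg {
  sa_car :> lmodType R[i] ;
  sa_set : set sa_car ;
  sa_mul : sa_car -> sa_car -> sa_car ;
  sa_star : sa_car -> sa_car }.

Record star_representation (R : realType) (A : starAlg R) (H : hilbertType R)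
    (pi : A -> H -> H) : Prop := {
  rep_bounded : forall T, sa_set T -> bounded_operator (pi T) ;
  rep_linear : forall (l : R[i]) S T, sa_set S -> sa_set T ->
    pi (l *: S + T) = l *: pi S + pi T ;
  rep_mul : forall S T, sa_set S -> sa_set T -> pi (sa_mul S T) = pi S \o pi T ;
  rep_star : forall T, sa_set T ->
    forall x y, hdot (pi T x) y = hdot x (pi (sa_star T) y) }.

Definition max_norm (R : realType) (A : starAlg R) (T : A) : \bar R :=
  ereal_sup [set r | exists (H : hilbertType R) (pi : A -> H -> H),
    star_representation pi /\ r = opnorm (pi T)].

(* [B] is the completion of [A] for [nrm]; this determines [B] up to a unique
   isometric *-isomorphism compatible with the maps from [A]. *)
Record completion_map (R : realType) (A : starAlg R) (nrm : A -> \bar R)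
    (B : cstarAlgType R) (iota : A -> B) : Prop := {
  compl_linear : forall (l : R[i]) S T, sa_set S -> sa_set T ->
    iota (l *: S + T) = l *: iota S + iota T ;
  compl_mul : forall S T, sa_set S -> sa_set T ->
    iota (sa_mul S T) = cmul (iota S) (iota T) ;
  compl_star : forall T, sa_set T -> iota (sa_star T) = cstar (iota T) ;
  compl_norm : forall T, sa_set T -> ((rnorm (iota T))%:E = nrm T)%E ;
  compl_dense : dense (iota @` @sa_set R A) }.

Definition is_completion (R : realType) (A : starAlg R) (nrm : A -> \bar R)
    (B : cstarAlgType R) : Prop :=
  exists iota : A -> B, completion_map nrm iota.

Definition uniformly_discrete (R : realType) (X : metricType R) : Prop :=
  exists2 delta : R, 0 < delta & forall x y : X, x <> y -> delta <= mdist x y.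

Definition bounded_geometry (R : realType) (X : metricType R) : Prop :=
  forall r : R, 0 < r -> exists N : nat, forall x : X, (ball x r #<= `I_N)%card.

Definition finite_propagation (R : realType) (X : metricType R)
    (C : lmodType R[i]) (T : X -> X -> C) : Prop :=
  exists2 S : R, 0 < S & forall x y, S <= mdist x y -> T x y = 0.

(* For matrices of finite propagation over a space of bounded geometry the sums
   below have finite support; [\sum_(z \in _)] is the sum over that support. *)
Definition mx_mul (R : realType) (X : metricType R) (C : lmodType R[i])
    (mul : C -> C -> C) (S T : X -> X -> C) : X -> X -> C :=
  fun x y => \sum_(z \in [set: X]) mul (S x z) (T z y).

Definition mx_star (X C : Type) (star : C -> C) (T : X -> X -> C) :
    X -> X -> C :=
  fun x y => star (T y x).

Definition mx_act (R : realType) (X : metricType R) (C H : lmodType R[i])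
    (act : C -> H -> H) (T : X -> X -> C) (xi : X -> H) : X -> H :=
  fun x => \sum_(y \in [set: X]) act (T x y) (xi y).

(* The norm of [xi] in l^2(X; H), which is l^2(X) (x) H; it is +oo when [xi] is
   not square-summable. *)
Definition l2norm (R : realType) (X : metricType R) (H : normedZmodType R[i])
    (xi : X -> H) : \bar R :=
  ((\esum_(x in [set: X]) ((rnorm (xi x)) ^+ 2)%:E) `^ 2^-1)%E.

Definition l2_opnorm (R : realType) (X : metricType R)
    (H : normedZmodType R[i]) (F : (X -> H) -> (X -> H)) : \bar R :=
  ereal_sup [set l2norm (F xi) | xi in [set xi : X -> H | (l2norm xi <= 1)%E]].

Definition Cu (R : realType) (X : metricType R) : set (X -> X -> R[i]^o) :=
  [set T | finite_propagation T /\
    exists M : R, forall x y, rnorm (T x y) <= M].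

Definition Cu_alg (R : realType) (X : metricType R) : starAlg R :=
  StarAlg (@Cu R X) (mx_mul *%R) (mx_star (@Num.conj R[i])).

Definition Cu_norm (R : realType) (X : metricType R) (T : Cu_alg X) : \bar R :=
  l2_opnorm (mx_act (H := R[i]^o) *%R T).

Definition is_Cstar_u (R : realType) (X : metricType R) (B : cstarAlgType R) :
    Prop :=
  is_completion (@Cu_norm R X) B.

Definition is_Cstar_u_max (R : realType) (X : metricType R)
    (B : cstarAlgType R) : Prop :=
  is_completion (@max_norm R (Cu_alg X)) B.

Definition UC0 (R : realType) (X : metricType R) (H0 : hilbertType R) :
    set (X -> X -> H0 -> H0) :=
  [set T | [/\ finite_propagation T,
    forall x y, compact_operator (T x y),
    exists M : R, forall x y, (opnorm (T x y) <= M%:E)%E &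
    exists N : nat, forall x y, rank_le N (T x y)]].

Definition UC (R : realType) (X : metricType R) (H0 : hilbertType R) :
    set (X -> X -> H0 -> H0) :=
  [set T | [/\ finite_propagation T,
    forall x y, compact_operator (T x y) &
    forall e : R, 0 < e -> exists2 T0, @UC0 R X H0 T0 &
      forall x y, (opnorm (T0 x y - T x y)%R < e%:E)%E]].

Definition UC_alg (R : realType) (X : metricType R) (H0 : hilbertType R) :
    starAlg R :=
  StarAlg (@UC R X H0) (mx_mul (fun f g => f \o g)) (mx_star (@adjoint R H0)).

Definition UC_norm (R : realType) (X : metricType R) (H0 : hilbertType R)
    (T : UC_alg X H0) : \bar R :=
  l2_opnorm (mx_act (fun (f : H0 -> H0) v => f v) T).

Definition is_UCstar (R : realType) (X : metricType R) (H0 : hilbertType R)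
    (A : cstarAlgType R) : Prop :=
  is_completion (@UC_norm R X H0) A.

Definition is_UCstar_max (R : realType) (X : metricType R)
    (H0 : hilbertType R) (A : cstarAlgType R) : Prop :=
  is_completion (@max_norm R (UC_alg X H0)) A.

(* Main.v *)
(* Fix a unit vector [e] of [H0] and put [p = 1 (x) e e^*]. The matrices
   [corner e T = T (x) e e^*] identify Cu[X] with the corner [p UC[X] p], and the
   closure of [UC[X] p] in the completion of UC[X] is the imprimitivity bimodule.
   It is full because a matrix of uniformly bounded rank is a finite sum of
   products [ket a (ket b)^*] with [ket a], [ket b] in [UC[X] p].

   The corner embedding is isometric. For the reduced norms this is immediate on
   l^2. For the maximal norms one has to extend a vector state of a
   *-representation of Cu[X] to UC[X]; this is done by inducing along [UC[X] p],
   and the induced semi-inner product is nonnegative since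
   the relevant Gram matrices factor as [sum_i b_i^* b_i] with [b_i] in Cu[X].

   The right inner product [a^* a], [a] in [UC[X] p] with [|a| <= 1], is positive
   in the corner: [|p - a^* a| <= 1], and a fixed point iteration gives a square
   root. *)
From HB Require Import structures.
From mathcomp Require Import all_boot all_order all_algebra.
From mathcomp Require Import sesquilinear.
From mathcomp Require Import all_classical all_reals all_analysis.
From mathcomp Require Import complex ring lra.
Require Import Defs.

Set Implicit Arguments.
Unset Strict Implicit.
Unset Printing Implicit Defensive.

Import Order.TTheory GRing.Theory Num.Theory.
Import numFieldNormedType.Exports.

Local Open Scope classical_set_scope.
Local Open Scope ring_scope.
Local Open Scope complex_scope.

(** * Convergence of sequences *)

(** No spectral theory is used for the completions: estimates move to Hilbert spaces through one
    property, [normed_by_reps], by which a bound valid in every representation dominated by the norm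
    holds for the norm. Both norms on [UC] satisfy it, so the corner argument [UC_morita] is carried
    out once, for an abstract pair of norms. The definition of [UC] controls entries only, whereas
    density of the matrices of bounded rank concerns a norm. The link is a bound of [pi T] by the
    supremum of the entries, in an arbitrary representation, with a constant that depends on the
    propagation alone. Diagonal matrices are bounded by inverting r - D within the algebra, and
    slicing reduces the others to them. For the maximal norms, restricting representations to the
    corner gives one inequality only. For the other, both the positivity of the induced form and the
    boundedness of the action must be shown inside [Cu], which is not norm closed, so that square
    roots are out of reach. A Cholesky factorisation replaces them; it stops because neighbourhoods
    have bounded size. *)

Section RealNorm.
Context {R : realType}.
Implicit Types (V : normedZmodType R[i]) (W : normedModType R[i]).

Lemma ReK (z : R[i]) : 0 <= z -> z = (complex.Re z)%:C.
Proof. by move=> z0; rewrite RRe_real// ger0_real. Qed.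

Lemma RecK (a : R) : complex.Re a%:C = a. Proof. by []. Qed.

Lemma rnormE V (v : V) : `|v| = (rnorm v)%:C.
Proof. by rewrite /rnorm -ReK. Qed.

Lemma Re_le (z w : R[i]) : z <= w -> complex.Re z <= complex.Re w.
Proof. by rewrite lecE => /andP[]. Qed.

Lemma rnorm_ge0 V (v : V) : 0 <= rnorm v.
Proof. by have := normr_ge0 v; rewrite rnormE ler0c. Qed.

Lemma rnorm0 V : rnorm (0 : V) = 0.
Proof. by rewrite /rnorm normr0. Qed.

Lemma rnorm_eq0 V (v : V) : rnorm v = 0 -> v = 0.
Proof. by move=> h; apply/eqP; rewrite -normr_eq0 rnormE h. Qed.

Lemma rnormN V (v : V) : rnorm (- v) = rnorm v.
Proof. by rewrite /rnorm normrN. Qed.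

Lemma rdistC V (u v : V) : rnorm (u - v) = rnorm (v - u).
Proof. by rewrite -rnormN opprB. Qed.

Lemma rnormD V (u v : V) : rnorm (u + v) <= rnorm u + rnorm v.
Proof. by have := ler_normD u v; rewrite !rnormE -rmorphD lecR. Qed.

Lemma rdistD V (w u v : V) : rnorm (u - v) <= rnorm (u - w) + rnorm (w - v).
Proof. by rewrite -[u - v](subrKA w); exact: rnormD. Qed.

Lemma rnormB V (u v : V) : rnorm (u - v) <= rnorm u + rnorm v.
Proof. by rewrite -(rnormN v); exact: rnormD. Qed.

Lemma rnorm_distl V (u v : V) : rnorm u <= rnorm v + rnorm (u - v).
Proof. by rewrite -{1}(subrK v u) addrC rnormD. Qed.

Lemma rnormM (z w : R[i]) : rnorm (z * w) = rnorm z * rnorm w.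
Proof. by apply: (@complexI R); rewrite rmorphM -!rnormE normrM. Qed.

Lemma rnormZ W (l : R[i]) (v : W) : rnorm (l *: v) = rnorm l * rnorm v.
Proof.
by apply: (@complexI R); rewrite -rnormE normrZ rnormE [`|v|]rnormE -rmorphM.
Qed.

Lemma rnormR (a : R) : rnorm (a%:C : R[i]) = `|a|.
Proof.
by apply: (@complexI R); rewrite -rnormE normc_def /= expr0n/= addr0 sqrtr_sqr.
Qed.

Lemma rnormJ (z : R[i]) : rnorm (Num.conj z : R[i]) = rnorm z.
Proof. by apply: (@complexI R); rewrite -!rnormE norm_conjC. Qed.

Lemma normr_Re (z : R[i]) : `|complex.Re z| <= rnorm z.
Proof. by rewrite -lecR -rnormE normc_ge_Re. Qed.

Lemma Re_rnorm (z : R[i]) : complex.Re z <= rnorm z.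
Proof. exact: le_trans (ler_norm _) (normr_Re z). Qed.

Lemma normr_Im (z : R[i]) : `|complex.Im z| <= rnorm z.
Proof.
rewrite -lecR -rnormE normc_def lecR -sqrtr_sqr ler_wsqrtr// lerDr.
exact: sqr_ge0.
Qed.

Lemma rnorm_ReIm (z : R[i]) :
  rnorm z <= `|complex.Re z| + `|complex.Im z|.
Proof.
rewrite -lecR -rnormE normc_def lecR.
apply: le_trans (ler_wsqrtr (_ : _ <= (`|complex.Re z| + `|complex.Im z|) ^+ 2)) _.
  rewrite sqrrD !real_normK ?num_real//.
  by rewrite addrAC lerDl mulrn_wge0// mulr_ge0.
by rewrite sqrtr_sqr ger0_norm// addr_ge0.
Qed.

Lemma conjE (z : R[i]) : (Num.conj z : R[i]) = (z^*)%C.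
Proof. by []. Qed.

Lemma rnorm_sum V (I : Type) (r : seq I) (P : pred I) (F : I -> V) :
  rnorm (\sum_(i <- r | P i) F i) <= \sum_(i <- r | P i) rnorm (F i).
Proof.
elim/big_rec2 : _ => [|i y x _ h]; first by rewrite rnorm0.
by apply: le_trans (rnormD _ _) _; rewrite lerD2l.
Qed.

End RealNorm.

Section Sequences.
Context {R : realType}.

(** Norms take values in [R[i]], whose order is partial, so the epsilons here are real.
    [cauchys_cvs], [cauchys_complete] and [dense_dist] translate from and to filters and open
    sets. *)
Definition cvs (V : normedZmodType R[i]) (u : nat -> V) (a : V) :=
  forall e : R, 0 < e -> exists N, forall n, (N <= n)%N -> rnorm (u n - a) < e.

Definition cauchys (V : normedZmodType R[i]) (u : nat -> V) :=
  forall e : R, 0 < e -> exists N, forall m n, (N <= m)%N -> (N <= n)%N ->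
    rnorm (u m - u n) < e.

Section Zmod.
Variable V : normedZmodType R[i].
Implicit Types (u v : nat -> V) (a b : V).

Lemma eq_rnorm_small a b : (forall e : R, 0 < e -> rnorm (a - b) <= e) -> a = b.
Proof.
move=> h; apply/eqP; rewrite -subr_eq0; apply/eqP; apply: rnorm_eq0; apply/eqP.
rewrite eq_le rnorm_ge0 andbT; apply/ler_addgt0Pl => e e0.
by rewrite addr0; exact: h.
Qed.

Lemma cvs_unique u a b : cvs u a -> cvs u b -> a = b.
Proof.
move=> ua ub; apply: eq_rnorm_small => e e0.
have e2 : 0 < e / 2 by rewrite divr_gt0.
have [N1 h1] := ua _ e2; have [N2 h2] := ub _ e2.
pose n := maxn N1 N2.
apply: (le_trans (rdistD (u n) _ _)); rewrite [leRHS]splitr rdistC; apply: lerD.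
  by apply/ltW/h1; rewrite leq_maxl.
by apply/ltW/h2; rewrite leq_maxr.
Qed.

Lemma cvs_cst a : cvs (fun=> a) a.
Proof. by move=> e e0; exists 0%N => n _; rewrite subrr rnorm0. Qed.

Lemma cvsD u v a b : cvs u a -> cvs v b -> cvs (fun n => u n + v n) (a + b).
Proof.
move=> ua ub e e0; have e2 : 0 < e / 2 by rewrite divr_gt0.
have [N1 h1] := ua _ e2; have [N2 h2] := ub _ e2.
exists (maxn N1 N2) => n; rewrite geq_max => /andP[n1 n2].
rewrite opprD addrACA; apply: le_lt_trans (rnormD _ _) _.
by rewrite [ltRHS]splitr ltrD ?h1 ?h2.
Qed.

Lemma cvsN u a : cvs u a -> cvs (fun n => - u n) (- a).
Proof.
move=> ua e /ua[N h]; exists N => n /h.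
by rewrite -opprD rnormN.
Qed.

Lemma cvsB u v a b : cvs u a -> cvs v b -> cvs (fun n => u n - v n) (a - b).
Proof. by move=> ua vb; apply: cvsD => //; exact: cvsN. Qed.

Lemma eq_cvs u v a : u =1 v -> cvs u a -> cvs v a.
Proof. by move=> uv ua e /ua[N h]; exists N => n; rewrite -uv; exact: h. Qed.

Lemma cvs_le u a c : cvs u a -> (forall n, rnorm (u n) <= c) -> rnorm a <= c.
Proof.
move=> ua uc; apply/ler_addgt0Pl => e /ua[N h].
apply: le_trans (rnorm_distl _ (u N)) _; rewrite addrC.
by apply: lerD (uc _); rewrite rdistC; exact/ltW/h.
Qed.

Lemma cvs_lim_eq u a c : cvs u a ->
  (forall e : R, 0 < e -> exists N, forall n, (N <= n)%N -> `|rnorm (u n) - c| < e)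
  -> rnorm a = c.
Proof.
move=> ua uc; apply/eqP; rewrite eq_le; apply/andP; split;
  apply/ler_addgt0Pl => e e0; have e2 : 0 < e / 2 by rewrite divr_gt0.
- have [N1 h1] := ua _ e2; have [N2 h2] := uc _ e2.
  have := h1 _ (leq_maxl N1 N2); have := h2 _ (leq_maxr N1 N2).
  set n := maxn _ _; rewrite ltr_norml => /andP[A B] D.
  have := rnorm_distl a (u n); rewrite rdistC; lra.
- have [N1 h1] := ua _ e2; have [N2 h2] := uc _ e2.
  have := h1 _ (leq_maxl N1 N2); have := h2 _ (leq_maxr N1 N2).
  set n := maxn _ _; rewrite ltr_norml => /andP[A B] D.
  have := rnorm_distl (u n) a; lra.
Qed.

Lemma cvs_norm_cvg u a : cvs u a ->
  forall e : R, 0 < e -> exists N, forall n, (N <= n)%N -> `|rnorm (u n) - rnorm a| < e.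
Proof.
move=> ua e /ua[N h]; exists N => n /h hn.
rewrite ltr_norml; have := rnorm_distl (u n) a; have := rnorm_distl a (u n).
rewrite [rnorm (a - _)]rdistC; lra.
Qed.

Lemma cvs_cauchy u a : cvs u a -> cauchys u.
Proof.
move=> ua e e0; have e2 : 0 < e / 2 by rewrite divr_gt0.
have [N h] := ua _ e2; exists N => m n /h hm /h hn.
by apply: le_lt_trans (rdistD a _ _) _; rewrite [ltRHS]splitr ltrD// rdistC.
Qed.

Lemma cauchys_bounded u : cauchys u -> exists2 c : R, 0 <= c & forall n, rnorm (u n) <= c.
Proof.
move=> /(_ 1 ltr01)[N h].
exists (\sum_(i < N.+1) rnorm (u i) + 1) => [|n].
  by rewrite addr_ge0// sumr_ge0// => i _; exact: rnorm_ge0.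
have [nN|Nn] := leqP n N.
  have nN' : (n < N.+1)%N by [].
  rewrite (bigD1 (Ordinal nN'))//= -addrA lerDl addr_ge0// sumr_ge0// => i _.
  exact: rnorm_ge0.
apply: le_trans (rnorm_distl _ (u N)) _; apply: lerD; last exact/ltW/h/leqnn/ltnW.
rewrite (bigD1 (@ord_max N))//= lerDl sumr_ge0// => i _; exact: rnorm_ge0.
Qed.

Lemma invS_small (e : R) : 0 < e -> exists N, forall n, (N <= n)%N -> n.+1%:R^-1 < e.
Proof.
move=> e0; exists (Num.truncn e^-1) => n Nn.
rewrite -[ltRHS]invrK ltf_pV2 ?posrE ?invr_gt0//.
by apply: lt_le_trans (truncnS_gt _) _; rewrite ler_nat.
Qed.

Lemma cvs_invS u a : (forall n, rnorm (u n - a) <= n.+1%:R^-1) -> cvs u a.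
Proof.
move=> h e /invS_small[N hN]; exists N => n /hN.
exact: le_lt_trans.
Qed.

End Zmod.

Lemma cvsM (u v : nat -> R[i]) (a b : R[i]) :
  cvs u a -> cvs v b -> cvs (fun n => u n * v n) (a * b).
Proof.
move=> ua vb e e0.
have [c c0 uc] := cauchys_bounded (cvs_cauchy ua).
pose d := e / (2 * (c + rnorm b + 1)).
have den : 0 < c + rnorm b + 1.
  by rewrite ltr_wpDl ?addr_ge0 ?rnorm_ge0.
have d0 : 0 < d by rewrite divr_gt0// mulr_gt0.
have [N1 h1] := ua _ d0; have [N2 h2] := vb _ d0.
exists (maxn N1 N2) => n; rewrite geq_max => /andP[/h1 A /h2 B].
rewrite (_ : _ - _ = u n * (v n - b) + (u n - a) * b); last by ring.
apply: le_lt_trans (rnormD _ _) _; rewrite !rnormM.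
have : rnorm (u n) * rnorm (v n - b) <= c * d.
  by apply: ler_pM; rewrite ?rnorm_ge0// ltW.
have : rnorm (u n - a) * rnorm b <= d * rnorm b.
  by rewrite ler_wpM2r ?rnorm_ge0// ltW.
have : d * (c + rnorm b + 1) = e / 2.
  by rewrite /d invfM mulrA mulfVK ?gt_eqF.
lra.
Qed.

Lemma cvsZ (W : normedModType R[i]) (l : R[i]) (u : nat -> W) (a : W) :
  cvs u a -> cvs (fun n => l *: u n) (l *: a).
Proof.
move=> ua e e0; have p : 0 < rnorm l + 1 by rewrite ltr_wpDl ?rnorm_ge0.
have [N h] := ua _ (divr_gt0 e0 p); exists N => n /h.
rewrite ltr_pdivlMr// -scalerBr rnormZ => hn.
have := rnorm_ge0 (u n - a); nra.
Qed.

Lemma cvsJ (u : nat -> R[i]) (a : R[i]) : cvs u a ->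
  cvs (fun n => Num.conj (u n) : R[i]) (Num.conj a : R[i]).
Proof. by move=> ua e /ua[N h]; exists N => n /h; rewrite -rmorphB rnormJ. Qed.

Lemma cvs_ge0 (u : nat -> R[i]) (a : R[i]) : cvs u a ->
  (forall n, 0 <= u n) -> 0 <= a.
Proof.
move=> ua u0.
have hi : complex.Im a = 0.
  apply/eqP; rewrite -normr_le0; apply/ler_addgt0Pl => e /ua[N /(_ N (leqnn _)) h].
  rewrite addr0; apply: le_trans (ltW h); apply: le_trans _ (normr_Im _).
  have /ger0_Im := u0 N; case: (u N) => x y /= ->; case: a {ua h} => ? ? /=.
  by rewrite sub0r normrN.
have hr : 0 <= complex.Re a.
  apply/ler_addgt0Pl => e /ua[N /(_ N (leqnn _)) h].
  have := Re_le (u0 N); have := Re_rnorm (u N - a) .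
  move: h; case: (u N) => x y; case: (a) => z t /=; rewrite /complex.Re/=; lra.
by rewrite lecE hi eqxx/=.
Qed.

Lemma cauchys_cvsC (u : nat -> R[i]) : cauchys u -> exists a, cvs u a.
Proof.
have rc (g : nat -> R) : (forall e : R, 0 < e -> exists N, forall m n, (N <= m)%N ->
    (N <= n)%N -> `|g m - g n| < e) -> exists l, forall e : R, 0 < e ->
    exists N, forall n, (N <= n)%N -> `|g n - l| < e.
  move=> h; have : cvg (g @ \oo).
    apply/cauchy_cvgP/cauchy_ballP => e e0.
    have [N hN] := h _ e0.
    exists (g @` [set n | N <= n]%N, g @` [set n | N <= n]%N) => /=.
      by split; exists N => // n Nn; exists n.
    by move=> [_ _] [[m Nm <-] [n Nn <-]] /=; rewrite -ball_normE /=; exact: hN.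
  move=> /cvgrPdist_lt hl; exists (limn g) => e /hl [N _ hN].
  by exists N => n Nn; rewrite distrC; exact: hN.
move=> cu.
have [a ha] : exists l, forall e : R, 0 < e ->
    exists N, forall n, (N <= n)%N -> `|complex.Re (u n) - l| < e.
  apply: rc => e /cu[N h]; exists N => m n Nm Nn.
  apply: le_lt_trans (h _ _ Nm Nn); apply: le_trans (normr_Re _).
  by case: (u m) => ? ?; case: (u n).
have [b hb] : exists l, forall e : R, 0 < e ->
    exists N, forall n, (N <= n)%N -> `|complex.Im (u n) - l| < e.
  apply: rc => e /cu[N h]; exists N => m n Nm Nn.
  apply: le_lt_trans (h _ _ Nm Nn); apply: le_trans (normr_Im _).
  by case: (u m) => ? ?; case: (u n).
exists (a +i* b) => e e0; have e2 : 0 < e / 2 by rewrite divr_gt0.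
have [N1 h1] := ha _ e2; have [N2 h2] := hb _ e2.
exists (maxn N1 N2) => n; rewrite geq_max => /andP[/h1 A /h2 B].
apply: le_lt_trans (rnorm_ReIm _) _; rewrite [ltRHS]splitr.
by move: A B; case: (u n) => x y /= A B; rewrite ltrD.
Qed.

Lemma cauchys_cvs (V : completeNormedModType R[i]) (u : nat -> V) :
  cauchys u -> exists a, cvs u a.
Proof.
move=> cu; have : cvg (u @ \oo).
  apply/cauchy_cvgP/cauchy_ballP => e e0.
  have er : 0 < complex.Re e by move: e0; rewrite ltcE => /andP[].
  have [N hN] := cu _ er.
  exists (u @` [set n | N <= n]%N, u @` [set n | N <= n]%N) => /=.
    by split; exists N => // n Nn; exists n.
  move=> [_ _] [[m Nm <-] [n Nn <-]] /=.
  by rewrite -ball_normE /= rnormE (ReK (ltW e0)) ltcR; exact: hN.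
move=> /cvgrPdist_lt hl; exists (limn u) => e e0.
have [|N _ hN] := hl e%:C; first by rewrite ltcR.
by exists N => n Nn; have := hN _ Nn; rewrite /= rnormE ltcR rdistC.
Qed.

(** For each n the filter contains a ball of radius 1/(n+1) around some [u n]. Two members of the
    filter meet, so [u] is Cauchy, and the filter follows its limit. *)
Lemma cauchys_complete (V : normedModType R[i]) :
  (forall u : nat -> V, cauchys u -> exists a, cvs u a) ->
  forall F : set_system V, ProperFilter F -> cauchy F -> cvg F.
Proof.
move=> hV F FF /cauchy_ballP cF.
have hex n : exists a : V, F (ball a ((n.+1%:R^-1 : R)%:C)).
  have /cauchyP : cauchy F by apply/cauchy_ballP.
  by apply; rewrite ltcR invr_gt0.
pose u n := sval (cid (hex n)).
have hu n : F (ball (u n) ((n.+1%:R^-1 : R)%:C)) by rewrite /u; case: cid.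
have cu : cauchys u.
  move=> e e0; have e2 : 0 < e / 2 by rewrite divr_gt0.
  have [N hN] := invS_small e2; exists N => m n Nm Nn.
  have [z [zm zn]] := filter_ex (filterI (hu m) (hu n)).
  apply: le_lt_trans (rdistD z _ _) _; rewrite [ltRHS]splitr ltrD//.
    by apply: lt_trans (hN _ Nm); rewrite -ltcR -rnormE; move: zm; rewrite -ball_normE.
  apply: lt_trans (hN _ Nn); rewrite rdistC -ltcR -rnormE.
  by move: zn; rewrite -ball_normE.
have [a ha] := hV _ cu.
apply/cvg_ex; exists a; apply/cvgrPdist_lt => /= e e0.
have er : 0 < complex.Re e / 2.
  by rewrite divr_gt0//; move: e0; rewrite ltcE => /andP[].
have [N1 h1] := ha _ er; have [N2 h2] := invS_small er.
pose n := maxn N1 N2; apply: filterS (hu n) => z.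
rewrite -ball_normE /= (ReK (ltW e0)) !rnormE !ltcR => hz.
apply: le_lt_trans (rdistD (u n) _ _) _; rewrite [ltRHS]splitr ltrD//.
  by rewrite rdistC h1// leq_maxl.
by apply: lt_trans hz _; rewrite h2// leq_maxr.
Qed.

Lemma dense_dist (V : normedModType R[i]) (D : set V) :
  dense D <-> forall (v : V) (e : R), 0 < e -> exists2 d, D d & rnorm (v - d) < e.
Proof.
split=> [dD v e e0|h O [v Ov] oO].
  have [||d [bd Dd]] := dD (ball v e%:C).
  - by exists v; apply: ballxx; rewrite ltcR.
  - by apply: ball_open; rewrite ltcR.
  by exists d => //; rewrite -ltcR -rnormE; move: bd; rewrite -ball_normE.
have /nbhs_ballP[e/= e0 be] : nbhs v O by apply: open_nbhs_nbhs; split.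
have er : 0 < complex.Re e by move: e0; rewrite ltcE => /andP[].
have [d Dd hd] := h v _ er; exists d; split=> //; apply: be.
by rewrite -ball_normE /= (ReK (ltW e0)) rnormE ltcR.
Qed.

Lemma dense_cvs (V : normedModType R[i]) (D : set V) (v : V) : dense D ->
  exists2 u : nat -> V, (forall n, D (u n)) & cvs u v.
Proof.
move=> /dense_dist h.
have hex n : exists d, D d /\ rnorm (v - d) < n.+1%:R^-1.
  by have [|d ? ?] := h v n.+1%:R^-1; [rewrite invr_gt0|exists d].
exists (fun n => sval (cid (hex n))) => [n|]; first by case: cid => ? [].
by apply: cvs_invS => n; case: cid => ? [? ?] /=; rewrite rdistC ltW.
Qed.

End Sequences.

(** * Subspaces and semi-inner products *)

Record is_linsub (R : realType) (V : lmodType R[i]) (D : set V) : Prop := {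
  is_linsub0 : D 0 ;
  is_linsubP : forall l u v, D u -> D v -> D (l *: u + v) }.

Section LinearOn.
Variables (R : realType) (V W : lmodType R[i]) (D : set V) (f : V -> W).
Hypotheses (hD : is_linsub D)
  (flin : forall l S T, D S -> D T -> f (l *: S + T) = l *: f S + f T).

Lemma linear_on_B S T : D S -> D T -> D (S - T) /\ f (S - T) = f S - f T.
Proof.
move=> DS DT; rewrite addrC -scaleN1r; split; first exact: is_linsubP.
by rewrite flin// scaleN1r addrC.
Qed.

Lemma linear_on_sum (I : Type) (s : seq I) (T : I -> V) : (forall i, D (T i)) ->
  D (\sum_(i <- s) T i) /\ f (\sum_(i <- s) T i) = \sum_(i <- s) f (T i).
Proof.
move=> DT; elim: s => [|i s [Ds IH]].
  have D0 := is_linsub0 hD; rewrite !big_nil; split=> //.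
  by have := flin (-1) D0 D0; rewrite scaler0 addr0 scaleN1r addNr.
rewrite !big_cons -IH -[T i]scale1r; split; first exact: is_linsubP.
by rewrite flin// !scale1r.
Qed.

End LinearOn.

Section LinSub.
Variables (R : realType) (V : lmodType R[i]) (D : set V) (h : is_linsub D).

(** The proof of [is_linsub D] is a phantom argument that puts closedness within reach of the
    structure instances. [normsub] and [hilbert_carrier] carry their hypotheses in the same way. *)
Definition linsub_pred of is_linsub D : {pred V} := fun v => `[< D v >].

Let linsub_closed : submod_closed (linsub_pred h).
Proof.
split=> [|l u v /asboolP Du /asboolP Dv]; first by apply/asboolP; exact: is_linsub0 h.
by apply/asboolP; exact: is_linsubP h _ _ _ Du Dv.
Qed.

HB.instance Definition _ := GRing.isSubmodClosed.Build _ _ (linsub_pred h) linsub_closed.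

Definition linsub : Type := {v : V | linsub_pred h v}.
HB.instance Definition _ := SubType.copy linsub {v : V | linsub_pred h v}.
HB.instance Definition _ := Choice.copy linsub {v : V | linsub_pred h v}.
HB.instance Definition _ := [SubChoice_isSubLmodule of linsub by <:].

Lemma linsub_mem (v : linsub) : D (val v).
Proof. by have /asboolP := valP v. Qed.

Definition to_linsub (v : V) (Dv : D v) : linsub := Sub v (asboolT Dv).

Lemma to_linsubK v (Dv : D v) : val (to_linsub Dv) = v.
Proof. exact: SubK. Qed.

Lemma val_linsubP l (u v : linsub) : val (l *: u + v) = l *: val u + val v.
Proof. by rewrite linearP. Qed.

Lemma val_linsubB (u v : linsub) : val (u - v) = val u - val v.
Proof. by rewrite raddfB. Qed.

End LinSub.

Section CompleteSub.
Variables (R : realType) (V : completeNormedModType R[i]) (D : set V)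
  (h : is_linsub D) (hc : forall u a, (forall n, D (u n)) -> cvs u a -> D a).

Definition normsub of (forall u a, (forall n, D (u n)) -> cvs u a -> D a) : Type :=
  linsub h.
Local Notation E := (normsub hc).
HB.instance Definition _ := GRing.Lmodule.copy E (linsub h).

Let ns_norm (v : E) : R[i] := `|val (v : linsub h)|.
Let ns_normD (u v : E) : ns_norm (u + v) <= ns_norm u + ns_norm v.
Proof. by rewrite /ns_norm raddfD ler_normD. Qed.
Let ns_normZ l (u : E) : ns_norm (l *: u) = `|l| * ns_norm u.
Proof. by rewrite /ns_norm linearZ normrZ. Qed.
Let ns_norm0 (u : E) : ns_norm u = 0 -> u = 0.
Proof. by move=> /normr0_eq0 u0; apply/val_inj; rewrite u0 raddf0. Qed.

HB.instance Definition _ := Lmodule_isNormed.Build R[i] E ns_normD ns_normZ ns_norm0.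

Lemma rnorm_normsub (v : E) : rnorm v = rnorm (val (v : linsub h)).
Proof. by []. Qed.

Let ns_complete : forall F : set_system E, ProperFilter F -> cauchy F -> cvg F.
Proof.
apply: cauchys_complete => u cu.
have /cauchys_cvs[a ua] : cauchys (fun n => val (u n : linsub h)).
  move=> e /cu[N hN]; exists N => m n Nm Nn.
  by have := hN _ _ Nm Nn; rewrite rnorm_normsub raddfB.
have Da : D a by apply: hc ua => n; exact: linsub_mem.
exists (to_linsub h Da : E) => e /ua[N hN]; exists N => n /hN hn.
by rewrite [ltLHS]rnorm_normsub raddfB.
Qed.

HB.instance Definition _ := Uniform_isComplete.Build E ns_complete.
Definition normsub_complete : completeNormedModType R[i] := E.

End CompleteSub.

(* [0 <= z] in [R[i]] means that [z] is real and nonnegative. *)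
Record semi_inner (R : realType) (V : lmodType R[i]) (f : V -> V -> R[i]) : Prop := {
  sip_linear : forall l u v w, f (l *: u + v) w = l * f u w + f v w ;
  sip_conj : forall u v, f u v = Num.conj (f v u) ;
  sip_ge0 : forall u, 0 <= f u u }.

Section SemiInner.
Variables (R : realType) (V : lmodType R[i]) (f : V -> V -> R[i]).
Hypothesis hf : semi_inner f.
Implicit Types u v w : V.

Definition snorm u : R := Num.sqrt (complex.Re (f u u)).

Lemma sip0l v : f 0 v = 0.
Proof.
by have := sip_linear hf (-1) 0 0 v; rewrite scaler0 addr0 mulN1r addNr.
Qed.

Lemma sipZl l u v : f (l *: u) v = l * f u v.
Proof. by have := sip_linear hf l u 0 v; rewrite addr0 sip0l addr0. Qed.

Lemma sipDl u v w : f (u + v) w = f u w + f v w.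
Proof. by have := sip_linear hf 1 u v w; rewrite scale1r mul1r. Qed.

Lemma sipNl u v : f (- u) v = - f u v.
Proof. by rewrite -scaleN1r sipZl mulN1r. Qed.

Lemma sipBl u v w : f (u - v) w = f u w - f v w.
Proof. by rewrite sipDl sipNl. Qed.

Lemma sip0r v : f v 0 = 0.
Proof. by rewrite (sip_conj hf) sip0l rmorph0. Qed.

Lemma sipZr l u v : f u (l *: v) = Num.conj l * f u v.
Proof. by rewrite (sip_conj hf u (_ *: _)) (sip_conj hf u v) sipZl rmorphM. Qed.

Lemma sipDr u v w : f u (v + w) = f u v + f u w.
Proof. by rewrite (sip_conj hf u (_ + _)) (sip_conj hf u v) (sip_conj hf u w) sipDl rmorphD. Qed.

Lemma sipNr u v : f u (- v) = - f u v.
Proof. by rewrite (sip_conj hf u (- _)) (sip_conj hf u v) sipNl rmorphN. Qed.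

Lemma sipBr u v w : f u (v - w) = f u v - f u w.
Proof. by rewrite sipDr sipNr. Qed.

Lemma sip_suml (I : Type) (r : seq I) (P : pred I) (F : I -> V) v :
  f (\sum_(i <- r | P i) F i) v = \sum_(i <- r | P i) f (F i) v.
Proof. by elim/big_rec2 : _ => [|i x y _ <-]; rewrite ?sip0l ?sipDl. Qed.

Lemma sip_sumr (I : Type) (r : seq I) (P : pred I) (F : I -> V) v :
  f v (\sum_(i <- r | P i) F i) = \sum_(i <- r | P i) f v (F i).
Proof. by elim/big_rec2 : _ => [|i x y _ <-]; rewrite ?sip0r ?sipDr. Qed.

Lemma snorm_ge0 u : 0 <= snorm u. Proof. exact: sqrtr_ge0. Qed.

Lemma sipE u : f u u = (snorm u ^+ 2)%:C.
Proof.
rewrite /snorm sqr_sqrtr -?ReK ?(sip_ge0 hf)//.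
exact: (Re_le (sip_ge0 hf u)).
Qed.

Lemma sip_CS2 u v : rnorm (f u v) ^+ 2 <= snorm u ^+ 2 * snorm v ^+ 2.
Proof.
have Pos (t : R[i]) (s : R) : 0 <= f (t *: u - s%:C *: v) (t *: u - s%:C *: v).
  exact: sip_ge0.
(* Weighting [u] by [Num.conj (f u v)] makes the cross term real, so that positivity becomes a real
   quadratic inequality in [s]. *)
have key (s : R) : 0 <= rnorm (f u v) ^+ 2 * snorm u ^+ 2 -
    2 * s * rnorm (f u v) ^+ 2 + s ^+ 2 * snorm v ^+ 2.
  have := Pos (Num.conj (f u v)) s.
  rewrite sipBl !sipBr !sipZl !sipZr conjCK (sip_conj hf v u) !sipE.
  have -> : Num.conj s%:C = s%:C :> R[i] by rewrite conjE conjc_real.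
  set z := f u v.
  have zz : Num.conj z * z = (rnorm z ^+ 2)%:C.
    by rewrite mulrC -normCK rnormE -rmorphXn.
  rewrite -[X in 0 <= X](_ : (rnorm z ^+ 2 * snorm u ^+ 2 -
    2 * s * rnorm z ^+ 2 + s ^+ 2 * snorm v ^+ 2)%:C = _) ?ler0c//.
  transitivity ((rnorm z ^+ 2)%:C * (snorm u ^+ 2)%:C -
    2 * s%:C * (rnorm z ^+ 2)%:C + s%:C ^+ 2 * (snorm v ^+ 2)%:C); last first.
    by rewrite -zz; ring.
  move: (rnorm z ^+ 2) (snorm u ^+ 2) (snorm v ^+ 2) => a b c.
  by rewrite rmorphD rmorphB !rmorphM rmorph_nat.
have [v0|v0] := eqVneq (snorm v ^+ 2) 0.
  (* For null [v] the inequality is affine in [s], and any [s] above half of [snorm u ^+ 2] forces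
     [f u v] to vanish. *)
  have := key (1 + snorm u ^+ 2); rewrite v0 mulr0 addr0 mulr0.
  have := sqr_ge0 (rnorm (f u v)); have := sqr_ge0 (snorm u).
  set a := _ ^+ 2; set b := _ ^+ 2 => a0 b0; nra.
have vp : 0 < snorm v ^+ 2 by rewrite lt_neqAle eq_sym v0 sqr_ge0.
(* The minimiser of the quadratic. *)
have := key (rnorm (f u v) ^+ 2 / snorm v ^+ 2).
have [z0|z0] := eqVneq (rnorm (f u v) ^+ 2) 0.
  by rewrite z0 mulr_ge0// sqr_ge0.
have zp : 0 < rnorm (f u v) ^+ 2 by rewrite lt_neqAle eq_sym z0 sqr_ge0.
set a := rnorm _ ^+ 2 in zp *; set b := snorm v ^+ 2 in vp *.
set c := snorm u ^+ 2.
rewrite (_ : _ + _ = a * (c - a / b)); last by field; rewrite gt_eqF.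
by rewrite pmulr_rge0// subr_ge0 ler_pdivrMr.
Qed.

Lemma sip_CS u v : rnorm (f u v) <= snorm u * snorm v.
Proof.
rewrite -(@ler_pXn2r _ 2) ?nnegrE ?mulr_ge0 ?snorm_ge0 ?rnorm_ge0//.
by rewrite exprMn sip_CS2.
Qed.

Lemma snormE u : snorm u ^+ 2 = complex.Re (f u u).
Proof. by rewrite sipE. Qed.

Lemma snormZ l u : snorm (l *: u) = rnorm l * snorm u.
Proof.
have h : snorm (l *: u) ^+ 2 = (rnorm l * snorm u) ^+ 2.
  apply: (@complexI R); rewrite -sipE sipZl sipZr sipE mulrA -normCK rnormE.
  by rewrite exprMn [RHS]rmorphM -[in LHS]rmorphXn.
by move/eqP: h; rewrite eqrXn2 ?mulr_ge0 ?snorm_ge0 ?rnorm_ge0// => /eqP.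
Qed.

Lemma snormN u : snorm (- u) = snorm u.
Proof. by rewrite /snorm sipNl sipNr opprK. Qed.

Lemma snormD2 u v :
  snorm (u + v) ^+ 2 = snorm u ^+ 2 + 2 * complex.Re (f u v) + snorm v ^+ 2.
Proof.
rewrite !snormE sipDl !sipDr (sip_conj hf v u).
by case: (f u u) (f u v) (f v v) => [? ?] [? ?] [? ?] /=; ring.
Qed.

Lemma snormD u v : snorm (u + v) <= snorm u + snorm v.
Proof.
rewrite -(@ler_pXn2r _ 2) ?nnegrE ?addr_ge0 ?snorm_ge0// snormD2 sqrrD.
have := le_trans (Re_rnorm _) (sip_CS u v); lra.
Qed.

Lemma snorm0 : snorm 0 = 0.
Proof. by rewrite /snorm sip0l sqrtr0. Qed.

Lemma snormB2 u v :
  snorm (u - v) ^+ 2 = snorm u ^+ 2 - 2 * complex.Re (f u v) + snorm v ^+ 2.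
Proof. by rewrite snormD2 snormN sipNr raddfN mulrN. Qed.

Lemma snorm_sum (I : Type) (r : seq I) (P : pred I) (F : I -> V) :
  snorm (\sum_(i <- r | P i) F i) <= \sum_(i <- r | P i) snorm (F i).
Proof.
elim/big_rec2 : _ => [|i y x _ h]; first by rewrite snorm0.
by apply: le_trans (snormD _ _) _; rewrite lerD2l.
Qed.

Lemma snorm_dist w u v : snorm (u - v) <= snorm (u - w) + snorm (w - v).
Proof. by rewrite -[u - v](subrKA w); exact: snormD. Qed.

Lemma snorm_distC u v : snorm (u - v) = snorm (v - u).
Proof. by rewrite -snormN opprB. Qed.

End SemiInner.

(** * Completion to a Hilbert space *)

Lemma quarter2 (R : realFieldType) (e : R) : 0 < e -> e / 4 + e / 4 <= e.
Proof. by move=> e0; lra. Qed.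

Lemma quarter3 (R : realFieldType) (e : R) :
  0 < e -> e / 4 + (e / 4 + e / 4) <= e.
Proof. by move=> e0; lra. Qed.

Definition sip_cauchy (R : realType) (V : lmodType R[i]) (f : V -> V -> R[i])
    (u : nat -> V) :=
  forall e : R, 0 < e -> exists N, forall m n, (N <= m)%N -> (N <= n)%N ->
    snorm f (u m - u n) < e.

Section HilbertOf.
Variables (R : realType) (V : lmodType R[i]) (f : V -> V -> R[i]).
Hypotheses (hf : semi_inner f) (hd : forall u, f u u = 0 -> u = 0)
  (hc : forall u, sip_cauchy f u -> exists a, forall e : R, 0 < e ->
     exists N, forall n, (N <= n)%N -> snorm f (u n - a) < e).

Definition hilbert_carrier of semi_inner f & (forall u, f u u = 0 -> u = 0) &
  (forall u, sip_cauchy f u -> exists a, forall e : R, 0 < e ->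
     exists N, forall n, (N <= n)%N -> snorm f (u n - a) < e) : Type := V.
Local Notation H := (hilbert_carrier hf hd hc).
HB.instance Definition _ := GRing.Lmodule.copy H V.

Let h_norm (v : H) : R[i] := (snorm f v)%:C.
Let h_normD (u v : H) : h_norm (u + v) <= h_norm u + h_norm v.
Proof. by rewrite /h_norm -rmorphD lecR (snormD hf). Qed.
Let h_normZ l (u : H) : h_norm (l *: u) = `|l| * h_norm u.
Proof. by rewrite /h_norm rnormE -rmorphM (snormZ hf). Qed.
Let h_norm0 (u : H) : h_norm u = 0 -> u = 0.
Proof. by move=> /complexI u0; apply: hd; rewrite (sipE hf) u0 expr0n. Qed.

HB.instance Definition _ := Lmodule_isNormed.Build R[i] H h_normD h_normZ h_norm0.

Let h_complete : forall F : set_system H, ProperFilter F -> cauchy F -> cvg F.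
Proof. by apply: cauchys_complete => u cu; exact: (hc cu). Qed.

HB.instance Definition _ := Uniform_isComplete.Build H h_complete.

Definition hilbert_dot (u v : H) : R[i] := f u v.

Let dot_bil : bilinear_for ( *%R ) (@Num.conj R[i] \; *%R) hilbert_dot.
Proof.
split=> [v l a b|u l a b]; first exact: (sip_linear hf).
by rewrite /hilbert_dot (sipDr hf) (sipZr hf).
Qed.
HB.instance Definition _ := bilinear_isBilinear.Build _ _ _ _ _ _ hilbert_dot dot_bil.
Let dot_herm (x y : H) : hilbert_dot x y = (-1) ^+ false * Num.conj (hilbert_dot y x).
Proof. by rewrite expr0 mul1r; exact: (sip_conj hf). Qed.
HB.instance Definition _ := isHermitianSesquilinear.Build _ _ _ _ hilbert_dot dot_herm.
Let dot_pos (u : H) : u != 0 -> 0 < hilbert_dot u u.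
Proof.
move=> u0; rewrite lt_neqAle (sip_ge0 hf) andbT eq_sym.
by apply: contra_neq u0; exact: hd.
Qed.
HB.instance Definition _ := isDotProduct.Build _ _ hilbert_dot dot_pos.

Let dotE (x : H) : hilbert_dot x x = `|x| ^+ 2.
Proof. by rewrite rnormE -rmorphXn /hilbert_dot (sipE hf). Qed.

HB.instance Definition _ := CompleteNormedModule_isHilbert.Build R H dotE.
Definition hilbert_of : hilbertType R := H.

End HilbertOf.

Section HilbertTheory.
Variables (R : realType) (H : hilbertType R).
Implicit Types x y z : H.

Lemma hdot_sip : semi_inner (fun x y : H => hdot x y).
Proof.
split=> [l u v w|u v|u]; first by rewrite linearPl.
- by rewrite hermC expr0 mul1r.
- by rewrite hdotE exprn_ge0.
Qed.

Lemma hnormE x : snorm (fun x y : H => hdot x y) x = rnorm x.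
Proof. by rewrite /snorm hdotE rnormE -rmorphXn /= sqrtr_sqr ger0_norm// rnorm_ge0. Qed.

Lemma hdotxx x : hdot x x = (rnorm x ^+ 2)%:C.
Proof. by rewrite hdotE rnormE -rmorphXn. Qed.

Lemma hdot_CS x y : rnorm (hdot x y) <= rnorm x * rnorm y.
Proof. by have := sip_CS hdot_sip x y; rewrite !hnormE. Qed.

Lemma hdotC x y : hdot x y = Num.conj (hdot y x).
Proof. exact: (sip_conj hdot_sip). Qed.

Lemma hdotDl x y z : hdot (x + y) z = hdot x z + hdot y z.
Proof. exact: (sipDl hdot_sip). Qed.
Lemma hdotDr x y z : hdot z (x + y) = hdot z x + hdot z y.
Proof. exact: (sipDr hdot_sip). Qed.
Lemma hdotBl x y z : hdot (x - y) z = hdot x z - hdot y z.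
Proof. exact: (sipBl hdot_sip). Qed.
Lemma hdotBr x y z : hdot z (x - y) = hdot z x - hdot z y.
Proof. exact: (sipBr hdot_sip). Qed.
Lemma hdotZl l x y : hdot (l *: x) y = l * hdot x y.
Proof. exact: (sipZl hdot_sip). Qed.
Lemma hdotZr l x y : hdot x (l *: y) = Num.conj l * hdot x y.
Proof. exact: (sipZr hdot_sip). Qed.
Lemma hdot0l x : hdot 0 x = 0. Proof. exact: (sip0l hdot_sip). Qed.
Lemma hdot0r x : hdot x 0 = 0. Proof. exact: (sip0r hdot_sip). Qed.
Lemma hdot_suml (I : Type) (r : seq I) (P : pred I) (F : I -> H) v :
  hdot (\sum_(i <- r | P i) F i) v = \sum_(i <- r | P i) hdot (F i) v.
Proof. exact: (sip_suml hdot_sip). Qed.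
Lemma hdot_sumr (I : Type) (r : seq I) (P : pred I) (F : I -> H) v :
  hdot v (\sum_(i <- r | P i) F i) = \sum_(i <- r | P i) hdot v (F i).
Proof. exact: (sip_sumr hdot_sip). Qed.

Lemma hdot_eq0 x : (forall y, hdot y x = 0) -> x = 0.
Proof.
move=> /(_ x); rewrite hdotxx => /complexI/eqP.
by rewrite sqrf_eq0 => /eqP/rnorm_eq0.
Qed.

Lemma hdot_inj x y : (forall z, hdot z x = hdot z y) -> x = y.
Proof.
move=> h; apply/eqP; rewrite -subr_eq0; apply/eqP/hdot_eq0 => z.
by rewrite hdotBr h subrr.
Qed.

Lemma cvs_hdot (u v : nat -> H) a b : cvs u a -> cvs v b ->
  cvs (fun n => hdot (u n) (v n) : R[i]) (hdot a b).
Proof.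
move=> ua vb e e0.
have [c c0 uc] := cauchys_bounded (cvs_cauchy ua).
pose k := c + rnorm b + 1.
have k0 : 0 < k by rewrite ltr_wpDl ?addr_ge0 ?rnorm_ge0.
have d0 : 0 < e / 2 / k by rewrite !divr_gt0.
have [N1 h1] := ua _ d0; have [N2 h2] := vb _ d0.
exists (maxn N1 N2) => n; rewrite geq_max => /andP[/h1 A /h2 B].
rewrite (_ : _ - _ = hdot (u n) (v n - b) + hdot (u n - a) b); last first.
  by rewrite hdotBr hdotBl addrA subrK.
apply: le_lt_trans (rnormD _ _) _.
have C1 := hdot_CS (u n) (v n - b); have C2 := hdot_CS (u n - a) b.
have : rnorm (u n) * rnorm (v n - b) <= c * (e / 2 / k).
  by apply: ler_pM; rewrite ?rnorm_ge0// ltW.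
have : rnorm (u n - a) * rnorm b <= e / 2 / k * rnorm b.
  by rewrite ler_wpM2r ?rnorm_ge0// ltW.
have : e / 2 / k * k = e / 2 by rewrite mulfVK ?gt_eqF.
move: C1 C2 d0; move: (e / 2 / k) => d; rewrite /k; lra.
Qed.

End HilbertTheory.

Section Completion.
Variables (R : realType) (V : lmodType R[i]) (f : V -> V -> R[i]).
Hypothesis hf : semi_inner f.

(* The completion is realised inside the space of functions on [V], as the
   limits of the functions [f u_n] for [u] Cauchy: no quotient is needed, since
   vectors of seminorm zero represent the zero function. *)
Definition represents (u : nat -> V) (phi : V -> R[i]^o) :=
  sip_cauchy f u /\ forall w, cvs (fun n => f (u n) w : R[i]) (phi w).

Let D : set (V -> R[i]^o) := [set phi | exists u, represents u phi].

Lemma represents_cst v : represents (fun=> v) (f v).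
Proof.
split=> [e e0|w]; last exact: cvs_cst.
by exists 0%N => *; rewrite subrr (snorm0 hf).
Qed.

Lemma representsP l u v phi psi : represents u phi -> represents v psi ->
  represents (fun n => l *: u n + v n) (l *: phi + psi).
Proof.
move=> [cu hu] [cv hv]; split=> [e e0|w]; last first.
  apply: eq_cvs (cvsD (cvsM (cvs_cst l) (hu w)) (hv w)) => n.
  by rewrite (sip_linear hf).
have e2 : 0 < e / 2 by rewrite divr_gt0.
have p : 0 < rnorm l + 1 by rewrite ltr_wpDl ?rnorm_ge0.
have [N1 h1] := cu _ (divr_gt0 e2 p); have [N2 h2] := cv _ e2.
exists (maxn N1 N2) => m n; rewrite !geq_max => /andP[m1 m2] /andP[n1 n2].
rewrite opprD addrACA -scalerBr; apply: le_lt_trans (snormD hf _ _) _.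
have := h1 _ _ m1 n1; rewrite ltr_pdivlMr// (snormZ hf) => A.
have := h2 _ _ m2 n2; have := snorm_ge0 f (u m - u n); nra.
Qed.

Lemma representsB u v phi psi : represents u phi -> represents v psi ->
  represents (fun n => u n - v n) (phi - psi).
Proof.
move=> hu hv; have := representsP (-1) hv hu.
rewrite (_ : -1 *: psi + phi = phi - psi); last by rewrite scaleN1r addrC.
rewrite (_ : (fun n => -1 *: v n + u n) = (fun n => u n - v n))//.
by apply/funext => n; rewrite scaleN1r addrC.
Qed.

Let Dsub : is_linsub D.
Proof.
split=> [|l phi psi [u hu] [v hv]]; last by exists (fun n => l *: u n + v n); exact: representsP.
exists (fun=> 0); split=> [e e0|w]; first by exists 0%N => *; rewrite subrr (snorm0 hf).
by apply: eq_cvs (cvs_cst 0) => n; rewrite (sip0l hf).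
Qed.

Let W : lmodType R[i] := linsub Dsub.
Let rep (phi : W) : nat -> V := sval (cid (linsub_mem phi)).
Let repP (phi : W) : represents (rep phi) (val phi).
Proof. by rewrite /rep; case: cid. Qed.

Lemma sip_cauchy_bounded u : sip_cauchy f u ->
  exists2 c : R, 0 < c & forall n, snorm f (u n) <= c.
Proof.
move=> /(_ 1 ltr01)[N h].
exists (\sum_(i < N.+1) snorm f (u i) + 1) => [|n].
  by rewrite ltr_wpDl// sumr_ge0// => i _; exact: snorm_ge0.
have [nN|Nn] := leqP n N.
  have nN' : (n < N.+1)%N by [].
  rewrite (bigD1 (Ordinal nN'))//= -addrA lerDl addr_ge0// sumr_ge0// => i _.
  exact: snorm_ge0.
rewrite -[u n](subrK (u N)) addrC; apply: le_trans (snormD hf _ _) _.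
apply: lerD; last exact/ltW/h/leqnn/ltnW.
rewrite (bigD1 (@ord_max N))//= lerDl sumr_ge0// => i _; exact: snorm_ge0.
Qed.

Lemma represents_form_cauchy u v phi psi : represents u phi -> represents v psi ->
  cauchys (fun n => f (u n) (v n) : R[i]).
Proof.
move=> [cu _] [cv _] e e0.
have [c c0 uc] := sip_cauchy_bounded cu; have [d d0 vd] := sip_cauchy_bounded cv.
have e2 : 0 < e / 2 by rewrite divr_gt0.
have [N1 h1] := cu _ (divr_gt0 e2 d0); have [N2 h2] := cv _ (divr_gt0 e2 c0).
exists (maxn N1 N2) => m n; rewrite !geq_max => /andP[m1 m2] /andP[n1 n2].
have := h1 _ _ m1 n1; rewrite ltr_pdivlMr// => A.
have := h2 _ _ m2 n2; rewrite ltr_pdivlMr// => B.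
rewrite (_ : _ - _ = f (u m - u n) (v m) + f (u n) (v m - v n)); last first.
  by rewrite (sipBl hf) (sipBr hf) addrA subrK.
apply: le_lt_trans (rnormD _ _) _.
have C1 := sip_CS hf (u m - u n) (v m); have C2 := sip_CS hf (u n) (v m - v n).
have := ler_wpM2l (snorm_ge0 f (u m - u n)) (vd m).
have := ler_wpM2r (snorm_ge0 f (v m - v n)) (uc n).
lra.
Qed.

(** Freeze [v] at a late index: the remainder is small because [v] is Cauchy and [u] bounded, and
    against a fixed vector [u] tends to 0 by assumption. Hence the inner product of two limits does
    not depend on the sequences that represent them. *)
Lemma represents_small u v phi : represents u (0 : V -> R[i]^o) -> represents v phi ->
  cvs (fun n => f (u n) (v n) : R[i]) 0.
Proof.
move=> [cu hu] [cv _] e e0.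
have [c c0 uc] := sip_cauchy_bounded cu.
have e2 : 0 < e / 2 by rewrite divr_gt0.
have [N1 h1] := cv _ (divr_gt0 e2 c0); have [N2 h2] := hu (v N1) _ e2.
exists (maxn N1 N2) => n; rewrite geq_max => /andP[n1 n2].
have := h2 _ n2; rewrite !subr0 => A.
have := h1 _ _ n1 (leqnn _); rewrite ltr_pdivlMr// => B.
rewrite -[v n](subrK (v N1)) addrC (sipDr hf).
apply: le_lt_trans (rnormD _ _) _.
have C := sip_CS hf (u n) (v n - v N1).
have := ler_wpM2r (snorm_ge0 f (v n - v N1)) (uc n).
lra.
Qed.

Let dot (phi psi : W) : R[i] :=
  sval (cid (cauchys_cvsC (represents_form_cauchy (repP phi) (repP psi)))).
Let dotP (phi psi : W) : cvs (fun n => f (rep phi n) (rep psi n) : R[i]) (dot phi psi).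
Proof. by rewrite /dot; case: cid. Qed.

Let dot_rep (phi psi : W) u v : represents u (val phi) -> represents v (val psi) ->
  cvs (fun n => f (u n) (v n) : R[i]) (dot phi psi).
Proof.
move=> hu hv.
have zu : represents (fun n => (-1) *: rep phi n + u n) (0 : V -> R[i]^o).
  by have := representsP (-1) (repP phi) hu; rewrite [in X in represents _ X]scaleN1r addNr.
have zv : represents (fun n => (-1) *: rep psi n + v n) (0 : V -> R[i]^o).
  by have := representsP (-1) (repP psi) hv; rewrite [in X in represents _ X]scaleN1r addNr.
have A := represents_small zu hv.
have B := cvsJ (represents_small zv (repP phi)).
rewrite -[dot _ _](add0r) -[_ + _](add0r) -{2}(rmorph0 (@Num.conj R[i])).
apply: eq_cvs (cvsD A (cvsD B (dotP phi psi))) => n.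
rewrite -(sip_conj hf) !scaleN1r (sipDl hf) (sipDr hf) (sipNl hf) (sipNr hf).
by ring.
Qed.

Let dot_sip : semi_inner dot.
Proof.
split=> [l phi psi chi|phi psi|phi].
- have h := representsP l (repP phi) (repP psi).
  have := dot_rep (phi := l *: phi + psi) (psi := chi) _ (repP chi).
  move=> /(_ (fun n => l *: rep phi n + rep psi n)).
  rewrite val_linsubP => /(_ h) h1; apply: (cvs_unique h1).
  apply: eq_cvs (cvsD (cvsM (cvs_cst l) (dotP phi chi)) (dotP psi chi)) => n.
  by rewrite (sip_linear hf).
- apply: (cvs_unique (dotP phi psi)).
  by apply: eq_cvs (cvsJ (dotP psi phi)) => n; rewrite -(sip_conj hf).
- by apply: cvs_ge0 (dotP phi phi) _ => n; exact: (sip_ge0 hf).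
Qed.

Let dot_def (phi : W) : dot phi phi = 0 -> phi = 0.
Proof.
move=> p0; apply: val_inj; rewrite raddf0; apply/funext => w.
have [_ hw] := repP phi; apply: cvs_unique (hw w) _ => e e0.
have p : 0 < e / (snorm f w + 1).
  by rewrite divr_gt0// ltr_wpDl// snorm_ge0.
have := dotP phi phi; rewrite p0 => /(_ _ (exprn_gt0 2 p))[N hN].
exists N => n /hN; rewrite !subr0 (sipE hf) rnormR ger0_norm ?sqr_ge0//.
rewrite ltr_pXn2r ?nnegrE ?snorm_ge0 ?(ltW p)// => A.
apply: le_lt_trans (sip_CS hf _ _) _; move: A.
rewrite ltr_pdivlMr; last by rewrite ltr_wpDl// snorm_ge0.
have := snorm_ge0 f (rep phi n); nra.
Qed.

Let D_cst v : D (f v). Proof. by exists (fun=> v); exact: represents_cst. Qed.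
Let incl (v : V) : W := to_linsub Dsub (D_cst v).

Let incl_linear l u v : incl (l *: u + v) = l *: incl u + incl v.
Proof.
apply: val_inj; rewrite val_linsubP !to_linsubK.
by apply/funext => w; rewrite (sip_linear hf).
Qed.

Let dot_incl u v : dot (incl u) (incl v) = f u v.
Proof.
have := dot_rep (phi := incl u) (psi := incl v) (represents_cst u) (represents_cst v).
by move=> /cvs_unique; apply; exact: cvs_cst.
Qed.

Let incl_lim (phi : W) (e : R) : 0 < e -> exists N, forall n, (N <= n)%N ->
  snorm dot (phi - incl (rep phi n)) < e.
Proof.
move=> e0; have e2 : 0 < e / 2 by rewrite divr_gt0.
have [cr _] := repP phi; have [N hN] := cr _ e2.
exists N => n Nn.
have h : represents (fun m => rep phi m - rep phi n) (val (phi - incl (rep phi n))).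
  by rewrite val_linsubB; exact: representsB (repP phi) (represents_cst _).
have A := dot_rep h h.
have : rnorm (dot (phi - incl (rep phi n)) (phi - incl (rep phi n))) <= (e / 2) ^+ 2.
  (* [cvs_le] asks for a bound at every index, whence the shift by [N]. *)
  have A' : cvs (fun m => f (rep phi (m + N) - rep phi n) (rep phi (m + N) - rep phi n)
      : R[i]) (dot (phi - incl (rep phi n)) (phi - incl (rep phi n))).
    by move=> d /A[M hM]; exists M => m Mm; apply: hM; exact: leq_trans (leq_addr _ _).
  apply: (cvs_le A') => m; rewrite (sipE hf) rnormR ger0_norm ?sqr_ge0//.
  by rewrite ler_pXn2r ?nnegrE ?snorm_ge0 ?(ltW e2)// ltW// hN// leq_addl.
rewrite (sipE dot_sip) rnormR ger0_norm ?sqr_ge0//.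
rewrite ler_pXn2r ?nnegrE ?snorm_ge0 ?(ltW e2)// => /le_lt_trans; apply.
by rewrite ltr_pdivrMr// ltr_pMr// ltr1n.
Qed.

Let snorm_incl v : snorm dot (incl v) = snorm f v.
Proof. by rewrite /snorm dot_incl. Qed.

(** Replace each [u n] by a vector of [V] at distance less than 1/(n+1). The new sequence is Cauchy
    in [V], and the function that it represents is the limit. *)
Let dot_complete (u : nat -> W) : sip_cauchy dot u -> exists a, forall e : R, 0 < e ->
     exists N, forall n, (N <= n)%N -> snorm dot (u n - a) < e.
Proof.
move=> cu.
have hex n : exists v : V, snorm dot (u n - incl v) < n.+1%:R^-1.
  have [|N /(_ N (leqnn _)) h] := @incl_lim (u n) n.+1%:R^-1; first by rewrite invr_gt0.
  by exists (rep (u n) N).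
pose v n := sval (cid (hex n)).
have hv n : snorm dot (u n - incl (v n)) < n.+1%:R^-1 by rewrite /v; case: cid.
have cv : sip_cauchy f v.
  move=> e e0; have e4 : 0 < e / 4 by rewrite divr_gt0.
  have [N1 h1] := invS_small e4; have [N2 h2] := cu _ e4.
  exists (maxn N1 N2) => m n; rewrite !geq_max => /andP[m1 m2] /andP[n1 n2].
  rewrite -snorm_incl (_ : incl _ = incl (v m) - incl (v n)); last first.
    by rewrite addrC -scaleN1r incl_linear scaleN1r addrC.
  have A := snorm_dist dot_sip (u m) (incl (v m)) (incl (v n)).
  have B := snorm_dist dot_sip (u n) (u m) (incl (v n)).
  rewrite (snorm_distC dot_sip _ (u m)) in A.
  have Am := lt_trans (hv m) (h1 _ m1); have An := lt_trans (hv n) (h1 _ n1).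
  apply: le_lt_trans A _.
  apply: lt_le_trans (ltrD Am (le_lt_trans B (ltrD (h2 _ _ m2 n2) An))) _.
  exact: quarter3.
have hl w : exists z, cvs (fun n => f (v n) w : R[i]) z.
  apply: cauchys_cvsC => e e0.
  have p : 0 < snorm f w + 1 by rewrite ltr_wpDl// snorm_ge0.
  have [N h] := cv _ (divr_gt0 e0 p); exists N => m n m1 n1.
  have := h _ _ m1 n1; rewrite -(sipBl hf) ltr_pdivlMr// => A.
  apply: le_lt_trans (sip_CS hf _ _) _.
  have := snorm_ge0 f (v m - v n); nra.
pose phi : V -> R[i]^o := fun w => sval (cid (hl w)).
have rphi : represents v phi by split=> // w; rewrite /phi; case: cid.
have Dphi : D phi by exists v.
exists (to_linsub Dsub Dphi) => e e0.
have e4 : 0 < e / 4 by rewrite divr_gt0.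
have [N1 h1] := invS_small e4; have [N2 h2] := cv _ e4.
exists (maxn N1 N2) => n; rewrite geq_max => /andP[n1 n2].
set a := to_linsub _ _.
have ra : represents (fun m => v n - v m) (val (incl (v n) - a)).
  by rewrite val_linsubB; exact: representsB (represents_cst _) rphi.
have A := dot_rep ra ra.
have : rnorm (dot (incl (v n) - a) (incl (v n) - a)) <= (e / 4) ^+ 2.
  have A' : cvs (fun m => f (v n - v (m + N2)%N) (v n - v (m + N2)%N)
      : R[i]) (dot (incl (v n) - a) (incl (v n) - a)).
    by move=> d /A[M hM]; exists M => m Mm; apply: hM; exact: leq_trans (leq_addr _ _).
  apply: (cvs_le A') => m; rewrite (sipE hf) rnormR ger0_norm ?sqr_ge0//.
  by rewrite ler_pXn2r ?nnegrE ?snorm_ge0 ?(ltW e4)// ltW// h2// leq_addl.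
rewrite (sipE dot_sip) rnormR ger0_norm ?sqr_ge0//.
rewrite ler_pXn2r ?nnegrE ?snorm_ge0 ?(ltW e4)// => B.
apply: le_lt_trans (snorm_dist dot_sip (incl (v n)) (u n) a) _.
apply: lt_le_trans (ltr_leD (lt_trans (hv n) (h1 _ n1)) B) _.
exact: quarter2.
Qed.

Lemma hilbert_completion : exists (H : hilbertType R) (i : V -> H),
  [/\ linear i, forall u v, hdot (i u) (i v) = f u v & dense (range i)].
Proof.
exists (hilbert_of dot_sip dot_def dot_complete), incl.
split; [exact: incl_linear|exact: dot_incl|apply/dense_dist => phi e].
move=> /(incl_lim phi)[N /(_ N (leqnn _)) h].
by exists (incl (rep phi N)) => //; exists (rep phi N).
Qed.

End Completion.

(** * Bounded operators and representations *)

(** The first-order condition at an approximate minimum: [m] is the infimum of the functional, [i]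
    the defect of a vector with value [q - 2 * p], [t] a step in a direction of squared norm [x],
    and [a - b] half the derivative. The optimal step would have denominator [x]; taking [x + 1]
    spares the case of the zero direction. *)
Lemma riesz_aux (R : realFieldType) (q p m i t a b x : R) : 0 < x + 1 ->
  q - 2 * p < m + i ->
  m <= q + 2 * (t * a) + t ^+ 2 * x - 2 * (p + t * b) ->
  t * (x + 1) = - (a - b) -> (a - b) ^+ 2 <= (x + 1) * i.
Proof.
move=> k0 A B tk.
have D : - i <= t * (a - b).
  have : t ^+ 2 * x = t * (t * (x + 1)) - t ^+ 2 by ring.
  rewrite tk => E; have := sqr_ge0 t; move: B; rewrite E; lra.
have : (x + 1) * (- i) <= (x + 1) * (t * (a - b)) by rewrite ler_pM2l.
rewrite (_ : _ * (t * _) = t * (x + 1) * (a - b)); last by ring.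
by rewrite tk mulrN mulNr lerN2 -expr2.
Qed.

Section Operators.
Variable R : realType.

Section Linear.
Variables (V W : lmodType R[i]) (f : V -> W) (hf : linear f).

Lemma lin0 : f 0 = 0.
Proof.
by have := hf (-1) 0 0; rewrite scaler0 addr0 scaleN1r addNr.
Qed.
Lemma linZ l u : f (l *: u) = l *: f u.
Proof. by have := hf l u 0; rewrite addr0 lin0 addr0. Qed.
Lemma linD u v : f (u + v) = f u + f v.
Proof. by have := hf 1 u v; rewrite !scale1r. Qed.
Lemma linN u : f (- u) = - f u.
Proof. by rewrite -scaleN1r linZ scaleN1r. Qed.
Lemma linB u v : f (u - v) = f u - f v.
Proof. by rewrite linD linN. Qed.
Lemma lin_sum (I : Type) (r : seq I) (P : pred I) (F : I -> V) :
  f (\sum_(i <- r | P i) F i) = \sum_(i <- r | P i) f (F i).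
Proof. by elim/big_rec2 : _ => [|i x y _ <-]; rewrite ?lin0 ?linD. Qed.

End Linear.

Section Opnorm.
Variables (V W : normedModType R[i]).
Implicit Types f g : V -> W.

Lemma opnorm_le f c : 0 <= c -> (forall x, rnorm (f x) <= c * rnorm x) ->
  (opnorm f <= c%:E)%E.
Proof.
move=> c0 h; apply: ge_ereal_sup => _ [x /= x1 <-]; rewrite lee_fin.
by apply: le_trans (h x) _; rewrite ler_piMr.
Qed.

Lemma opnorm_bound f c x : linear f -> (opnorm f <= c%:E)%E ->
  rnorm (f x) <= c * rnorm x.
Proof.
move=> lf h; have [x0|x0] := eqVneq (rnorm x) 0.
  by rewrite x0 (rnorm_eq0 x0) (lin0 lf) rnorm0 mulr0.
have xp : 0 < rnorm x by rewrite lt_neqAle eq_sym x0 rnorm_ge0.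
have : ((rnorm (f (((rnorm x)^-1)%:C *: x)))%:E <= c%:E)%E.
  apply: le_trans h; apply: ereal_sup_ubound; exists (((rnorm x)^-1)%:C *: x) => //=.
  by rewrite rnormZ rnormR ger0_norm ?invr_ge0 ?rnorm_ge0// mulVf.
rewrite (linZ lf) lee_fin rnormZ rnormR ger0_norm ?invr_ge0 ?rnorm_ge0//.
by rewrite ler_pdivrMl// mulrC.
Qed.

Lemma opnorm_ge0 f : linear f -> (0 <= opnorm f)%E.
Proof.
move=> lf; apply: ereal_sup_ubound; exists 0 => /=; first by rewrite rnorm0.
by rewrite (lin0 lf) rnorm0.
Qed.

Lemma bounded_operatorP f : bounded_operator f <->
  linear f /\ exists2 c : R, 0 <= c & forall x, rnorm (f x) <= c * rnorm x.
Proof.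
split=> [[lf fo]|[lf [c c0 h]]]; split=> //.
  exists (fine (opnorm f)); first by rewrite fine_ge0// opnorm_ge0.
  by move=> x; apply: opnorm_bound; rewrite ?fineK// ge0_fin_numE// opnorm_ge0.
by apply: le_lt_trans (opnorm_le c0 h) _; rewrite ltry.
Qed.

Lemma cvs_bounded f c (u : nat -> V) a : linear f -> (forall x, rnorm (f x) <= c * rnorm x) ->
  cvs u a -> cvs (fun n => f (u n)) (f a).
Proof.
move=> lf hf ua e e0.
have p : 0 < `|c| + 1 by rewrite ltr_wpDl.
have [N h] := ua _ (divr_gt0 e0 p); exists N => n /h.
rewrite ltr_pdivlMr// -(linB lf) => A; apply: le_lt_trans (hf _) _.
have := ler_norm c; have := rnorm_ge0 (u n - a); nra.
Qed.

End Opnorm.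

Section Extension.
Variables (S : Type) (D : set S) (U : normedModType R[i])
  (W : completeNormedModType R[i]) (f : S -> U) (g : S -> W) (K : R).
Hypotheses (dD : dense (f @` D))
  (hK : forall s t, D s -> D t -> rnorm (g s - g t) <= K * rnorm (f s - f t)).

(** The domain is a set [S] with a map [f] to [U] rather than a subset of [U]: [f] may identify
    elements, and [hK] makes [g] identify them too. It extends operators to a Hilbert space
    completion, and later the corner embedding to the completion of [Cu]. *)
Lemma lipschitz_extension : exists phi : U -> W, forall u s,
  (forall n, D (s n)) -> cvs (f \o s) u -> cvs (g \o s) (phi u).
Proof.
have cc s : (forall n, D (s n)) -> cauchys (f \o s) -> cauchys (g \o s).
  move=> Ds cf e e0; have p : 0 < `|K| + 1 by rewrite ltr_wpDl.
  have [N h] := cf _ (divr_gt0 e0 p); exists N => m n Nm Nn.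
  have := h _ _ Nm Nn; rewrite ltr_pdivlMr// => A.
  apply: le_lt_trans (hK (Ds m) (Ds n)) _; move: A => /=.
  have := ler_norm K; have := rnorm_ge0 (f (s m) - f (s n)); nra.
have hex u : exists w, forall s, (forall n, D (s n)) -> cvs (f \o s) u -> cvs (g \o s) w.
  have [v Dv vu] := dense_cvs u dD.
  pose s n := sval (cid2 (Dv n)).
  have Ds n : D (s n) by rewrite /s; case: cid2.
  have fs n : f (s n) = v n by rewrite /s; case: cid2.
  have su : cvs (f \o s) u by apply: eq_cvs vu => n /=; rewrite fs.
  have [w hw] := cauchys_cvs (cc _ Ds (cvs_cauchy su)).
  exists w => t Dt tu e e0.
  have e2 : 0 < e / 2 by rewrite divr_gt0.
  have p : 0 < `|K| + 1 by rewrite ltr_wpDl.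
  have [N1 h1] := hw _ e2.
  have := cvsB tu su; rewrite subrr => /(_ _ (divr_gt0 e2 p))[N2 h2].
  exists (maxn N1 N2) => n; rewrite geq_max => /andP[/h1 A /h2].
  rewrite subr0 ltr_pdivlMr//= => B.
  apply: le_lt_trans (rdistD (g (s n)) _ _) _; rewrite [ltRHS]splitr.
  apply: ler_ltD A; apply: le_trans (hK (Dt n) (Ds n)) _.
  apply: le_trans (ltW B); rewrite mulrC ler_wpM2l ?rnorm_ge0//.
  by apply: le_trans (ler_norm K) _; rewrite lerDl.
by exists (fun u => sval (cid (hex u))) => u; case: cid.
Qed.

End Extension.

(** * The Riesz representation theorem *)

Section Riesz.
Variables (H : hilbertType R) (phi : H -> R[i]) (c : R).
Hypotheses (phiP : forall l u v, phi (l *: u + v) = l * phi u + phi v)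
  (hc : forall u, rnorm (phi u) <= c * rnorm u).

Let J (v : H) : R := rnorm v ^+ 2 - 2 * complex.Re (phi v).

Let rnormD2 (u v : H) :
  rnorm (u + v) ^+ 2 = rnorm u ^+ 2 + 2 * complex.Re (hdot u v) + rnorm v ^+ 2.
Proof. by have := snormD2 (hdot_sip H) u v; rewrite !hnormE. Qed.

Let phi0 : phi 0 = 0.
Proof. by have := phiP (-1) 0 0; rewrite scaler0 addr0 mulN1r addNr. Qed.
Let phiZ l u : phi (l *: u) = l * phi u.
Proof. by have := phiP l u 0; rewrite addr0 phi0 addr0. Qed.
Let phiD u v : phi (u + v) = phi u + phi v.
Proof. by have := phiP 1 u v; rewrite scale1r mul1r. Qed.

Let ReD (z w : R[i]) : complex.Re (z + w) = complex.Re z + complex.Re w.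
Proof. by case: z; case: w. Qed.
Let ReZ (t : R) (z : R[i]) : complex.Re (t%:C * z) = t * complex.Re z.
Proof. by case: z => a b /=; rewrite mul0r subr0. Qed.

Let J_lb v : - c ^+ 2 <= J v.
Proof.
rewrite /J; have := le_trans (Re_rnorm _) (hc v).
have := sqr_ge0 (rnorm v - c); rewrite sqrrB; lra.
Qed.

Let m := inf (range J).
Let J_inf v : m <= J v.
Proof.
by apply: ge_inf; [exists (- c ^+ 2) => _ [w _ <-]; exact: J_lb | exists v].
Qed.

Let near_min n : exists v, J v < m + n.+1%:R^-1.
Proof.
have := @inf_adherent R (range J) n.+1%:R^-1; case.
- by rewrite invr_gt0.
- split; first by exists (J 0); exists 0.
  by exists (- c ^+ 2) => _ [w _ <-]; exact: J_lb.
- by move=> _ [v _ <-] h; exists v.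
Qed.

(** Variational proof: by the parallelogram identity the vectors that nearly minimise [J] form a
    Cauchy sequence, and the derivative of [J] along it tends to 0, which is the identity for real
    parts. *)
Lemma riesz : exists w : H, forall v, phi v = hdot v w.
Proof.
pose v n := sval (cid (near_min n)).
have hv n : J (v n) < m + n.+1%:R^-1 by rewrite /v; case: cid.
have par (a b : H) : rnorm (a - b) ^+ 2 <= 2 * (J a + J b) - 4 * m.
  have := J_inf ((2^-1 : R)%:C *: (a + b)); rewrite /J rnormZ rnormR phiZ phiD ReZ ReD.
  rewrite exprMn (rnormD2 a b) (rnormD2 a (- b)) rnormN (sipNr (hdot_sip H)).
  rewrite raddfN/= ger0_norm ?invr_ge0//.
  lra.
have cv : cauchys v.
  move=> e e0; have p : 0 < e ^+ 2 / 4 by rewrite divr_gt0// exprn_gt0.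
  have [N h] := invS_small p; exists N => i j Ni Nj.
  rewrite -(@ltr_pXn2r _ 2) ?nnegrE ?rnorm_ge0 ?(ltW e0)//.
  have := par (v i) (v j); have := hv i; have := hv j.
  have := h _ Ni; have := h _ Nj.
  move: (rnorm _ ^+ 2) (J _) (J _) (i.+1%:R^-1) (j.+1%:R^-1) (e ^+ 2).
  by move=> A B C D E F; lra.
have [w hw] := cauchys_cvs cv.
have reE x : complex.Re (phi x) = complex.Re (hdot x w).
  pose d n := complex.Re (hdot x (v n)) - complex.Re (phi x).
  have dn n : d n ^+ 2 <= (rnorm x ^+ 2 + 1) * n.+1%:R^-1.
    have k0 : 0 < rnorm x ^+ 2 + 1 by rewrite ltr_wpDl// sqr_ge0.
    pose t := - d n / (rnorm x ^+ 2 + 1).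
    have := le_trans (J_inf (v n + t%:C *: x)) (lexx _); have := hv n.
    rewrite /J rnormD2 rnormZ rnormR phiD phiZ ReD ReZ exprMn real_normK ?num_real//.
    have -> : complex.Re (hdot (v n) (t%:C *: x)) = t * complex.Re (hdot x (v n)).
      rewrite hdotZr (hdotC (v n) x) !conjE conjc_real ReZ.
      by case: (hdot x (v n)).
    move=> A B; apply: (riesz_aux k0 A B); rewrite /t mulfVK// gt_eqF//.
  have hl := cvs_hdot (cvs_cst x) hw.
  apply/eqP; rewrite -subr_eq0 -normr_eq0 eq_le normr_ge0 andbT.
  apply/ler_addgt0Pl => e e0; rewrite addr0.
  have e2 : 0 < e / 2 by rewrite divr_gt0.
  have k0 : 0 < rnorm x ^+ 2 + 1 by rewrite ltr_wpDl// sqr_ge0.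
  have p : 0 < (e / 2) ^+ 2 / (rnorm x ^+ 2 + 1) by rewrite divr_gt0// exprn_gt0.
  have [N1 h1] := invS_small p; have [N2 h2] := hl _ e2.
  have := h1 _ (leq_maxl N1 N2); have := h2 _ (leq_maxr N1 N2).
  set n := maxn _ _ => A; rewrite ltr_pdivlMr// => B.
  have {}A : `|complex.Re (hdot x (v n)) - complex.Re (hdot x w)| <= e / 2.
    apply: le_trans (ltW A); apply: le_trans (normr_Re _).
    by case: (hdot x (v n)); case: (hdot x w).
  have {}B : `|d n| <= e / 2.
    rewrite -(@ler_pXn2r _ 2) ?nnegrE ?(ltW e2)// real_normK ?num_real//.
    by apply: le_trans (dn n) _; rewrite mulrC ltW.
  rewrite (_ : _ - _ = (complex.Re (hdot x (v n)) - complex.Re (hdot x w)) - d n).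
    by apply: le_trans (ler_normB _ _) _; rewrite [leRHS]splitr lerD.
  by rewrite /d; ring.
(* The imaginary part at [x] is the real part at [- 'i *: x]. *)
exists w => x; have := reE x; have := reE (- 'i%C *: x).
rewrite phiZ hdotZl; case: (phi x) => a b; case: (hdot x w) => a' b' /=.
by rewrite oppr0 !mul0r !mulN1r !opprK !add0r => -> ->.
Qed.

End Riesz.

Section Adjoint.
Variable H : hilbertType R.
Implicit Types f g : H -> H.

Lemma adjoint_eq f g : (forall x y, hdot (f x) y = hdot x (g y)) -> adjoint f = g.
Proof.
move=> h; rewrite /adjoint; set P := [set _ | _].
have ag : P (xget 0 P) by apply: xgetPex; exists g.
apply/funext => y; apply: hdot_inj => x.
by rewrite -ag; exact: h.
Qed.

Lemma adjointP f c : linear f -> (forall x, rnorm (f x) <= c * rnorm x) ->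
  forall x y, hdot (f x) y = hdot x (adjoint f y).
Proof.
move=> lf hc; have hex y : exists w, forall x, hdot (f x) y = hdot x w.
  apply: (@riesz H _ (c * rnorm y)) => [l u v|u]; first by rewrite lf hdotDl hdotZl.
  apply: le_trans (hdot_CS _ _) _; rewrite mulrAC.
  by rewrite ler_wpM2r ?rnorm_ge0.
have h x y : hdot (f x) y = hdot x (sval (cid (hex y))) by case: cid.
by move=> x y; rewrite (adjoint_eq h).
Qed.

Lemma adjoint_linear f c : linear f -> (forall x, rnorm (f x) <= c * rnorm x) ->
  linear (adjoint f).
Proof.
move=> lf hc l u v; apply: hdot_inj => z.
by rewrite hdotDr hdotZr -!(adjointP lf hc) hdotDr hdotZr.
Qed.

Lemma adjoint_bound f c : 0 <= c -> linear f -> (forall x, rnorm (f x) <= c * rnorm x) ->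
  forall x, rnorm (adjoint f x) <= c * rnorm x.
Proof.
move=> c0 lf hc x; have := adjointP lf hc (adjoint f x) x.
rewrite hdotxx => h.
have := hdot_CS (f (adjoint f x)) x; rewrite h rnormR ger0_norm ?sqr_ge0// => A.
have B := ler_wpM2r (rnorm_ge0 x) (hc (adjoint f x)).
have [x0|x0] := eqVneq (rnorm (adjoint f x)) 0.
  by rewrite x0 mulr_ge0 ?rnorm_ge0.
have xp : 0 < rnorm (adjoint f x) by rewrite lt_neqAle eq_sym x0 rnorm_ge0.
by rewrite -(ler_pM2l xp) -expr2; apply: le_trans A _; rewrite mulrCA mulrA.
Qed.

End Adjoint.

(** * From algebraic actions to representations on Hilbert spaces *)

Record sa_closed (A : starAlg R) : Prop := {
  sa_closed_lin : is_linsub (@sa_set R A) ;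
  sa_closed_mul : forall S T : A, sa_set S -> sa_set T -> sa_set (sa_mul S T) ;
  sa_closed_star : forall T : A, sa_set T -> sa_set (sa_star T) }.

(** The common source of the induced and the regular representation. Operators extend by density,
    and each identity passes to the limit along sequences from [V]. Vectors of seminorm zero cause
    no trouble, since the bound makes every [rho T] preserve them. *)
Lemma completed_representation (A : starAlg R) (V : lmodType R[i])
    (f : V -> V -> R[i]) (rho : A -> V -> V) : sa_closed A -> semi_inner f ->
  (forall T, sa_set T -> linear (rho T)) ->
  (forall T, sa_set T -> exists c, forall v, snorm f (rho T v) <= c * snorm f v) ->
  (forall l S T v, sa_set S -> sa_set T -> rho (l *: S + T) v = l *: rho S v + rho T v) ->
  (forall S T v, sa_set S -> sa_set T -> rho (sa_mul S T) v = rho S (rho T v)) ->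
  (forall T u v, sa_set T -> f (rho T u) v = f u (rho (sa_star T) v)) ->
  exists (H : hilbertType R) (pi : A -> H -> H) (i : V -> H),
    [/\ star_representation pi, linear i, forall u v, hdot (i u) (i v) = f u v,
      dense (range i) & forall T v, sa_set T -> pi T (i v) = i (rho T v)].
Proof.
move=> hA hf rlin rbnd rP rM rS.
have [H [i [il idot iden]]] := hilbert_completion hf.
have inorm v : rnorm (i v) = snorm f v by rewrite -hnormE /snorm idot.
have iB u v : rnorm (i u - i v) = snorm f (u - v) by rewrite -(linB il) inorm.
have hex T : exists phi : H -> H, sa_set T -> forall u s,
    cvs (i \o s) u -> cvs (fun n => i (rho T (s n))) (phi u).
  have [ST|] := pselect (sa_set T); last by exists id.
  have [c hc] := rbnd _ ST.
  have lip s t : setT s -> setT t ->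
      rnorm ((i \o rho T) s - (i \o rho T) t) <= c * rnorm (i s - i t).
    by move=> _ _; rewrite /= !iB -(linB (rlin _ ST)); exact: hc.
  have [phi hphi] := lipschitz_extension iden lip.
  by exists phi => _ u s su; apply: hphi.
pose pi T := sval (cid (hex T)).
have hpi T u s : sa_set T -> cvs (i \o s) u -> cvs (fun n => i (rho T (s n))) (pi T u).
  by rewrite /pi; case: cid => /= ? h ST; exact: h.
have dseq u : exists s, cvs (i \o s) u.
  have [v Dv vu] := dense_cvs u iden.
  exists (fun n => sval (cid2 (Dv n))); apply: eq_cvs vu => n /=.
  by case: cid2.
exists H, pi, i; split => // [|T v ST]; last first.
  apply: (@cvs_unique _ _ (fun=> i (rho T v))); last exact: cvs_cst.
  exact: (hpi T (i v) (fun=> v) ST (cvs_cst _)).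
split=> [T ST|l S T SS ST|S T SS ST|T ST x y].
- apply/bounded_operatorP; split=> [l u v|].
    have [s su] := dseq u; have [t tv] := dseq v.
    have := hpi T (l *: u + v) (fun n => l *: s n + t n) ST.
    move=> /(_ _)/cvs_unique; apply.
      by apply: eq_cvs (cvsD (cvsZ l su) tv) => n /=; rewrite il.
    apply: eq_cvs (cvsD (cvsZ l (hpi T u s ST su)) (hpi T v t ST tv)) => n.
    by rewrite (rlin _ ST) il.
  have [c hc] := rbnd _ ST; exists `|c| => // u; have [s su] := dseq u.
  have hs := hpi _ _ _ ST su.
  apply/ler_addgt0Pl => e e0.
  have p : 0 < e / (`|c| + 1) by rewrite divr_gt0// ltr_wpDl.
  have [N h] := su _ p.
  have A' : cvs (fun n => i (rho T (s (n + N)%N))) (pi T u).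
    by move=> d /hs[M hM]; exists M => n Mn; apply: hM; exact: leq_trans (leq_addr _ _).
  apply: (cvs_le A') => n; rewrite inorm; apply: le_trans (hc _) _.
  rewrite -inorm; have := h (n + N)%N (leq_addl _ _).
  rewrite ltr_pdivlMr ?ltr_wpDl//= => B.
  have := rnorm_distl (i (s (n + N)%N)) u; have := rnorm_ge0 (i (s (n + N)%N)).
  have := ler_norm c; have := normr_ge0 c; have := rnorm_ge0 (i (s (n + N)%N) - u).
  move: B; move: (rnorm (i _ - u)) (rnorm (i _)) (rnorm u) `|c| => x y z d; nra.
- apply/funext => u; have [s su] := dseq u.
  apply: cvs_unique (hpi _ _ _ (is_linsubP (sa_closed_lin hA) l SS ST) su) _.
  apply: eq_cvs (cvsD (cvsZ l (hpi _ _ _ SS su)) (hpi _ _ _ ST su)) => n.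
  by rewrite rP// il.
- apply/funext => u; have [s su] := dseq u.
  apply: cvs_unique (hpi _ _ _ (sa_closed_mul hA SS ST) su) _.
  apply: eq_cvs (hpi S _ (fun n => rho T (s n)) SS (hpi _ _ _ ST su)) => n.
  by rewrite rM.
- have [s sx] := dseq x; have [t ty] := dseq y.
  apply: cvs_unique (cvs_hdot (hpi _ _ _ ST sx) ty) _.
  apply: eq_cvs (cvs_hdot sx (hpi _ _ _ (sa_closed_star hA ST) ty)) => n.
  by rewrite /= !idot rS.
Qed.

End Operators.

(** * Finite rank approximation *)

Section TotallyBounded.
Variable R : realType.

(** Centres outside [A] are allowed, so that the notion passes to subsets at once. *)
Definition tbounded (V : normedZmodType R[i]) (A : set V) :=
  forall e : R, 0 < e -> exists s : seq V, forall a, A a ->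
    exists2 p, p \in s & rnorm (a - p) < e.

(** For every radius, an ultrafilter on the closure contains one of the finitely many balls that
    cover it. It is therefore Cauchy, and converges by completeness. *)
Lemma tbounded_precompact (V : completeNormedModType R[i]) (A : set V) :
  tbounded A -> precompact A.
Proof.
move=> tA; rewrite precompactE compact_ultra => F FU FA.
suff cF : cauchy F.
  have Fa : F --> lim F by exact: cauchy_cvg.
  exists (lim F); split => //.
  exact: (@closed_cvg _ _ F _ id (closure A) (@closed_closure _ A) FA _ Fa).
apply/cauchyP => e e0; have er : 0 < complex.Re e.
  by move: e0; rewrite ltcE => /andP[].
have e2 : 0 < complex.Re e / 2 by rewrite divr_gt0.
have [s hs] := tA _ e2.
have : exists2 p, p \in s & F (ball p e).
  have : F (\bigcup_(p in [set` s]) ball p e).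
    apply: filterS FA => x clx.
    have e2C : 0 < (complex.Re e / 2)%:C by rewrite ltcR.
    have [y [Ay yx]] := clx _ (nbhsx_ballx x _ e2C).
    have [p ps yp] := hs _ Ay; exists p => //.
    rewrite -ball_normE /= (ReK (ltW e0)) rnormE ltcR rdistC.
    apply: le_lt_trans (rdistD y _ _) _; rewrite [ltRHS]splitr ltrD//.
    by rewrite -ltcR -rnormE; move: yx; rewrite -ball_normE.
  elim: s {hs} => [|p s IH].
    by move=> F0; have [x [p]] := filter_ex F0.
  move=> Fu; have [Fp|Fnp] := in_ultra_setVsetC (ball p e) FU.
    by exists p => //; rewrite mem_head.
  have [|q qs Fq] := IH; last by exists q => //; rewrite in_cons qs orbT.
  apply: filterS (filterI Fu Fnp) => x [[q /=]].
  by rewrite in_cons => /orP[/eqP -> ? []//|qs qx _]; exists q.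
by move=> [p _ Fp]; exists p.
Qed.

Lemma tbounded_approx (V : normedZmodType R[i]) (A : set V) :
  (forall e : R, 0 < e -> exists2 B, tbounded B & forall a, A a ->
     exists2 b, B b & rnorm (a - b) < e) -> tbounded A.
Proof.
move=> h e e0; have e2 : 0 < e / 2 by rewrite divr_gt0.
have [B tB AB] := h _ e2; have [s hs] := tB _ e2.
exists s => a /AB[b Bb ab]; have [p ps bp] := hs _ Bb; exists p => //.
by apply: le_lt_trans (rdistD b _ _) _; rewrite [ltRHS]splitr ltrD.
Qed.

Lemma tboundedS (V : normedZmodType R[i]) (A B : set V) : A `<=` B ->
  tbounded B -> tbounded A.
Proof. by move=> AB tB e /tB[s hs]; exists s => a /AB; exact: hs. Qed.

Lemma tboundedD (V : normedZmodType R[i]) (A B : set V) : tbounded A ->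
  tbounded B -> tbounded [set a + b | a in A & b in B].
Proof.
move=> tA tB e e0; have e2 : 0 < e / 2 by rewrite divr_gt0.
have [s hs] := tA _ e2; have [t ht] := tB _ e2.
exists [seq a + b | a <- s, b <- t] => _ [a /hs[p ps ap] [b /ht[q qt bq] <-]].
exists (p + q); first by apply/allpairsP; exists (p, q).
rewrite opprD addrACA; apply: le_lt_trans (rnormD _ _) _.
by rewrite [ltRHS]splitr ltrD.
Qed.

Lemma tbounded1 (V : normedZmodType R[i]) (a : V) : tbounded [set a].
Proof.
move=> e e0; exists [:: a] => _ ->; exists a; first by rewrite mem_head.
by rewrite subrr rnorm0.
Qed.

Lemma tbounded_disc (M : R) : 0 <= M -> tbounded [set c : R[i] | rnorm c <= M].
Proof.
move=> M0 e e0; have d0 : 0 < e / 2 by rewrite divr_gt0.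
pose d := e / 2; pose K := (Num.truncn (2 * M / d)).+1.
pose g k : R := - M + k%:R * d.
have net t : `|t| <= M -> exists2 k, (k < K)%N & `|t - g k| < d.
  rewrite ler_norml => /andP[A B].
  have p : 0 <= (t + M) / d by rewrite divr_ge0 ?(ltW d0)// -lerBlDr sub0r.
  have kK : (Num.truncn ((t + M) / d) < K)%N.
    rewrite ltnS le_truncn// ler_pM2r ?invr_gt0//.
    by rewrite mulrDl mul1r lerD2r.
  have := truncn_itv p; move: kK; move: (Num.truncn _) => k kK /andP[].
  rewrite ler_pdivlMr// ltr_pdivrMr// -natr1 [_ * d in X in _ -> X -> _]mulrDl mul1r => C D.
  exists k => //; rewrite /g; move: C D; move: (k%:R * d) => x C D.
  by rewrite ger0_norm; lra.
exists [seq (g k +i* g l)%C | k <- iota 0 K, l <- iota 0 K] => c cM.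
have [k kK hk] := net _ (le_trans (normr_Re _) cM).
have [l lK hl] := net _ (le_trans (normr_Im _) cM).
exists (g k +i* g l)%C.
  by apply/allpairsP; exists (k, l); rewrite !mem_iota.
apply: le_lt_trans (rnorm_ReIm _) _; rewrite [ltRHS]splitr.
by move: hk hl; case: c {cM} => a b /= hk hl; rewrite ltrD.
Qed.

Lemma tbounded_scale (V : normedModType R[i]) (A : set R[i]) (u : V) :
  tbounded A -> tbounded [set c *: u | c in A].
Proof.
move=> tA e e0; have p : 0 < rnorm u + 1 by rewrite ltr_wpDl ?rnorm_ge0.
have [s hs] := tA _ (divr_gt0 e0 p).
exists [seq c *: u | c <- s] => _ [c /hs[q qs cq] <-].
exists (q *: u); first by apply/mapP; exists q.
rewrite -scalerBl rnormZ; move: cq; rewrite ltr_pdivlMr//.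
have := rnorm_ge0 (c - q); nra.
Qed.

End TotallyBounded.

(** * Finite rank operators on a Hilbert space *)

Section FiniteRank.
Variables (R : realType) (H : hilbertType R).
Implicit Types (s : seq (H * H)) (f g : H -> H).

(** A pair (p, q) encodes the rank one operator p q^*. *)
Definition frk s (v : H) : H := \sum_(p <- s) hdot v p.2 *: p.1.

Definition bnd f (c : R) := forall v, rnorm (f v) <= c * rnorm v.

Lemma frk_linear s : linear (frk s).
Proof.
move=> l u v; rewrite /frk scaler_sumr -big_split/=; apply: eq_bigr => p _.
by rewrite hdotDl hdotZl scalerDl scalerA.
Qed.

Lemma frk_cat s t v : frk (s ++ t) v = frk s v + frk t v.
Proof. by rewrite /frk big_cat. Qed.

Lemma frk_adjoint s x y :
  hdot (frk s x) y = hdot x (frk [seq (p.2, p.1) | p <- s] y).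
Proof.
rewrite /frk hdot_suml hdot_sumr big_map; apply: eq_bigr => p _ /=.
by rewrite hdotZl hdotZr (hdotC p.1) mulrC.
Qed.

Lemma frk_comp_r f c s v : linear f -> bnd f c ->
  frk s (f v) = frk [seq (p.1, adjoint f p.2) | p <- s] v.
Proof.
move=> lf hf; rewrite /frk big_map; apply: eq_bigr => p _ /=.
by rewrite (adjointP lf hf).
Qed.

Lemma frk_scale l s v : l *: frk s v = frk [seq (l *: p.1, p.2) | p <- s] v.
Proof.
rewrite /frk scaler_sumr big_map; apply: eq_bigr => p _ /=.
by rewrite !scalerA mulrC.
Qed.

Lemma frk_tbounded s : tbounded (frk s @` [set v | rnorm v <= 1]).
Proof.
elim: s => [|p s IH].
  apply: tboundedS (tbounded1 0) => _ [v _ <-].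
  by rewrite /frk big_nil.
have h := tboundedD (tbounded_scale p.1 (tbounded_disc (rnorm_ge0 p.2))) IH.
apply: tboundedS h => _ [v /= v1 <-].
exists (hdot v p.2 *: p.1).
  exists (hdot v p.2) => //=; apply: le_trans (hdot_CS _ _) _.
  by rewrite ler_piMl ?rnorm_ge0.
by exists (frk s v); [exists v|rewrite /frk big_cons].
Qed.

(** The rank bound is explicit because [UC] wants one that is valid for all entries at once. Sums,
    products and adjoints then only have to keep track of [N] and [e], and compactness is recovered
    at the end by [fr_approx_compact]. *)
Definition fr_approx N (e : R) f := exists2 s, (size s <= N)%N &
  forall v, rnorm (f v - frk s v) <= e * rnorm v.

Lemma fr_approx_compact f : linear f ->
  (forall e : R, 0 < e -> exists N, fr_approx N e f) -> compact_operator f.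
Proof.
move=> lf h; split=> //; apply/tbounded_precompact/tbounded_approx => e e0.
have e2 : 0 < e / 2 by rewrite divr_gt0.
have [N [s _ hs]] := h _ e2; exists (frk s @` [set v | rnorm v <= 1]).
  exact: frk_tbounded.
move=> _ [v /= v1 <-]; exists (frk s v); first by exists v.
apply: le_lt_trans (hs v) _; apply: le_lt_trans (_ : _ <= e / 2) _.
  by rewrite ler_piMr// ltW.
by rewrite ltr_pdivrMr// ltr_pMr// ltr1n.
Qed.

Lemma frk_compact s : compact_operator (frk s).
Proof.
apply: fr_approx_compact; first exact: frk_linear.
move=> e e0; exists (size s); exists s => // v.
by rewrite subrr rnorm0 mulr_ge0 ?rnorm_ge0// ltW.
Qed.

Lemma frk_rank s N : (size s <= N)%N -> rank_le N (frk s).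
Proof.
move=> sN; exists (fun i => (nth (0, 0) s i).1) => _ [v _ <-].
exists (size s), (fun i => hdot v (nth (0, 0) s i).2), (fun i => (nth (0, 0) s i).1).
split=> [i|]; first by exists (widen_ord sN i).
by rewrite /frk (big_nth (0, 0)) big_mkord.
Qed.

Lemma fr_approxP N e l f g N' e' : fr_approx N e f -> fr_approx N' e' g ->
  fr_approx (N + N') (rnorm l * e + e') (fun v => l *: f v + g v).
Proof.
move=> [s sN hs] [t tN ht]; exists ([seq (l *: p.1, p.2) | p <- s] ++ t) => [|v].
  by rewrite size_cat size_map leq_add.
rewrite frk_cat -frk_scale opprD addrACA -scalerBr.
apply: le_trans (rnormD _ _) _; rewrite mulrDl lerD// rnormZ -mulrA.
by rewrite ler_wpM2l ?rnorm_ge0.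
Qed.

Lemma fr_approx_comp_r N e f g c : fr_approx N e f -> linear g -> bnd g c -> 0 <= e ->
  fr_approx N (e * c) (f \o g).
Proof.
move=> [s sN hs] lg hg e0; exists [seq (p.1, adjoint g p.2) | p <- s] => [|v].
  by rewrite size_map.
rewrite -(frk_comp_r _ _ lg hg) /=; apply: le_trans (hs _) _.
by rewrite -mulrA ler_wpM2l.
Qed.

Lemma fr_approx_adjoint N e f c : fr_approx N e f -> linear f -> bnd f c -> 0 <= e ->
  fr_approx N e (adjoint f).
Proof.
move=> [s sN hs] lf hf e0; exists [seq (p.2, p.1) | p <- s] => [|v]; first by rewrite size_map.
have lfs : linear (fun x => f x - frk s x).
  by move=> l x y; rewrite lf (frk_linear s) scalerBr opprD addrACA.
have -> : adjoint f v - frk [seq (p.2, p.1) | p <- s] v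
    = adjoint (fun x => f x - frk s x) v.
  apply: hdot_inj => z; rewrite -(adjointP lfs hs) hdotBr hdotBl.
  by rewrite -(adjointP lf hf) frk_adjoint.
exact: adjoint_bound.
Qed.

(** Orthogonality of [u] is never stated. It is replaced by the fact that the symmetric operator
    [Q u] fixes the vectors concerned: the residual [a - Q u a] is then orthogonal to every fixed
    vector, and a vanishing residual adds nothing to [u]. *)
Lemma gram_schmidt (w : seq H) : exists u : seq H,
  [/\ (size u <= size w)%N, {in u, forall x, rnorm x <= 1} &
      {in w, forall x, \sum_(y <- u) hdot x y *: y = x}].
Proof.
pose Q u x := frk [seq (y, y) | y <- u] x.
have QE u x : \sum_(y <- u) hdot x y *: y = Q u x by rewrite /Q /frk big_map.
have Qsym u x y : hdot (Q u x) y = hdot x (Q u y).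
  by rewrite /Q frk_adjoint -map_comp.
have Qlin u : linear (Q u) by exact: frk_linear.
(* The induction needs in addition that [Q u] fixes [u] itself, which makes [Q u] idempotent. *)
suff [u [su u1 uw uu]] : exists u : seq H, [/\ (size u <= size w)%N,
    {in u, forall x, rnorm x <= 1}, {in w, forall x, Q u x = x} &
    {in u, forall x, Q u x = x}].
  by exists u; split=> // x xw; rewrite QE uw.
elim: w => [|a w [u [su u1 uw uu]]]; first by exists [::].
pose r := a - Q u a.
have ur x : Q u x = x -> hdot x r = 0.
  by move=> h; rewrite hdotBr -Qsym h subrr.
have QQ x : Q u (Q u x) = Q u x.
  rewrite -(QE u x) (lin_sum (Qlin u)) big_seq [RHS]big_seq.
  by apply: eq_bigr => y yu; rewrite (linZ (Qlin u)) uu.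
have [r0|r0] := eqVneq r 0.
  exists u; split=> //; first exact: leq_trans (leqnSn _).
  move=> x; rewrite in_cons => /orP[/eqP ->|/uw//].
  by apply/esym/eqP; rewrite -subr_eq0 -/r r0.
have rn : rnorm r != 0 by apply: contra_neq r0; exact: rnorm_eq0.
have rp : 0 < rnorm r by rewrite lt_neqAle eq_sym rn rnorm_ge0.
pose t := ((rnorm r)^-1)%:C *: r.
have Qt x : Q (t :: u) x = ((rnorm r)^-1 ^+ 2)%:C * hdot x r *: r + Q u x.
  rewrite /Q /frk /= big_cons /= hdotZr conjE conjc_real scalerA mulrAC.
  by rewrite -rmorphM -expr2.
have Qfix x : Q u x = x -> Q (t :: u) x = x.
  by move=> h; rewrite Qt ur// mulr0 scale0r add0r.
have rr : ((rnorm r)^-1 ^+ 2)%:C * hdot r r = 1.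
  by rewrite hdotxx -rmorphM -exprMn mulVf// expr1n.
exists (t :: u); split=> //.
- move=> x; rewrite in_cons => /orP[/eqP ->|/u1//].
  by rewrite rnormZ rnormR ger0_norm ?invr_ge0 ?rnorm_ge0// mulVf.
- move=> x; rewrite in_cons => /orP[/eqP ->|/uw/Qfix//].
  rewrite Qt -{1}(subrK (Q u a) a) -/r hdotDl (ur _ (QQ a)) addr0 rr scale1r.
  by rewrite subrK.
- move=> x; rewrite in_cons => /orP[/eqP ->|/uu/Qfix//].
  rewrite [LHS](linZ (Qlin _)) Qt rr scale1r.
  by rewrite /r (linB (Qlin u)) QQ subrr addr0.
Qed.

(** Expand [f v] along an orthonormal system x of the range and move [f] across: the coefficient of
    x is [hdot v (adjoint f x)]. The bounds 1 and [c] depend on [f] only through its norm, which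
    later keeps the columns built from all the entries of a matrix uniformly bounded. *)
Lemma rank_le_frk N f c : 0 <= c -> linear f -> bnd f c -> rank_le N f ->
  exists s, [/\ (size s <= N)%N, f = frk s &
    forall p, p \in s -> rnorm p.1 <= 1 /\ rnorm p.2 <= c].
Proof.
move=> c0 lf hf [w hw].
have [u [su u1 uw]] := gram_schmidt [seq w i | i <- enum 'I_N].
exists [seq (x, adjoint f x) | x <- u]; split.
- by rewrite size_map (leq_trans su)// size_map size_enum_ord.
- apply/funext => v; rewrite /frk big_map /=.
  under eq_bigr do rewrite -(adjointP lf hf).
  have [n [b [x [xw ->]]]] := hw _ (ex_intro2 _ _ v I erefl).
  under eq_bigr do rewrite hdot_suml scaler_suml.
  rewrite exchange_big /=; apply: eq_bigr => i _.
  have xiw : x i \in [seq w i | i <- enum 'I_N].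
    by have [j _ <-] := xw i; apply/mapP; exists j; rewrite ?mem_enum.
  rewrite -[in LHS](uw _ xiw); under eq_bigr do rewrite hdotZl -scalerA.
  by rewrite -scaler_sumr !uw.
- move=> _ /mapP[x xu ->] /=; split; first exact: u1.
  apply: le_trans (adjoint_bound c0 lf hf _) _.
  by rewrite ler_piMr// u1.
Qed.

End FiniteRank.

(** * Matrices of finite propagation *)

Lemma sum_const_le (R : numDomainType) (I : Type) (s : seq I) n (a : R) :
  (size s <= n)%N -> 0 <= a -> \sum_(z <- s) a <= n%:R * a.
Proof.
move=> sn a0; rewrite big_const_seq count_predT iter_addr_0 -[leLHS]mulr_natl.
by rewrite ler_wpM2r// ler_nat.
Qed.

Lemma fsumE (I : choiceType) (M : nmodType) (F : I -> M) (s : seq I) : uniq s ->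
  (forall z, z \notin s -> F z = 0) ->
  \sum_(z \in [set: I]) F z = \sum_(z <- s) F z.
Proof.
move=> us h; rewrite (@fsbig_seq _ _ _ _ _ F us); symmetry; apply: fsbig_widen => //.
by move=> z [_ /= /negP zs]; exact: h.
Qed.

Section Neighbourhoods.
Variables (R : realType) (X : metricType R).
Hypothesis hX : bounded_geometry X.

(** The premise [0 < S] sits inside the conclusion so that [nb] and [nbN] are total functions of the
    radius. *)
Lemma ball_enum (S : R) : exists N, forall x : X, exists s : seq X,
  [/\ uniq s, (size s <= N)%N & 0 < S -> forall y, (y \in s) = (mdist x y < S)].
Proof.
have [S0|S0] := ltP 0 S; last first.
  by exists 0%N => x; exists [::]; split.
have [N hN] := hX S0; exists N => x.
have := hN x => /[dup] bN /pcard_leP[f].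
have [s0 hs] : exists s : seq X, ball x S = [set` s].
  by apply/finite_seqP/finite_set_leP; exists N.
exists (undup s0); split; first exact: undup_uniq.
  rewrite -(size_iota 0 N) -(size_map f); apply: uniq_leq_size.
    rewrite map_inj_in_uniq ?undup_uniq// => y z; rewrite !mem_undup => ys zs.
    by apply: (@inj _ _ _ f); rewrite inE hs.
  move=> n /mapP[y]; rewrite mem_undup => ys ->.
  rewrite mem_iota add0n; have : ball x S y by rewrite hs.
  by move=> /(@funS _ _ _ _ f).
move=> _ y; rewrite mem_undup.
have : (y \in s0) <-> ball x S y by rewrite hs.
rewrite ballEmdist/=; case: (y \in s0); case: (mdist x y < S) => // -[h1 h2].
  by have := h1 isT.
by have := h2 isT.
Qed.

Definition nbN S : nat := sval (cid (ball_enum S)).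
Definition nb S x : seq X := sval (cid (svalP (cid (ball_enum S)) x)).

Let nbP S x : [/\ uniq (nb S x), (size (nb S x) <= nbN S)%N &
  0 < S -> forall y, (y \in nb S x) = (mdist x y < S)].
Proof. exact: svalP (cid (svalP (cid (ball_enum S)) x)). Qed.

Lemma nb_uniq S x : uniq (nb S x).
Proof. by have [] := nbP S x. Qed.

Lemma nb_size S x : (size (nb S x) <= nbN S)%N.
Proof. by have [] := nbP S x. Qed.

Lemma mem_nb S x y : 0 < S -> (y \in nb S x) = (mdist x y < S).
Proof. by have [_ _ /[apply]] := nbP S x. Qed.

Definition fprop (C : zmodType) (S : R) (T : X -> X -> C) :=
  forall x y, S <= mdist x y -> T x y = 0.

Lemma fprop_le (C : zmodType) (S S' : R) (T : X -> X -> C) :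
  S <= S' -> fprop S T -> fprop S' T.
Proof. by move=> SS h x y xy; apply: h; exact: le_trans xy. Qed.

Lemma fprop_nb (C : zmodType) S (T : X -> X -> C) x y : 0 < S -> fprop S T ->
  y \notin nb S x -> T x y = 0.
Proof. by move=> S0 h; rewrite mem_nb// -leNgt; exact: h. Qed.

Lemma sub_nb S1 S2 x z y : 0 < S1 -> 0 < S2 -> z \in nb S1 x -> y \in nb S2 z ->
  y \in nb (S1 + S2) x.
Proof.
move=> S10 S20; rewrite !mem_nb ?addr_gt0// => A B.
by apply: le_lt_trans (metric_triangle x z y) _; rewrite ltrD.
Qed.

Lemma nb_self S x : 0 < S -> x \in nb S x.
Proof. by move=> S0; rewrite mem_nb// mdistxx. Qed.

Lemma nb_sym S x y : 0 < S -> (y \in nb S x) = (x \in nb S y).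
Proof. by move=> S0; rewrite !mem_nb// metric_sym. Qed.

Lemma sub_nb_le S S' x : 0 < S -> S <= S' -> {subset nb S x <= nb S' x}.
Proof.
move=> S0 SS y; rewrite !mem_nb ?(lt_le_trans S0)// => h.
exact: lt_le_trans h SS.
Qed.

Section MxMul.
Variables (C : lmodType R[i]) (mul : C -> C -> C) (mul0 : forall b, mul 0 b = 0).

(** The list [s] may be larger than the neighbourhood, so that several sums can be taken over a
    common list and then exchanged. *)
Lemma mx_mulE S (A B : X -> X -> C) x y s : 0 < S -> fprop S A -> uniq s ->
  {subset nb S x <= s} -> mx_mul mul A B x y = \sum_(z <- s) mul (A x z) (B z y).
Proof.
move=> S0 hA us hs; rewrite /mx_mul (fsumE us)// => z zs.
by rewrite (fprop_nb S0 hA) ?mul0//; apply: contra zs; exact: hs.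
Qed.

Lemma mx_mul_fprop S S' (A B : X -> X -> C) : 0 < S -> 0 < S' ->
  fprop S A -> fprop S' B -> (forall x z, mul (A x z) 0 = 0) ->
  fprop (S + S') (mx_mul mul A B).
Proof.
move=> S0 S'0 hA hB A0 x y xy.
rewrite (mx_mulE _ _ S0 hA (nb_uniq S x))// big_seq big1// => z zx.
rewrite hB ?A0//; move: zx; rewrite mem_nb// => zx.
have := le_trans xy (metric_triangle x z y); move: zx.
move: (mdist x z) (mdist z y) => a b; lra.
Qed.

End MxMul.

End Neighbourhoods.

Lemma fun_linE (K : pzRingType) (I : Type) (V : lmodType K) (l : K) (f g : I -> V) x :
  (l *: f + g) x = l *: f x + g x.
Proof. by []. Qed.

Lemma mx_linE (K : pzRingType) (I J : Type) (V : lmodType K) (l : K) (f g : I -> J -> V) x y :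
  (l *: f + g) x y = l *: f x y + g x y.
Proof. by []. Qed.

(** * The *-algebra [UC] and its action on families of vectors *)

Section UC.
Variables (R : realType) (X : metricType R) (H : hilbertType R).
Hypothesis hX : bounded_geometry X.
Implicit Types T : X -> X -> H -> H.
Local Notation nb := (nb hX).
Local Notation nbN := (nbN hX).

Record UC_spec T : Prop := {
  uc_prop : exists2 S : R, 0 < S & fprop S T ;
  uc_lin : forall x y, linear (T x y) ;
  uc_bnd : exists2 M : R, 0 <= M & forall x y, bnd (T x y) M ;
  uc_approx : forall e : R, 0 < e -> exists N, forall x y, fr_approx N e (T x y) }.

Lemma UC0_spec T : UC0 T -> exists S M N, [/\ 0 < S, fprop S T, 0 <= M &
  forall x y, exists s, [/\ (size s <= N)%N, T x y = frk s, bnd (T x y) M &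
    forall p, p \in s -> rnorm p.1 <= 1 /\ rnorm p.2 <= M]].
Proof.
move=> [[S S0 hS] cT [M hM] [N hN]]; exists S, `|M|, N; split=> // x y.
have [lT _] := cT x y.
have bT : bnd (T x y) `|M|.
  move=> v; apply: opnorm_bound => //; apply: le_trans (hM x y) _.
  by rewrite lee_fin ler_norm.
have [s [sN Ts hs]] := rank_le_frk (normr_ge0 M) lT bT (hN x y).
by exists s; split.
Qed.

Lemma UC0_intro T S M N : 0 < S -> fprop S T -> 0 <= M ->
  (forall x y, bnd (T x y) M) ->
  (forall x y, exists2 s, (size s <= N)%N & T x y = frk s) -> UC0 T.
Proof.
move=> S0 hS M0 bT hs; split.
- by exists S.
- by move=> x y; have [s _ ->] := hs x y; exact: frk_compact.
- by exists M => x y; apply: opnorm_le => // v; exact: bT.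
- by exists N => x y; have [s sN ->] := hs x y; exact: frk_rank.
Qed.

(** The uniform bound on the entries is inherited from an approximant at tolerance 1. Conversely,
    the approximants chosen entry by entry assemble to a matrix in [UC0], because rank and norm are
    controlled uniformly. *)
Lemma UCP T : UC T <-> UC_spec T.
Proof.
split=> [[[S S0 hS] cT hT]|[[S S0 hS] lT [M M0 bT] aT]].
- have lT x y : linear (T x y) by case: (cT x y).
  have lB (f g : H -> H) : linear f -> linear g -> linear (f - g).
    by move=> lf lg l u v; rewrite !fctE lf lg scalerBr opprD addrACA.
  split=> //; first by exists S.
    have [T0 /UC0_spec[S' [M [N' [_ _ M0 hM]]]] h] := hT _ ltr01.
    exists (M + 1) => [|x y v]; first by rewrite addr_ge0.
    have [s [_ Ts bs _]] := hM x y.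
    have lT0 : linear (T0 x y) by rewrite Ts; exact: frk_linear.
    have := opnorm_bound v (lB _ _ lT0 (lT x y)) (ltW (h x y)).
    rewrite !fctE rdistC; have := rnorm_distl (T x y v) (T0 x y v); have := bs v.
    lra.
  move=> e e0; have [T0 /UC0_spec[S' [M [N [_ _ M0 hM]]]] h] := hT _ e0.
  exists N => x y; have [s [sN Ts bs _]] := hM x y; exists s => // v.
  have lT0 : linear (T0 x y) by rewrite Ts; exact: frk_linear.
  have := opnorm_bound v (lB _ _ lT0 (lT x y)) (ltW (h x y)).
  by rewrite !fctE Ts rdistC.
- split; first by exists S.
    move=> x y; apply: fr_approx_compact => // e /aT[N hN].
    by exists N.
  move=> e e0; have e2 : 0 < e / 2 by rewrite divr_gt0.
  have [N hN] := aT _ e2.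
  (* Beyond distance [S] the empty list is taken, so that the approximating matrix has finite
     propagation as well. *)
  have hex x y : exists s, [/\ (size s <= N)%N,
      forall v, rnorm (T x y v - frk s v) <= e / 2 * rnorm v &
      S <= mdist x y -> frk s = 0].
    have [Sxy|Sxy] := leP S (mdist x y).
      exists [::]; split=> // [v|_]; last by apply/funext => v; rewrite /frk big_nil.
      by rewrite hS// /frk big_nil subrr rnorm0 mulr_ge0 ?rnorm_ge0// ltW.
    by have [s sN hs] := hN x y; exists s; split.
  pose s x y := sval (cid (hex x y)).
  have sP x y : [/\ (size (s x y) <= N)%N,
      forall v, rnorm (T x y v - frk (s x y) v) <= e / 2 * rnorm v &
      S <= mdist x y -> frk (s x y) = 0] by rewrite /s; case: cid.
  exists (fun x y => frk (s x y)).
    apply: (@UC0_intro _ S (M + e / 2) N) => //.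
    + by move=> x y; have [_ _ h] := sP x y.
    + by rewrite addr_ge0// ltW.
    + move=> x y v; have [_ h _] := sP x y.
      have := rnorm_distl (frk (s x y) v) (T x y v); rewrite rdistC.
      have := h v; have := bT x y v; lra.
    + by move=> x y; have [? _ _] := sP x y; exists (s x y).
  move=> x y; have [_ h _] := sP x y.
  apply: le_lt_trans (opnorm_le (ltW e2) _) _ => [v|]; last first.
    by rewrite lte_fin ltr_pdivrMr// ltr_pMr// ltr1n.
  by rewrite !fctE rdistC.
Qed.

Lemma fr_approx_le N N' (e e' : R) (f : H -> H) : (N <= N')%N -> e <= e' ->
  fr_approx N e f -> fr_approx N' e' f.
Proof.
move=> NN ee [s sN hs]; exists s => [|v]; first exact: leq_trans NN.
by apply: le_trans (hs v) _; rewrite ler_wpM2r ?rnorm_ge0.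
Qed.

Lemma fr_approx0 N (e : R) : 0 <= e -> fr_approx N e (fun=> 0 : H).
Proof.
move=> e0; exists [::] => // v.
by rewrite /frk big_nil subrr rnorm0 mulr_ge0 ?rnorm_ge0.
Qed.

Lemma fr_approx_sum (I : Type) (s : seq I) N (e : R) (f : I -> H -> H) : 0 <= e ->
  (forall i, fr_approx N e (f i)) ->
  fr_approx (size s * N) ((size s)%:R * e) (fun v => \sum_(i <- s) f i v).
Proof.
move=> e0 h; elim: s => [|i s IH].
  by under eq_fun do rewrite big_nil; apply: fr_approx0; rewrite mul0r.
have := fr_approxP 1 (h i) IH; rewrite /= mulSn -natr1 mulrDl mul1r.
rewrite (_ : rnorm (1 : R[i]) = 1) ?mul1r 1?[e + _]addrC; last first.
  by rewrite -[1]/(1%:C) rnormR normr1.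
by under eq_fun do rewrite scale1r; under [in X in _ -> X]eq_fun do rewrite big_cons.
Qed.

Lemma UC_is_linsub : is_linsub (@UC R X H).
Proof.
split=> [|l S T]; rewrite !UCP.
  split=> [|x y|| e e0].
  - by exists 1.
  - by move=> l u v; rewrite -[LHS]/(0 : H) -[RHS]/(l *: 0 + 0 : H) scaler0 addr0.
  - by exists 0 => // x y v; rewrite -[X in rnorm X]/(0 : H) rnorm0 mul0r.
  - by exists 0%N => x y; exact: fr_approx0 (ltW e0).
move=> [[r r0 hr] lS [M M0 bS] aS] [[r' r0' hr'] lT [M' M0' bT] aT]; split.
- exists (r + r'); first by rewrite addr_gt0.
  move=> x y xy; rewrite mx_linE hr; last first.
    by apply: le_trans xy; rewrite lerDl ltW.
  rewrite hr'; last by apply: le_trans xy; rewrite lerDr ltW.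
  by rewrite scaler0 addr0.
- move=> x y k u v; rewrite !mx_linE !fun_linE lS lT !scalerDr addrACA; congr (_ + _).
  by congr (_ + _); rewrite !scalerA mulrC.
- exists (rnorm l * M + M'); first by rewrite addr_ge0// mulr_ge0// rnorm_ge0.
  move=> x y v; rewrite mx_linE fun_linE; apply: le_trans (rnormD _ _) _.
  by rewrite mulrDl lerD ?bT// rnormZ -mulrA ler_wpM2l ?rnorm_ge0 ?bS.
- move=> e e0; have e2 : 0 < e / 2 by rewrite divr_gt0.
  have p : 0 < rnorm l + 1 by rewrite ltr_wpDl ?rnorm_ge0.
  have [N hN] := aS _ (divr_gt0 e2 p); have [N' hN'] := aT _ e2.
  exists (N + N')%N => x y.
  apply: fr_approx_le (leqnn _) _ (fr_approxP l (hN x y) (hN' x y)).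
  rewrite [leRHS]splitr lerD2r mulrCA ler_piMr ?(ltW e2)// ler_pdivrMr// mul1r.
  by rewrite lerDl.
Qed.

Lemma opmul0 : forall b : H -> H, (0 : H -> H) \o b = 0.
Proof. by move=> b; apply/funext. Qed.

Lemma UC_mulE S T1 T2 x y s v : 0 < S -> fprop S T1 -> uniq s ->
  {subset nb S x <= s} ->
  mx_mul (fun f g => f \o g) T1 T2 x y v = \sum_(z <- s) T1 x z (T2 z y v).
Proof.
by move=> S0 h us hs; rewrite (mx_mulE opmul0 _ _ S0 h us hs) fct_sumE.
Qed.

Lemma UC_mul T1 T2 : UC T1 -> UC T2 -> UC (mx_mul (fun f g => f \o g) T1 T2).
Proof.
rewrite !UCP => -[[r r0 hr] lS [M M0 bS] aS] [[r' r0' hr'] lT [M' M0' bT] aT].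
have E x y : mx_mul (fun f g => f \o g) T1 T2 x y =
    fun v => \sum_(z <- nb r x) (T1 x z \o T2 z y) v.
  by apply/funext => v; rewrite (UC_mulE _ _ _ r0 hr (nb_uniq hX r x)).
split.
- exists (r + r'); first by rewrite addr_gt0.
  apply: (mx_mul_fprop hX) => //.
  by move=> x z; apply/funext => v /=; rewrite (lin0 (lS _ _)).
- move=> x y l u v; rewrite E scaler_sumr -big_split; apply: eq_bigr => z _ /=.
  by rewrite lT lS.
- exists ((nbN r)%:R * (M * M')) => [|x y v]; first by rewrite !mulr_ge0.
  rewrite E; apply: le_trans (rnorm_sum _ _ _) _.
  apply: (@le_trans _ _ (\sum_(z <- nb r x) M * M' * rnorm v)).
    apply: ler_sum => z _ /=; apply: le_trans (bS _ _ _) _.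
    by rewrite -mulrA ler_wpM2l// bT.
  by rewrite -[leRHS]mulrA; apply: sum_const_le; rewrite ?nb_size ?mulr_ge0 ?rnorm_ge0.
- move=> e e0; pose k := (nbN r).+1%:R * (M' + 1).
  have k0 : 0 < k by rewrite mulr_gt0// ltr_wpDl.
  have [N hN] := aS _ (divr_gt0 e0 k0).
  exists (nbN r * N)%N => x y; rewrite E.
  have h z : fr_approx N (e / k * M') (T1 x z \o T2 z y).
    by apply: fr_approx_comp_r (hN x z) (lT z y) (bT z y) _; rewrite ltW// divr_gt0.
  apply: fr_approx_le (fr_approx_sum (nb r x) _ h).
  + by rewrite leq_mul2r nb_size orbT.
  + have : (size (nb r x))%:R * M' <= k.
      rewrite /k; apply: ler_pM => //; last by rewrite lerDl.
      by rewrite ler_nat leqW// nb_size.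
    move=> A; rewrite mulrCA; apply: (@le_trans _ _ (e / k * k)).
      by rewrite ler_wpM2l// ltW// divr_gt0.
    by rewrite mulfVK ?gt_eqF.
  + by rewrite mulr_ge0// divr_ge0// ltW.
Qed.

Lemma UC_star T : UC T -> UC (mx_star (@adjoint R H) T).
Proof.
rewrite !UCP => -[[r r0 hr] lT [M M0 bT] aT]; split.
- exists r => // x y; rewrite metric_sym => yx; rewrite /mx_star hr//.
  by apply: adjoint_eq => u v; rewrite hdot0l hdot0r.
- by move=> x y; exact: adjoint_linear (lT y x) (bT y x).
- by exists M => // x y; apply: adjoint_bound (M0) (lT y x) (bT y x).
- move=> e e0; have [N hN] := aT _ e0; exists N => x y.
  exact: fr_approx_adjoint (hN y x) (lT y x) (bT y x) (ltW e0).
Qed.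

Lemma UC_mask (m : X -> X -> bool) T : UC T -> UC (fun x y => if m x y then T x y else 0).
Proof.
rewrite !UCP => -[[r r0 hr] lT [M M0 bT] aT]; split.
- by exists r => // x y /hr ->; case: ifP.
- move=> x y; case: ifP => // _ l u v.
  by rewrite -[LHS]/(0 : H) -[RHS]/(l *: 0 + 0 : H) scaler0 addr0.
- exists M => // x y; case: ifP => // _ v.
  by rewrite -[X in rnorm X]/(0 : H) rnorm0 mulr_ge0 ?rnorm_ge0.
- move=> e e0; have [N hN] := aT _ e0; exists N => x y; case: ifP => // _.
  exact: fr_approx0 (ltW e0).
Qed.

Lemma UC_closed : sa_closed (UC_alg X H).
Proof.
by split; [exact: UC_is_linsub|exact: UC_mul|exact: UC_star].
Qed.

Lemma adjP T x y u v : UC T -> hdot (T x y u) v = hdot u (adjoint (T x y) v).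
Proof. by move=> /UCP[_ lT [M M0 bT] _]; exact: adjointP (lT x y) (bT x y) u v. Qed.

(** Finite propagation gives a meaning to the action on all families. The same lemmas then serve
    finitely supported vectors, square-summable ones and the columns of a matrix. *)
Definition act T (xi : X -> H) : X -> H := mx_act (fun (f : H -> H) v => f v) T xi.

Lemma actE S T (xi : X -> H) x s : 0 < S -> fprop S T -> uniq s ->
  {subset nb S x <= s} -> act T xi x = \sum_(z <- s) T x z (xi z).
Proof.
move=> S0 h us hs; rewrite /act /mx_act (fsumE us)// => z zs.
by rewrite (fprop_nb S0 h) //; apply: contra zs; exact: hs.
Qed.

Lemma actE_supp T (xi : X -> H) x s : (forall x y, linear (T x y)) -> uniq s ->
  (forall z, z \notin s -> xi z = 0) -> act T xi x = \sum_(z <- s) T x z (xi z).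
Proof.
move=> lT us hs; rewrite /act /mx_act (fsumE us)// => z zs.
by rewrite hs// (lin0 (lT _ _)).
Qed.

Lemma act_mul T1 T2 xi : UC T1 -> UC T2 ->
  act (mx_mul (fun f g => f \o g) T1 T2) xi = act T1 (act T2 xi).
Proof.
rewrite !UCP => -[[r r0 hr] lS _ _] [[r' r0' hr'] lT _ _]; apply/funext => x.
have hm : fprop (r + r') (mx_mul (fun f g => f \o g) T1 T2).
  apply: (mx_mul_fprop hX) => //.
  by move=> y z; apply/funext => v /=; rewrite (lin0 (lS _ _)).
pose L := nb (r + r') x; have uL : uniq L by exact: nb_uniq.
have sL : {subset nb r x <= L} by apply: sub_nb_le => //; rewrite lerDl ltW.
rewrite (actE _ (addr_gt0 r0 r0') hm uL)// (actE _ r0 hr uL sL).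
under eq_bigr do rewrite (UC_mulE _ _ _ r0 hr uL sL).
rewrite exchange_big/=; apply: eq_bigr => z _.
have [zx|zx] := boolP (z \in nb r x).
  rewrite (actE xi r0' hr' uL) ?(lin_sum (lS x z))// => y yz.
  exact: sub_nb yz.
by rewrite (fprop_nb r0 hr zx) big1.
Qed.

Lemma act_linl l T1 T2 xi : UC T1 -> UC T2 -> act (l *: T1 + T2) xi = l *: act T1 xi + act T2 xi.
Proof.
rewrite !UCP => -[[r r0 hr] lS _ _] [[r' r0' hr'] lT _ _]; apply/funext => x.
have r1 : r <= r + r' by rewrite lerDl ltW.
have r2 : r' <= r + r' by rewrite lerDr ltW.
have rr : 0 < r + r' by rewrite addr_gt0.
have h1 := fprop_le r1 hr; have h2 := fprop_le r2 hr'.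
have h : fprop (r + r') (l *: T1 + T2).
  by move=> y z yz; rewrite mx_linE h1// h2// scaler0 addr0.
have uL := nb_uniq hX (r + r') x.
rewrite fun_linE !(actE _ rr _ uL)// scaler_sumr -big_split.
by apply: eq_bigr => z _ /=; rewrite mx_linE fun_linE.
Qed.

Lemma act_linr l T (xi eta : X -> H) : UC T -> act T (l *: xi + eta) = l *: act T xi + act T eta.
Proof.
move=> /UCP[[r r0 hr] lS _ _]; apply/funext => x.
have uL := nb_uniq hX r x.
rewrite fun_linE !(actE _ r0 hr uL)// scaler_sumr -big_split.
by apply: eq_bigr => z _ /=; rewrite fun_linE lS.
Qed.

Definition fsupp (xi : X -> H) := exists2 s : seq X, uniq s &
  forall z, z \notin s -> xi z = 0.

Definition dotX (xi eta : X -> H) : R[i] := \sum_(x \in [set: X]) hdot (xi x) (eta x).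

Lemma dotX_supp xi eta s : uniq s -> (forall z, z \notin s -> xi z = 0) ->
  dotX xi eta = \sum_(z <- s) hdot (xi z) (eta z).
Proof.
by move=> us h; rewrite /dotX (fsumE us)// => z /h ->; rewrite hdot0l.
Qed.

Lemma act_supp T xi : UC T -> fsupp xi -> exists s, [/\ uniq s,
  forall z, z \notin s -> xi z = 0 & forall z, z \notin s -> act T xi z = 0].
Proof.
move=> /UCP[[r r0 hr] lT _ _] [s us hs].
exists (undup (s ++ flatten [seq nb r y | y <- s])); split.
- exact: undup_uniq.
- by move=> z; rewrite mem_undup mem_cat negb_or => /andP[/hs].
- move=> x; rewrite mem_undup mem_cat negb_or => /andP[xs xf].
  rewrite (actE_supp _ lT us hs) big_seq big1// => z zs.
  rewrite (fprop_nb r0 hr)// nb_sym//; apply: contra xf => xz.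
  by apply/flattenP; exists (nb r z) => //; apply/mapP; exists z.
Qed.

Lemma fsupp_act T xi : UC T -> fsupp xi -> fsupp (act T xi).
Proof. by move=> uT xs; have [s [us _ h]] := act_supp uT xs; exists s. Qed.

Lemma act_adj T xi eta : UC T -> fsupp xi ->
  dotX (act T xi) eta = dotX xi (act (mx_star (@adjoint R H) T) eta).
Proof.
move=> uT [s0 us0 hs0]; have uT' := UC_star uT.
have [_ lT _ _] := (UCP _).1 uT; have [[r r0 hr] lT' _ _] := (UCP _).1 uT'.
have [s [us hs has]] := act_supp uT (ex_intro2 _ _ s0 us0 hs0).
rewrite (dotX_supp _ us has) (dotX_supp _ us0 hs0).
pose L := undup (s ++ flatten [seq nb r y | y <- s0]).
have uL : uniq L by exact: undup_uniq.
have sL : {subset s <= L} by move=> z zs; rewrite mem_undup mem_cat zs.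
have nL y : y \in s0 -> {subset nb r y <= L}.
  move=> ys z zy; rewrite mem_undup mem_cat; apply/orP; right.
  by apply/flattenP; exists (nb r y) => //; apply/mapP; exists y.
have -> : \sum_(z <- s) hdot (act T xi z) (eta z) = \sum_(z <- L) hdot (act T xi z) (eta z).
  rewrite -(dotX_supp eta us has) (dotX_supp eta uL)// => z zL.
  by apply: has; apply: contra zL; exact: sL.
under eq_bigr do rewrite (actE_supp _ lT us0 hs0) hdot_suml.
rewrite exchange_big/= big_seq [RHS]big_seq; apply: eq_bigr => y ys.
rewrite (actE _ r0 hr uL (nL y ys)) hdot_sumr; apply: eq_bigr => x _.
exact: adjP.
Qed.

End UC.

(** * A uniform bound for all representations *)

Section Neumann.
Variables (R : realType) (H : hilbertType R) (d : H -> H) (c r : R).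
Hypotheses (ld : linear d) (bd : bnd d c) (c0 : 0 <= c) (cr : c < r).

Let r0 : 0 < r. Proof. exact: (le_lt_trans c0 cr). Qed.

Lemma geometric_cauchy (V : normedModType R[i]) (u : nat -> V) (C q : R) :
  0 <= C -> 0 <= q -> q < 1 ->
  (forall n, rnorm (u n.+1 - u n) <= C * q ^+ n) -> cauchys u.
Proof.
move=> C0 q0 q1 h.
have q1' : 0 < 1 - q by rewrite subr_gt0.
have tail n k : rnorm (u (n + k)%N - u n) <= C * q ^+ n / (1 - q) * (1 - q ^+ k).
  elim: k => [|k IH]; first by rewrite addn0 subrr rnorm0 expr0 subrr mulr0.
  apply: le_trans (rdistD (u (n + k)%N) _ _) _; rewrite addnS.
  apply: le_trans (lerD (h _) IH) _; rewrite exprD exprS.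
  have : C * (q ^+ n * q ^+ k) = C * q ^+ n / (1 - q) * (q ^+ k * (1 - q)).
    by field; rewrite gt_eqF.
  by move=> ->; rewrite -mulrDr ler_wpM2l ?mulr_ge0 ?invr_ge0 ?(ltW q1') ?exprn_ge0//; lra.
move=> e e0.
have p : 0 < e / 2 * (1 - q) / (C + 1) by rewrite !divr_gt0 ?mulr_gt0// ltr_wpDl.
have /cvgrPdist_lt/(_ _ p)[N _ hN] : q ^+ n @[n --> \oo] --> (0 : R).
  by apply: cvg_expr; rewrite ger0_norm.
have tN k : rnorm (u (N + k)%N - u N) < e / 2.
  apply: le_lt_trans (tail N k) _.
  have := hN N (leqnn N); rewrite /= sub0r normrN ger0_norm ?exprn_ge0//.
  rewrite ltr_pdivlMr ?ltr_wpDl// => A.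
  apply: (@le_lt_trans _ _ (C * q ^+ N / (1 - q))).
    rewrite ler_piMr ?mulr_ge0 ?invr_ge0 ?(ltW q1') ?exprn_ge0//.
    by rewrite gerBl exprn_ge0.
  rewrite ltr_pdivrMr//; apply: le_lt_trans A.
  by rewrite mulrC ler_wpM2l ?exprn_ge0// lerDl.
exists N => m n /subnKC <- /subnKC <-.
by apply: le_lt_trans (rdistD (u N) _ _) _; rewrite [ltRHS]splitr ltrD// rdistC.
Qed.

Let step v w := (r^-1)%:C *: d (v + w).

Let stepB v w w' : rnorm (step v w - step v w') <= c / r * rnorm (w - w').
Proof.
rewrite /step -scalerBr -(linB ld) opprD addrACA subrr add0r rnormZ rnormR.
rewrite ger0_norm ?invr_ge0 ?(ltW r0)// [c / r]mulrC -mulrA.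
by rewrite ler_wpM2l ?invr_ge0 ?(ltW r0)//; exact: bd.
Qed.

Let solve v : exists w, r%:C *: w = d (v + w).
Proof.
pose u n := iter n (step v) 0.
have qq : c / r < 1 by rewrite ltr_pdivrMr// mul1r.
have q0 : 0 <= c / r by rewrite divr_ge0// ltW.
have [w uw] : exists w, cvs u w.
  apply: cauchys_cvs; apply: (@geometric_cauchy _ u (rnorm (u 1%N - u 0%N)) (c / r)) => //.
    exact: rnorm_ge0.
  elim=> [|n IH]; first by rewrite expr0 mulr1.
  apply: le_trans (stepB v (u n.+1) (u n)) _.
  by rewrite exprS mulrCA ler_wpM2l.
exists w.
have : w = step v w.
  apply: (cvs_unique uw) => e e0.
  have [N hN] := uw _ e0; exists N.+1 => -[//|n] Nn.
  apply: le_lt_trans (stepB v (u n) w) _; apply: le_lt_trans (hN n Nn).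
  by rewrite ler_piMl ?rnorm_ge0// ltW.
by move=> {1}->; rewrite /step scalerA -rmorphM mulfV ?gt_eqF// scale1r.
Qed.

Let solve_uniq v w w' : r%:C *: w = d (v + w) -> r%:C *: w' = d (v + w') -> w = w'.
Proof.
move=> h h'; apply/eqP; rewrite -subr_eq0; apply/eqP/rnorm_eq0/eqP.
have : r * rnorm (w - w') <= c * rnorm (w - w').
  have := bd (w - w'); rewrite (_ : d (w - w') = r%:C *: (w - w')).
    by rewrite rnormZ rnormR gtr0_norm.
  by rewrite scalerBr h h' -(linB ld) opprD addrACA subrr add0r.
rewrite eq_le rnorm_ge0 andbT; apply: contraTT; rewrite -!ltNge => p.
by rewrite ltr_pM2r.
Qed.

(** [F] is d (r - d)^{-1}, the sum of (d/r)^k over k >= 1. The inverse of r - d itself would not do: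
    in infinite dimension it is not compact, so it cannot be an entry of a matrix in [UC]. [F]
    arises as the fixed point of a contraction; uniqueness gives linearity and commutation with
    [d]. *)
Lemma neumann : exists F : H -> H, [/\ linear F,
  forall v, r%:C *: F v = d v + F (d v),
  forall v, r%:C *: F v = d (v + F v) & bnd F (c / (r - c))].
Proof.
pose F v := sval (cid (solve v)).
have hF v : r%:C *: F v = d (v + F v) by rewrite /F; case: cid.
exists F; split=> //.
- move=> l u v; apply: (@solve_uniq (l *: u + v)) => //.
  rewrite scalerDr scalerA [_ * l]mulrC -scalerA !hF !(linD ld) !(linZ ld).
  by rewrite scalerDr addrACA.
- move=> v; rewrite hF (linD ld); congr (_ + _).
  apply: (@solve_uniq (d v)) => //.
  by rewrite -(linZ ld) hF (linD ld).
- move=> v; have rc : 0 < r - c by rewrite subr_gt0.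
  rewrite mulrAC ler_pdivlMr//.
  have := bd (v + F v); rewrite -hF rnormZ rnormR gtr0_norm// => A.
  have := ler_wpM2l c0 (rnormD v (F v)); lra.
Qed.

End Neumann.

Section RepBound.
Variables (R : realType) (X : metricType R) (H : hilbertType R).
Hypothesis hX : bounded_geometry X.
Local Notation nb := (nb hX).
Local Notation nbN := (nbN hX).
Local Notation UCA := (UC_alg X H).
Local Notation opmx_mul := (mx_mul (fun f g : H -> H => f \o g)).
Local Notation opmx_star := (mx_star (@adjoint R H)).

Definition diagonal (C : zmodType) (D : X -> X -> C) := forall x y, x <> y -> D x y = 0.

Lemma diagonal_fprop (C : zmodType) (D : X -> X -> C) : diagonal D -> fprop 1 D.
Proof. by move=> dD x y xy; apply: dD => yx; move: xy; rewrite yx mdistxx lt_geF. Qed.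

Lemma diagonal_mul (D T : X -> X -> H -> H) x y v : diagonal D ->
  opmx_mul D T x y v = D x x (T x y v).
Proof.
move=> dD; rewrite (UC_mulE _ _ _ ltr01 (diagonal_fprop dD) (nb_uniq hX 1 x))//.
rewrite (bigD1_seq x) ?nb_uniq ?nb_self//= big1 ?addr0// => z zx.
by rewrite dD// => /esym/eqP; exact/negP.
Qed.

(** The two equations for [G] have different uses. The form r G = D + G D is the identity lifted to
    matrices; the form r G = D (1 + G) has [D] as left factor, so that [G] inherits its finite rank
    approximations, with constants independent of the point. *)
Lemma diagonal_neumann (D : X -> X -> H -> H) (c r : R) : UC D -> diagonal D ->
  0 <= c -> c < r -> (forall x, bnd (D x x) c) ->
  exists2 F, UC F & r%:C *: F = D + opmx_mul F D.
Proof.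
move=> uD dD c0 cr bD; have [_ lD _ aD] := (UCP _).1 uD.
pose G x := sval (cid (neumann (lD x x) (bD x) c0 cr)).
have hG x : [/\ linear (G x), forall v, r%:C *: G x v = D x x v + G x (D x x v),
    forall v, r%:C *: G x v = D x x (v + G x v) & bnd (G x) (c / (r - c))].
  by rewrite /G; case: cid.
have rc : 0 < r - c by rewrite subr_gt0.
have r0 : 0 < r by exact: (le_lt_trans c0 cr).
have k0 : 0 <= c / (r - c) by rewrite divr_ge0// ltW.
pose F x y := if x == y then G x else 0.
have dF : diagonal F by move=> x y /eqP/negbTE xy; rewrite /F xy.
have lF x y : linear (F x y).
  rewrite /F; case: ifP => _; first by have [] := hG x.
  by move=> l u v; rewrite -[LHS]/(0 : H) -[RHS]/(l *: 0 + 0 : H) scaler0 addr0.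
exists F.
  apply/UCP; split=> //; first by exists 1 => //; exact: diagonal_fprop.
    exists (c / (r - c)) => // x y v; rewrite /F; case: ifP => _; first by have [] := hG x.
    by rewrite -[X in rnorm X]/(0 : H) rnorm0 mulr_ge0 ?rnorm_ge0.
  move=> e e0; pose k := r^-1 * (1 + c / (r - c)).
  have kp : 0 < k by rewrite mulr_gt0 ?invr_gt0// ltr_wpDr.
  have [N hN] := aD _ (divr_gt0 e0 kp); exists N => x y; rewrite /F; case: ifP => _.
    have [lG _ GE bG] := hG x.
    have lg : linear (fun v => (r^-1)%:C *: (v + G x v)).
      move=> l u v; rewrite lG !scalerDr !scalerA [in RHS]mulrC addrACA.
      by congr (_ + _); rewrite [_ * l]mulrC.
    have -> : G x = D x x \o (fun v => (r^-1)%:C *: (v + G x v)).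
      apply/funext => v /=; rewrite (linZ (lD x x)) -GE scalerA -rmorphM mulVf ?gt_eqF//.
      by rewrite scale1r.
    have bg : bnd (fun v => (r^-1)%:C *: (v + G x v)) k.
      move=> v; rewrite rnormZ rnormR ger0_norm ?invr_ge0 ?(ltW r0)// /k -mulrA.
      rewrite ler_wpM2l ?invr_ge0 ?(ltW r0)// mulrDl mul1r.
      by apply: le_trans (rnormD _ _) _; rewrite lerD2l.
    have := fr_approx_comp_r (hN x x) lg bg (ltW (divr_gt0 e0 kp)).
    by rewrite mulfVK ?gt_eqF.
  exact: fr_approx0 (ltW e0).
apply/funext => x; apply/funext => y; apply/funext => v.
rewrite -[LHS]/(r%:C *: F x y v) -[RHS]/(D x y v + opmx_mul F D x y v).
rewrite (diagonal_mul _ _ _ _ dF) /F eqxx; case: eqP => [<-|xy].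
  by have [_ ->] := hG x.
have [lG _ _ _] := hG x.
rewrite (dD _ _ xy) -[(0 : H -> H) v]/(0 : H) (lin0 lG) addr0.
by rewrite scaler0.
Qed.

Section Rep.
Variables (K : hilbertType R) (pi : UCA -> K -> K).
Hypothesis hpi : star_representation pi.

Lemma rep_lin (A : starAlg R) (K' : hilbertType R) (rho : A -> K' -> K') T :
  star_representation rho -> sa_set T -> linear (rho T).
Proof. by move=> h uT; have [] := rep_bounded h uT. Qed.

(* Suppose [r = |pi T|^2 > c] and let [D = T^* T]. As [D] is diagonal, its Neumann
   series at [r] converges entrywise to a matrix of UC[X], so that [r - pi D] is
   invertible; but [r] is an approximate eigenvalue of [pi D]. *)
Lemma rep_diagonal (T : UCA) c : UC T -> diagonal (opmx_mul (opmx_star T) T) ->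
  0 <= c -> (forall x, bnd (opmx_mul (opmx_star T) T x x) c) ->
  forall xi, rnorm (pi T xi) ^+ 2 <= c * rnorm xi ^+ 2.
Proof.
move=> uT; have uT' := UC_star uT; have uD := UC_mul hX uT' uT.
set D := opmx_mul _ _ in uD *; move=> dD c0 bD xi.
have [lpi bpi] := rep_bounded hpi uT.
have fpi : (opnorm (pi T) \is a fin_num)%E by rewrite ge0_fin_numE// opnorm_ge0.
pose N := fine (opnorm (pi T)).
have NE : opnorm (pi T) = N%:E by rewrite fineK.
have N0 : 0 <= N by rewrite fine_ge0// opnorm_ge0.
have bN v : rnorm (pi T v) <= N * rnorm v by apply: opnorm_bound; rewrite ?NE.
have [Nc|cN] := leP (N ^+ 2) c.
  apply: le_trans (_ : _ <= (N * rnorm xi) ^+ 2) _.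
    by rewrite ler_pXn2r ?nnegrE ?mulr_ge0 ?rnorm_ge0.
  by rewrite exprMn ler_wpM2r// sqr_ge0.
exfalso; set r := N ^+ 2 in cN.
have r0 : 0 < r by exact: (le_lt_trans c0 cN).
have Np : 0 < N by rewrite lt_neqAle N0 andbT eq_sym -sqrf_eq0 gt_eqF.
have [F uF FE] := diagonal_neumann uD dD c0 cN bD.
have [C C0 bC] := ((bounded_operatorP _).1 (rep_bounded hpi uF)).2.
have lF := rep_lin hpi uF.
(* The estimates below end in r - delta < 2 (1 + C)^2 delta. With this choice delta (1 + 2 (1 +
   C)^2) is r/2, a contradiction. *)
pose delta := r / (2 * (1 + 2 * (1 + C) ^+ 2)).
have k0 : 0 < 1 + 2 * (1 + C) ^+ 2 by rewrite ltr_pwDl// mulr_ge0// sqr_ge0.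
have d0 : 0 < delta by rewrite divr_gt0// mulr_gt0.
have dE : delta * (1 + 2 * (1 + C) ^+ 2) = r / 2 by rewrite /delta; field; rewrite gt_eqF.
have dr : delta < r.
  have : delta <= delta * (1 + 2 * (1 + C) ^+ 2).
    by rewrite ler_pMr// lerDl mulr_ge0// sqr_ge0.
  by rewrite dE => /le_lt_trans; apply; rewrite ltr_pdivrMr// ltr_pMr// ltr1n.
(* A vector [eta] that nearly attains the norm is nearly an eigenvector: the squared norm of [zeta],
   the defect of the eigenvalue equation, is at most 2 r delta. *)
have : ((Num.sqrt (r - delta))%:E < opnorm (pi T))%E.
  rewrite NE lte_fin -[ltRHS]ger0_norm// -sqrtr_sqr ltr_sqrt// -/r.
  by rewrite gtrBl.
move=> /ereal_sup_gt[_ [eta /= eta1 <-]]; rewrite lte_fin => het.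
have {}het : r - delta < rnorm (pi T eta) ^+ 2.
  rewrite -[ltLHS]sqr_sqrtr ?subr_ge0 ?(ltW dr)//.
  by rewrite ltr_pXn2r ?nnegrE ?sqrtr_ge0 ?rnorm_ge0.
have piDE : pi D = pi (opmx_star T) \o pi T by exact: (rep_mul hpi uT' uT).
have D_dot : hdot (pi D eta) eta = (rnorm (pi T eta) ^+ 2)%:C.
  by rewrite piDE /= hdotC -(rep_star hpi uT) hdotxx conjE conjc_real.
have bT' v : rnorm (pi (opmx_star T) v) <= N * rnorm v.
  have := rep_star hpi uT (pi (opmx_star T) v) v; rewrite [RHS]hdotxx => h.
  have := hdot_CS (pi T (pi (opmx_star T) v)) v.
  rewrite h rnormR ger0_norm ?sqr_ge0// => A.
  have B := ler_wpM2r (rnorm_ge0 v) (bN (pi (opmx_star T) v)).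
  have [->|v0] := eqVneq (rnorm (pi (opmx_star T) v)) 0; first by rewrite mulr_ge0 ?rnorm_ge0.
  have vp : 0 < rnorm (pi (opmx_star T) v) by rewrite lt_neqAle eq_sym v0 rnorm_ge0.
  by rewrite -(ler_pM2l vp) -expr2; apply: le_trans A _; rewrite mulrCA mulrA.
have bDe : rnorm (pi D eta) <= r.
  rewrite piDE /=; apply: le_trans (bT' _) _; rewrite /r expr2 ler_wpM2l//.
  by apply: le_trans (bN _) _; rewrite ler_piMr.
pose zeta := pi D eta - r%:C *: eta.
have hz : rnorm zeta ^+ 2 <= 2 * r * delta.
  rewrite -hnormE (snormB2 (hdot_sip K)) !hnormE hdotZr conjE conjc_real D_dot.
  rewrite -rmorphM RecK rnormZ rnormR gtr0_norm// exprMn.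
  have A : rnorm (pi D eta) ^+ 2 <= r ^+ 2 by rewrite ler_pXn2r ?nnegrE ?rnorm_ge0 ?(ltW r0).
  have B : r ^+ 2 * rnorm eta ^+ 2 <= r ^+ 2.
    by rewrite ler_piMr ?sqr_ge0// expr_le1// rnorm_ge0.
  have E : r * (r - delta) <= r * rnorm (pi T eta) ^+ 2 by rewrite ler_pM2l// ltW.
  move: A B E; rewrite mulrBr -expr2 -[2 * r * delta]mulrA.
  move: (r ^+ 2) (r * delta) (rnorm (pi D eta) ^+ 2) (r * rnorm _ ^+ 2) => a b x y.
  lra.
have rE : r%:C *: pi F eta = pi D eta + pi F (pi D eta).
  have u0 : @sa_set R UCA 0 by exact: is_linsub0 (UC_is_linsub X H).
  have uFD := UC_mul hX uF uD.
  have pi0 : pi 0 = 0.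
    have := rep_linear hpi (-1) u0 u0.
    by rewrite scaler0 addr0 scaleN1r addNr.
  have := rep_linear hpi r%:C uF u0; rewrite addr0 pi0 addr0 FE.
  have := rep_linear hpi 1 uD uFD; rewrite !scale1r (rep_mul hpi uF uD) => ->.
  by move=> /(congr1 (fun f => f eta))/esym.
(* [FE] says F (r - D) = D. Since [zeta] is small, so is D eta, and so is r eta = D eta - zeta; but
   [h4] keeps [eta] away from 0. *)
have hF : pi F zeta = - pi D eta.
  by rewrite (linB lF) (linZ lF) rE opprD addrCA subrr addr0.
have h1 : rnorm (pi D eta) <= C * rnorm zeta by rewrite -rnormN -hF.
have h2 : r * rnorm eta <= (1 + C) * rnorm zeta.
  have -> : r * rnorm eta = rnorm (pi D eta - zeta).
    by rewrite /zeta opprB addrCA subrr addr0 rnormZ rnormR gtr0_norm.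
  by apply: le_trans (rnormB _ _) _; rewrite mulrDl mul1r addrC lerD2l.
have h3 : r ^+ 2 * rnorm eta ^+ 2 <= (1 + C) ^+ 2 * (2 * r * delta).
  rewrite -exprMn; apply: (@le_trans _ _ (((1 + C) * rnorm zeta) ^+ 2)).
    by rewrite ler_pXn2r ?nnegrE ?mulr_ge0 ?rnorm_ge0 ?addr_ge0 ?(ltW r0).
  by rewrite exprMn ler_wpM2l ?sqr_ge0.
have h4 : r - delta < r * rnorm eta ^+ 2.
  apply: lt_le_trans het _; rewrite /r -exprMn.
  by rewrite ler_pXn2r ?nnegrE ?mulr_ge0 ?rnorm_ge0.
have h5 : r * (r - delta) < r * (2 * (1 + C) ^+ 2 * delta).
  apply: (@lt_le_trans _ _ (r * (r * rnorm eta ^+ 2))); first by rewrite ltr_pM2l.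
  rewrite mulrA -expr2; apply: le_trans h3 _; rewrite le_eqVlt; apply/orP; left.
  by apply/eqP; ring.
move: h5; rewrite ltr_pM2l// => h5.
have : r < r / 2 by rewrite -dE mulrDr mulr1 mulrC -ltrBlDl.
by rewrite ltr_pdivlMr// gtr_pMr// ltNge ler1n.
Qed.

End Rep.

(* One entry is selected in every row, which makes the square of a slice diagonal. *)
Definition slice (C : zmodType) S (T : X -> X -> C) i : X -> X -> C :=
  fun x y => if index y (nb S x) == i then T x y else 0.

Lemma slice_sum (C : zmodType) S (T : X -> X -> C) : 0 < S -> fprop S T ->
  T = \sum_(i < nbN S) slice S T i.
Proof.
move=> S0 hT; apply/funext => x; apply/funext => y; rewrite !fct_sumE /slice.
have [yx|yx] := boolP (y \in nb S x); last first.
  by rewrite (fprop_nb S0 hT yx) big1// => i _; case: ifP.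
have iN : (index y (nb S x) < nbN S)%N by rewrite (leq_trans _ (nb_size hX S x))// index_mem.
rewrite (bigD1 (Ordinal iN))//= eqxx big1 ?addr0// => i ii.
by case: ifP => // /eqP e; move: ii; rewrite -val_eqE /= e eqxx.
Qed.

Lemma slice_fprop (C : zmodType) S (T : X -> X -> C) i S' : fprop S' T -> fprop S' (slice S T i).
Proof. by move=> h x y /h; rewrite /slice => ->; case: ifP. Qed.

Lemma slice_inj (C : zmodType) S (T : X -> X -> C) i z x y : 0 < S -> fprop S T ->
  slice S T i z x <> 0 -> slice S T i z y <> 0 -> x = y.
Proof.
move=> S0 hT; rewrite /slice; case: eqP => // ix Tx; case: eqP => // iy Ty.
have mem w : T z w <> 0 -> w \in nb S z.
  by move=> Tw; apply: contraT => /(fprop_nb S0 hT).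
by rewrite -(nth_index x (mem _ Tx)) ix -iy nth_index// mem.
Qed.

Lemma slice_UC S (T : X -> X -> H -> H) i : UC T -> UC (slice S T i).
Proof. exact: (@UC_mask _ _ _ (fun x y => index y (nb S x) == i)). Qed.

Lemma adjoint0 : adjoint (0 : H -> H) = 0.
Proof. by apply: adjoint_eq => u v; rewrite hdot0l hdot0r. Qed.

Section SliceSquare.
Variables (S e : R) (T : X -> X -> H -> H) (i : nat).
Hypotheses (S0 : 0 < S) (uT : UC T) (hT : fprop S T) (e0 : 0 <= e)
  (bT : forall x y, bnd (T x y) e).
Local Notation Ti := (slice S T i).

Lemma slice_star_fprop : fprop S (opmx_star Ti).
Proof.
move=> x y; rewrite metric_sym => yx.
by rewrite /mx_star (slice_fprop _ _ hT yx) adjoint0.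
Qed.

Let bTi x y : bnd (Ti x y) e.
Proof.
by rewrite /slice; case: ifP => // _ v; rewrite -[X in rnorm X]/(0 : H) rnorm0 mulr_ge0 ?rnorm_ge0.
Qed.

Lemma slice_square_diagonal : diagonal (opmx_mul (opmx_star Ti) Ti).
Proof.
move=> x y xy; apply/funext => v.
rewrite (UC_mulE _ _ _ S0 slice_star_fprop (nb_uniq hX S x))// big1// => z _.
rewrite /mx_star.
have [Tx|Tx] := pselect (Ti z x = 0); first by rewrite Tx adjoint0.
have [Ty|Ty] := pselect (Ti z y = 0); last by have := xy (slice_inj S0 hT Tx Ty).
have [_ lTi _ _] := (UCP _).1 (UC_star (slice_UC S i uT)).
by rewrite Ty; exact: lin0 (lTi x z).
Qed.

Lemma slice_square_bnd x : bnd (opmx_mul (opmx_star Ti) Ti x x) ((nbN S)%:R * (e * e)).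
Proof.
move=> v; rewrite (UC_mulE _ _ _ S0 slice_star_fprop (nb_uniq hX S x))//.
apply: le_trans (rnorm_sum _ _ _) _; rewrite -[leRHS]mulrA.
apply: le_trans (sum_const_le (nb_size hX S x) _); last by rewrite !mulr_ge0 ?rnorm_ge0.
apply: ler_sum => z _; have [_ lTi _ _] := (UCP _).1 (slice_UC S i uT).
apply: le_trans (adjoint_bound e0 (lTi z x) (bTi z x) _) _.
by rewrite -mulrA; apply: ler_wpM2l => //; exact: bTi.
Qed.

End SliceSquare.

(** There are [nbN S] slices, and [rep_diagonal] bounds each by sqrt(nbN S) e, rounded up to nbN S
    times e. The constant depends on the propagation alone, so that entrywise approximation at fixed
    propagation is approximation in every representation. *)
Lemma UC_rep_bound S e (T : UCA) (K : hilbertType R) (pi : UCA -> K -> K) xi :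
  star_representation pi -> 0 < S -> UC T -> fprop S T -> 0 <= e ->
  (forall x y, bnd (T x y) e) ->
  rnorm (pi T xi) <= (nbN S)%:R ^+ 2 * e * rnorm xi.
Proof.
move=> hpi S0 uT hT e0 bT; rewrite (slice_sum S0 hT).
have [_ ->] := linear_on_sum (UC_is_linsub X H) (rep_linear hpi) (index_enum 'I_(nbN S))
  (fun i : 'I_(nbN S) => slice_UC S i uT).
rewrite fct_sumE; apply: le_trans (rnorm_sum _ _ _) _.
rewrite expr2 -!mulrA.
apply: le_trans (sum_const_le (s := index_enum 'I_(nbN S)) (n := nbN S) _ _); last first.
- by rewrite !mulr_ge0 ?rnorm_ge0.
- by rewrite /index_enum unlock -enumT size_enum_ord.
apply: ler_sum => i _.
have := rep_diagonal hpi (slice_UC S i uT) (slice_square_diagonal i S0 uT hT) _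
  (slice_square_bnd i S0 uT hT e0 bT) xi.
rewrite mulr_ge0 ?mulr_ge0// => /(_ isT) h.
rewrite -(@ler_pXn2r _ 2) ?nnegrE ?mulr_ge0 ?rnorm_ge0//; apply: le_trans h _.
rewrite [leRHS](_ : _ = (nbN S)%:R ^+ 2 * (e * e) * rnorm xi ^+ 2); last by ring.
rewrite ler_wpM2r ?sqr_ge0// ler_wpM2r ?mulr_ge0//.
by rewrite -natrX ler_nat; case: (nbN S) => // n; rewrite expnS leq_pmulr// expn_gt0.
Qed.

End RepBound.

(** * The corner embedding *)

Section Corner.
Variables (R : realType) (X : metricType R) (H : hilbertType R).
Hypothesis hX : bounded_geometry X.
Variable e : H.
Hypothesis e1 : hdot e e = 1.
Local Notation nb := (nb hX).
Local Notation nbN := (nbN hX).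
Local Notation opmx_mul := (mx_mul (fun f g : H -> H => f \o g)).
Local Notation opmx_star := (mx_star (@adjoint R H)).
Local Notation cmx := (X -> X -> R[i]^o).
Local Notation cmx_mul := (mx_mul (C := R[i]^o) *%R).
Local Notation cmx_star := (mx_star (@Num.conj R[i])).

Record Cu_spec (T : cmx) : Prop := {
  Cu_prop : exists2 S : R, 0 < S & fprop S T ;
  Cu_bnd : exists2 M : R, 0 <= M & forall x y, rnorm (T x y) <= M }.

Lemma CuP (T : cmx) : Cu T <-> Cu_spec T.
Proof.
split=> [[[S S0 h] [M hM]]|[[S S0 h] [M _ hM]]]; last by split; [exists S|exists M].
split; first by exists S.
by exists `|M| => // x y; apply: le_trans (hM x y) _; exact: ler_norm.
Qed.

Lemma Cu_is_linsub : is_linsub (@Cu R X).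
Proof.
split=> [|l S T]; rewrite !CuP.
  by split; [exists 1|exists 0 => // x y; rewrite rnorm0].
move=> [[r r0 hr] [M M0 bS]] [[r' r0' hr'] [M' M0' bT]]; split.
- exists (r + r'); first by rewrite addr_gt0.
  move=> x y xy; rewrite mx_linE hr; last by apply: le_trans xy; rewrite lerDl ltW.
  rewrite hr'; last by apply: le_trans xy; rewrite lerDr ltW.
  by rewrite scaler0 addr0.
- exists (rnorm l * M + M'); first by rewrite addr_ge0// mulr_ge0// rnorm_ge0.
  move=> x y; rewrite mx_linE; apply: le_trans (rnormD _ _) _.
  by rewrite lerD ?bT// rnormM ler_wpM2l ?rnorm_ge0 ?bS.
Qed.

Lemma Cu_mulE S (T1 T2 : cmx) x y s : 0 < S -> fprop S T1 -> uniq s ->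
  {subset nb S x <= s} -> cmx_mul T1 T2 x y = \sum_(z <- s) T1 x z * T2 z y.
Proof. by move=> S0 h us hs; rewrite (mx_mulE (@mul0r _) _ _ S0 h us hs). Qed.

Lemma Cu_mul (T1 T2 : cmx) : Cu T1 -> Cu T2 -> Cu (cmx_mul T1 T2).
Proof.
rewrite !CuP => -[[r r0 hr] [M M0 bS]] [[r' r0' hr'] [M' M0' bT]]; split.
- exists (r + r'); first by rewrite addr_gt0.
  by apply: (mx_mul_fprop hX) => // [b|x z]; rewrite ?mul0r ?mulr0.
- exists ((nbN r)%:R * (M * M')) => [|x y]; first by rewrite !mulr_ge0.
  rewrite (Cu_mulE _ _ r0 hr (nb_uniq hX r x))//.
  apply: le_trans (rnorm_sum _ _ _) _.
  apply: le_trans (sum_const_le (nb_size hX r x) _); last by rewrite mulr_ge0.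
  by apply: ler_sum => z _; rewrite rnormM ler_pM ?rnorm_ge0.
Qed.

Lemma Cu_star (T : cmx) : Cu T -> Cu (cmx_star T).
Proof.
rewrite !CuP => -[[r r0 hr] [M M0 bT]]; split.
- exists r => // x y; rewrite metric_sym => yx; rewrite /mx_star hr//.
  exact: rmorph0.
- by exists M => // x y; rewrite /mx_star rnormJ.
Qed.

(** An algebraic model of UC[X] p through [ket]: since p is the projection onto [e] at each point,
    an element of UC[X] p is determined by the images of [e] under its entries. *)
Definition column (a : X -> X -> H) : Prop :=
  (exists2 S : R, 0 < S & fprop S a) /\
  (exists2 M : R, 0 <= M & forall x y, rnorm (a x y) <= M).

Lemma column_is_linsub : is_linsub column.
Proof.
split=> [|l S T].
  by split; [exists 1|exists 0 => // x y; rewrite rnorm0].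
move=> [[r r0 hr] [M M0 bS]] [[r' r0' hr'] [M' M0' bT]]; split.
- exists (r + r'); first by rewrite addr_gt0.
  move=> x y xy; rewrite mx_linE hr; last by apply: le_trans xy; rewrite lerDl ltW.
  rewrite hr'; last by apply: le_trans xy; rewrite lerDr ltW.
  by rewrite scaler0 addr0.
- exists (rnorm l * M + M'); first by rewrite addr_ge0// mulr_ge0// rnorm_ge0.
  move=> x y; rewrite mx_linE; apply: le_trans (rnormD _ _) _.
  by rewrite lerD ?bT// rnormZ ler_wpM2l ?rnorm_ge0 ?bS.
Qed.

Lemma rnorm_e : rnorm e = 1.
Proof.
have /complexI/eqP : ((rnorm e ^+ 2)%:C = 1%:C :> R[i]) by rewrite -hdotxx e1.
by rewrite expr2 -expr2 sqrp_eq1 ?rnorm_ge0// => /eqP.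
Qed.

(* [ket a] is the operator matrix with entries [a x y (x) e^*]. *)
Definition ket (a : X -> X -> H) : X -> X -> H -> H := fun x y v => hdot v e *: a x y.

Lemma ket_frk a x y : ket a x y = frk [:: (a x y, e)].
Proof. by apply/funext => v; rewrite /frk big_seq1. Qed.

Lemma ket_UC0 a : column a -> UC0 (ket a).
Proof.
move=> [[S S0 hS] [M M0 hM]]; apply: (@UC0_intro _ _ _ _ S M 1%N) => //.
- by move=> x y /hS axy; apply/funext => v; rewrite /ket axy scaler0.
- move=> x y v; rewrite /ket rnormZ mulrC; apply: ler_pM; rewrite ?rnorm_ge0//.
  by have := hdot_CS v e; rewrite rnorm_e mulr1.
- by move=> x y; exists [:: (a x y, e)] => //; exact: ket_frk.
Qed.

Lemma UC0_UC (T : X -> X -> H -> H) : UC0 T -> UC T.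
Proof.
move=> uT; case: (uT) => hS cT _ _; split=> // r r0; exists T => // x y.
rewrite subrr; apply: le_lt_trans (opnorm_le (lexx 0) _) _; last by rewrite lte_fin.
by move=> v; rewrite -[X in rnorm X]/(0 : H) rnorm0 mul0r.
Qed.

Lemma ket_UC a : column a -> UC (ket a).
Proof. by move=> /ket_UC0/UC0_UC. Qed.

Definition vec (T : cmx) : X -> X -> H := fun x y => T x y *: e.
Definition corner (T : cmx) : X -> X -> H -> H := ket (vec T).
Definition one_mx : cmx := fun x y => (x == y)%:R.

Lemma vec_column (T : cmx) : Cu T -> column (vec T).
Proof.
move=> /CuP[[S S0 h] [M M0 hM]]; split.
  by exists S => // x y /h; rewrite /vec => ->; rewrite scale0r.
by exists M => // x y; rewrite rnormZ rnorm_e mulr1.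
Qed.

Lemma corner_UC (T : cmx) : Cu T -> UC (corner T).
Proof. by move=> /vec_column/ket_UC. Qed.

Lemma one_mx_diagonal : diagonal one_mx.
Proof. by move=> x y /eqP/negbTE xy; rewrite /one_mx xy. Qed.

Lemma Cu_one_mx : Cu one_mx.
Proof.
apply/CuP; split.
  by exists 1 => //; exact: diagonal_fprop one_mx_diagonal.
exists 1 => // x y; rewrite /one_mx; case: (x == y); last by rewrite rnorm0.
by rewrite -[1%:R]/(1%:C) rnormR normr1.
Qed.

Lemma one_mx_mul (T : cmx) : cmx_mul one_mx T = T.
Proof.
apply/funext => x; apply/funext => y.
rewrite (Cu_mulE _ _ ltr01 (diagonal_fprop one_mx_diagonal) (nb_uniq hX 1 x))//.
rewrite (bigD1_seq x) ?nb_uniq ?nb_self//= big1 ?addr0 => [|z zx].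
  by rewrite /one_mx eqxx mul1r.
by rewrite /one_mx eq_sym (negbTE zx) mul0r.
Qed.

Lemma mul_one_mx (T : cmx) : Cu T -> cmx_mul T one_mx = T.
Proof.
move=> /CuP[[S S0 h] _]; apply/funext => x; apply/funext => y.
rewrite (Cu_mulE _ _ S0 h (nb_uniq hX S x))//.
have [yx|yx] := boolP (y \in nb S x).
  rewrite (bigD1_seq y) ?nb_uniq//= big1 ?addr0 => [|z zx].
    by rewrite /one_mx eqxx mulr1.
  by rewrite /one_mx (negbTE zx) mulr0.
rewrite (fprop_nb S0 h yx) big_seq big1// => z zx.
rewrite /one_mx; case: eqP => [zy|_]; last by rewrite mulr0.
by rewrite zy (negbTE yx) in zx.
Qed.

Lemma one_mx_star : cmx_star one_mx = one_mx.
Proof.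
apply/funext => x; apply/funext => y; rewrite /mx_star /one_mx eq_sym.
exact: rmorph_nat.
Qed.

Lemma corner_lin l (S T : cmx) : corner (l *: S + T) = l *: corner S + corner T.
Proof.
apply/funext => x; apply/funext => y; apply/funext => v.
rewrite mx_linE fun_linE /corner /ket /vec mx_linE scalerDl scalerDr.
congr (_ + _); rewrite !scalerA; congr (_ *: _).
by rewrite -[l *: S x y]/(l * S x y) mulrCA mulrA.
Qed.

Lemma corner_mul (S T : cmx) : Cu S -> Cu T ->
  corner (cmx_mul S T) = opmx_mul (corner S) (corner T).
Proof.
move=> uS uT; have /CuP[[r r0 hr] _] := uS.
have hc : fprop r (corner S).
  move=> x y /hr Sxy; apply/funext => v.
  by rewrite /corner /ket /vec Sxy scale0r scaler0.
apply/funext => x; apply/funext => y; apply/funext => v.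
rewrite (UC_mulE _ _ _ r0 hc (nb_uniq hX r x))// /corner /ket /vec.
rewrite (Cu_mulE _ _ r0 hr (nb_uniq hX r x))// scaler_suml scaler_sumr.
apply: eq_bigr => z _; rewrite !hdotZl e1 mulr1 !scalerA; congr (_ *: _).
by rewrite -mulrA [S x z * _]mulrC.
Qed.

Lemma ket_star a x y v : adjoint (ket a x y) v = hdot v (a x y) *: e.
Proof.
rewrite (@adjoint_eq _ _ _ (fun v => hdot v (a x y) *: e))// => u w.
by rewrite /ket hdotZl hdotZr (hdotC (a x y)) mulrC.
Qed.

Lemma corner_star (T : cmx) : corner (cmx_star T) = opmx_star (corner T).
Proof.
apply/funext => x; apply/funext => y; apply/funext => v.
rewrite [RHS]ket_star /corner /ket /vec hdotZr scalerA mulrC.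
by congr (_ *: _).
Qed.

Lemma mul_diagonal (T D : X -> X -> H -> H) x y v : UC T -> diagonal D ->
  opmx_mul T D x y v = T x y (D y y v).
Proof.
move=> /UCP[[S S0 h] lT _ _] dD; rewrite (UC_mulE _ _ _ S0 h (nb_uniq hX S x))//.
have D0 z : z != y -> T x z (D z y v) = 0.
  by move=> /eqP/dD ->; exact: lin0 (lT x z).
have [yx|yx] := boolP (y \in nb S x).
  by rewrite (bigD1_seq y) ?nb_uniq//= big1 ?addr0.
rewrite (fprop_nb S0 h yx) big_seq big1// => z zx; apply: D0.
by apply: contraNneq yx => <-.
Qed.

Lemma corner_cid_diagonal : diagonal (corner one_mx).
Proof.
move=> x y /one_mx_diagonal xy; apply/funext => v.
by rewrite /corner /ket /vec xy scale0r scaler0.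
Qed.

Lemma corner_cidE x v : corner one_mx x x v = hdot v e *: e.
Proof. by rewrite /corner /ket /vec /one_mx eqxx scale1r. Qed.

Lemma ket_one a : column a -> opmx_mul (ket a) (corner one_mx) = ket a.
Proof.
move=> /ket_UC uk; apply/funext => x; apply/funext => y; apply/funext => v.
rewrite (mul_diagonal _ _ _ uk corner_cid_diagonal) corner_cidE.
by rewrite /ket hdotZl e1 mulr1.
Qed.

Definition compress (T : X -> X -> H -> H) : cmx := fun x y => hdot (T x y e) e.

Lemma compress_Cu T : UC T -> Cu (compress T).
Proof.
move=> /UCP[[S S0 h] lT [M M0 bT] _]; apply/CuP; split.
  by exists S => // x y /h; rewrite /compress => ->; rewrite hdot0l.
exists M => // x y; apply: le_trans (hdot_CS _ _) _.
by have := bT x y e; rewrite rnorm_e !mulr1.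
Qed.

Lemma corner_compress T : UC T ->
  opmx_mul (corner one_mx) (opmx_mul T (corner one_mx)) = corner (compress T).
Proof.
move=> uT; apply/funext => x; apply/funext => y; apply/funext => v.
rewrite (diagonal_mul hX) ?corner_cidE; last exact: corner_cid_diagonal.
rewrite (mul_diagonal _ _ _ uT corner_cid_diagonal) corner_cidE.
have [_ lT _ _] := (UCP _).1 uT.
by rewrite (linZ (lT x y)) hdotZl /corner /ket /vec /compress scalerA.
Qed.

(** There is one product for each neighbour index i and rank index k. Given i, the row x determines
    the column y, so the left vector of the entry (x, y) can sit in the diagonal matrix [a i k] at
    x, while [b i k] carries the right vector and selects y. *)
Lemma UC0_span T : UC0 T -> exists s : seq ((X -> X -> H) * (X -> X -> H)),
  (forall p, p \in s -> column p.1 /\ column p.2) /\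
  T = \sum_(p <- s) opmx_mul (ket p.1) (opmx_star (ket p.2)).
Proof.
move=> /UC0_spec[S [M [N [S0 hS M0 hs]]]].
pose s x y := sval (cid (hs x y)).
have sP x y : [/\ (size (s x y) <= N)%N, T x y = frk (s x y), bnd (T x y) M &
    forall p, p \in s x y -> rnorm p.1 <= 1 /\ rnorm p.2 <= M].
  by rewrite /s; case: cid.
pose u k x y := (nth (0, 0) (s x y) k).1.
pose w k x y := (nth (0, 0) (s x y) k).2.
have uw k x y : rnorm (u k x y) <= 1 /\ rnorm (w k x y) <= M.
  have [kN|kN] := ltnP k (size (s x y)); last first.
    by rewrite /u /w nth_default// rnorm0.
  by have [_ _ _ h] := sP x y; apply: h; exact: mem_nth.
(* When x has no i-th neighbour, [nth] returns the default x; this is harmless, as [b i k] then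
   vanishes. *)
pose a i k : X -> X -> H := fun x z => if x == z then u k x (nth x (nb S x) i) else 0.
pose b i k : X -> X -> H := fun y x =>
  if (y \in nb S x) && (index y (nb S x) == i) then w k x y else 0.
have ca i k : column (a i k).
  split.
    exists 1 => // x z xz; rewrite /a; case: eqP => // xz'.
    by move: xz; rewrite xz' mdistxx lt_geF.
  exists 1 => // x z; rewrite /a; case: ifP => _; last by rewrite rnorm0.
  by have [] := uw k x (nth x (nb S x) i).
have cb i k : column (b i k).
  split.
    exists S => // y x; rewrite metric_sym => yx.
    by rewrite /b mem_nb// ltNge yx.
  exists M => // y x; rewrite /b; case: ifP => _; last by rewrite rnorm0.
  by have [] := uw k x y.
exists [seq (a i k, b i k) | i <- iota 0 (nbN S), k <- iota 0 N]; split.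
  by move=> p /allpairsP[[i k] /= [_ _ ->]]; split; [exact: ca|exact: cb].
rewrite big_allpairs_dep /=; apply/funext => x; apply/funext => y; apply/funext => v.
have E i k : opmx_mul (ket (a i k)) (opmx_star (ket (b i k))) x y v =
    if (y \in nb S x) && (index y (nb S x) == i) then hdot v (w k x y) *: u k x y else 0.
  have dk : diagonal (ket (a i k)).
    move=> x' z /eqP/negbTE xz; apply/funext => v'.
    by rewrite /ket /a xz scaler0.
  rewrite (diagonal_mul hX)// /mx_star ket_star {1}/ket hdotZl e1 mulr1.
  rewrite /a eqxx /b; case: ifP => [/andP[yx /eqP <-]|_].
    by rewrite nth_index.
  by rewrite hdot0r scale0r.
rewrite fct_sumE fct_sumE fct_sumE.
under eq_bigr do rewrite fct_sumE fct_sumE fct_sumE.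
under eq_bigr do under eq_bigr do rewrite E.
have [yx|yx] := boolP (y \in nb S x); last first.
  by rewrite (fprop_nb S0 hS yx) /= big1// => i _; rewrite big1.
have iN : index y (nb S x) \in iota 0 (nbN S).
  by rewrite mem_iota/= (leq_trans _ (nb_size hX S x))// index_mem.
rewrite (bigD1_seq _ iN) ?iota_uniq//= eqxx [X in _ + X]big1 ?addr0 => [|i ii]; last first.
  by rewrite big1// => k _; rewrite eq_sym (negbTE ii).
have [sN -> _ _] := sP x y.
(* The decompositions of the entries have varying lengths up to [N]; past the end the default (0, 0)
   contributes nothing. *)
rewrite /frk (big_nth (0, 0)) -(subnKC sN) iotaD big_cat/= -/(index_iota 0 _).
rewrite /index_iota subn0 [X in _ = _ + X]big_seq [X in _ = _ + X]big1 ?addr0// => k.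
rewrite mem_iota => /andP[sk _].
by rewrite /u nth_default// scaler0.
Qed.

End Corner.

(** * Induced representations *)

Lemma conj_mulR (R : realType) (z : R[i]) (a : R) :
  Num.conj (z * a%:C) = Num.conj z * a%:C :> R[i].
Proof. by rewrite rmorphM /= !conjE conjc_real. Qed.

(** * Positivity of Gram matrices in vector states *)

Section GramPositivity.
Variables (R : realType) (X : metricType R).
Hypothesis hX : bounded_geometry X.
Variables (K : hilbertType R) (pi : Cu_alg X -> K -> K) (xi : K).
Hypothesis hpi : star_representation pi.
Local Notation nb := (nb hX).
Local Notation nbN := (nbN hX).
Local Notation cmx := (X -> X -> R[i]^o).
Local Notation cmx_mul := (mx_mul (C := R[i]^o) *%R).
Local Notation cmx_star := (mx_star (@Num.conj R[i])).

Definition vstate (c : cmx) : R[i] := hdot (pi c xi) xi.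

Lemma vstate_lin l (S T : cmx) : Cu S -> Cu T ->
  vstate (l *: S + T) = l * vstate S + vstate T.
Proof.
by move=> uS uT; rewrite /vstate (rep_linear hpi l uS uT) fun_linE hdotDl hdotZl.
Qed.

Lemma vstate0 : vstate 0 = 0.
Proof.
have u0 : @Cu R X 0 by exact: is_linsub0 (Cu_is_linsub X).
have := vstate_lin (-1) u0 u0.
by rewrite scaler0 addr0 mulN1r addNr.
Qed.

Lemma vstateB l (S T : cmx) : Cu S -> Cu T ->
  vstate (l *: S - T) = l * vstate S - vstate T.
Proof.
move=> uS uT; have u0 : @Cu R X 0 by exact: is_linsub0 (Cu_is_linsub X).
have uN : Cu (-1 *: T + 0) by exact: (is_linsubP (Cu_is_linsub X) (-1) uT u0).
have -> : l *: S - T = l *: S + (-1 *: T + 0) by rewrite addr0 scaleN1r.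
by rewrite vstate_lin// vstate_lin// vstate0 addr0 mulN1r.
Qed.

Lemma vstate_star (T : cmx) : Cu T -> vstate (cmx_star T) = Num.conj (vstate T).
Proof.
by move=> uT; rewrite /vstate hdotC -(rep_star hpi uT).
Qed.

Lemma vstate_square (T : cmx) : Cu T ->
  vstate (cmx_mul (cmx_star T) T) = (rnorm (pi T xi) ^+ 2)%:C.
Proof.
move=> uT; rewrite /vstate (rep_mul hpi (Cu_star uT) uT) /=.
by rewrite hdotC -(rep_star hpi uT) hdotxx conjE conjc_real.
Qed.

Variable W : lmodType R[i].
Implicit Types (B : X -> W -> W -> R[i]) (v : X -> X -> W).

(** The form [B z] may vary with the point. The inner product of [H] yields positivity of the
    induced form; a scalar minus a positive operator at each point yields boundedness of the
    action. *)
Definition gram B v : cmx := fun x y => \sum_(z \in [set: X]) B z (v z y) (v z x).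

Lemma sip_snorm0l (f : W -> W -> R[i]) a b : semi_inner f -> snorm f a = 0 -> f a b = 0.
Proof.
move=> hf a0; apply/rnorm_eq0/eqP; rewrite eq_le rnorm_ge0 andbT.
by have := sip_CS hf a b; rewrite a0 mul0r.
Qed.

Lemma sip_snorm0r (f : W -> W -> R[i]) a b : semi_inner f -> snorm f b = 0 -> f a b = 0.
Proof. by move=> hf b0; rewrite (sip_conj hf) (sip_snorm0l _ hf b0) rmorph0. Qed.

Section Bounded.
Variables (B : X -> W -> W -> R[i]) (S M : R).
Hypotheses (hB : forall z, semi_inner (B z)) (S0 : 0 < S) (M0 : 0 <= M).

(** Vanishing is asked only up to [B z]-null vectors, since that is all an elimination step achieves
    when the forms are degenerate. *)
Definition gram_bounded v := (forall z x, S <= mdist z x -> snorm (B z) (v z x) = 0) /\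
  (forall z x, snorm (B z) (v z x) <= M).

Lemma gramE v x y : gram_bounded v ->
  gram B v x y = \sum_(z <- nb S x) B z (v z y) (v z x).
Proof.
move=> [h _]; rewrite /gram (fsumE (nb_uniq hX S x))// => z.
by rewrite mem_nb// -leNgt metric_sym => /h; exact: sip_snorm0r.
Qed.

Lemma gram_Cu v : gram_bounded v -> Cu (gram B v).
Proof.
move=> hv; apply/CuP; split.
  exists (S + S); first by rewrite addr_gt0.
  move=> x y xy; rewrite gramE// big_seq big1// => z; rewrite mem_nb// => zx.
  have [h _] := hv; apply: sip_snorm0l => //; apply: h.
  have := le_trans xy (metric_triangle x z y); move: zx.
  by move: (mdist x z) (mdist z y) => a b; lra.
exists ((nbN S)%:R * (M * M)) => [|x y]; first by rewrite !mulr_ge0.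
rewrite gramE//; apply: le_trans (rnorm_sum _ _ _) _.
apply: le_trans (sum_const_le (nb_size hX S x) _); last by rewrite mulr_ge0.
apply: ler_sum => z _; apply: le_trans (sip_CS (hB z) _ _) _.
by have [_ h] := hv; rewrite ler_pM ?snorm_ge0.
Qed.

(* One step of the Cholesky factorisation, performed at every point [z]
   simultaneously: it removes the [n]-th neighbour of [z] from the support of
   [v z], at the cost of a summand [c^* c]. *)
Lemma gram_step v n : gram_bounded v ->
  (forall z x, (n.+1 <= index x (nb S z))%N -> snorm (B z) (v z x) = 0) ->
  exists c v', [/\ Cu c, gram_bounded v',
    forall z x, (n <= index x (nb S z))%N -> snorm (B z) (v' z x) = 0 &
    gram B v = cmx_mul (cmx_star c) c + gram B v'].
Proof.
move=> hv; have [hvS hvM] := hv; move=> hvn.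
pose u z := v z (nth z (nb S z) n).
pose beta z := snorm (B z) (u z).
(* [c z x] is the coordinate of [v z x] along the normalised [u z], and [v' z x] is the orthogonal
   component. If [u z] is null, the inverse of 0 is 0 and nothing is removed; by Cauchy-Schwarz
   nothing has to be. *)
pose c : cmx := fun z x => B z (v z x) (u z) * ((beta z)^-1)%:C.
pose v' z x := v z x - (c z x * ((beta z)^-1)%:C) *: u z.
have vuE z x : B z (v z x) (u z) = c z x * (beta z)%:C.
  have [b0|b0] := eqVneq (beta z) 0.
    by rewrite (sip_snorm0r _ (hB z) b0) b0 mulr0.
  by rewrite /c -mulrA -rmorphM mulVf// mulr1.
have c_le z x : rnorm (c z x) <= snorm (B z) (v z x).
  rewrite /c rnormM rnormR ger0_norm ?invr_ge0 ?snorm_ge0//.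
  have [b0|b0] := eqVneq (beta z) 0; first by rewrite b0 invr0 mulr0 snorm_ge0.
  rewrite ler_pdivrMr; last by rewrite lt_neqAle eq_sym b0 snorm_ge0.
  exact: sip_CS.
have c0E z x : beta z = 0 -> c z x = 0 by rewrite /c => ->; rewrite invr0 mulr0.
have cuE z x : v z x = u z -> rnorm (c z x) = beta z.
  rewrite /c => ->; rewrite (sipE (hB z)) -/(beta z) -rmorphM rnormR.
  have [->|b0] := eqVneq (beta z) 0; first by rewrite invr0 mulr0 normr0.
  by rewrite expr2 mulfK// ger0_norm// snorm_ge0.
clearbody c.
have v'E z x y : B z (v' z y) (v' z x) = B z (v z y) (v z x) - c z y * Num.conj (c z x).
  rewrite /v' (sipBl (hB z)) !(sipBr (hB z)) !(sipZl (hB z)) !(sipZr (hB z)).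
  rewrite vuE (sip_conj (hB z) (u z) (v z x)) vuE (sipE (hB z)) -/(beta z) !conj_mulR.
  rewrite [(beta z ^+ 2)%:C]rmorphXn.
  have [b0|b0] := eqVneq (beta z) 0.
    by rewrite !c0E// !(mulr0, mul0r, rmorph0, subr0, subrr).
  have bb : ((beta z)^-1)%:C * (beta z)%:C = 1 :> R[i] by rewrite -rmorphM mulVf.
  transitivity (B z (v z y) (v z x)
    - (((beta z)^-1)%:C * (beta z)%:C) * (c z y * Num.conj (c z x))
    - (((beta z)^-1)%:C * (beta z)%:C) * (c z y * Num.conj (c z x))
    + (((beta z)^-1)%:C * (beta z)%:C) ^+ 2 * (c z y * Num.conj (c z x))).
    by move: (Num.conj (c z x)) (c z y) ((beta z)^-1)%:C => p q r; rewrite /=; ring.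
  by rewrite bb; ring.
have v'n z x : snorm (B z) (v' z x) ^+ 2 = snorm (B z) (v z x) ^+ 2 - rnorm (c z x) ^+ 2.
  apply: (@complexI R); rewrite -(sipE (hB z)) v'E (sipE (hB z)) -normCK rnormE.
  by rewrite rmorphB -[in LHS]rmorphXn.
have v'le z x : snorm (B z) (v' z x) <= snorm (B z) (v z x).
  by rewrite -(@ler_pXn2r _ 2) ?nnegrE ?snorm_ge0// v'n gerBl sqr_ge0.
have v'0 z x : snorm (B z) (v z x) = 0 -> snorm (B z) (v' z x) = 0.
  by move=> h; apply/eqP; rewrite eq_le snorm_ge0 andbT -h v'le.
have hv' : gram_bounded v'.
  by split=> z x => [/hvS/v'0//|]; exact: le_trans (v'le z x) (hvM z x).
have fc : fprop S c.
  move=> z x /hvS h; apply/rnorm_eq0/eqP; rewrite eq_le rnorm_ge0 andbT -h.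
  exact: c_le.
have uc : Cu c.
  apply/CuP; split; first by exists S.
  by exists M => // z x; exact: le_trans (c_le z x) (hvM z x).
have fc' : fprop S (cmx_star c).
  by move=> x z; rewrite metric_sym => /fc; rewrite /mx_star => ->; exact: rmorph0.
exists c, v'; split=> //.
- move=> z x; rewrite leq_eqVlt => /orP[/eqP nx|/hvn/v'0//].
  have [xz|xz] := boolP (x \in nb S z); last first.
    by apply/v'0/hvS; rewrite leNgt -(mem_nb hX)//.
  have ux : v z x = u z by rewrite /u nx nth_index.
  apply/eqP; rewrite -sqrf_eq0 v'n ux -/(beta z).
  by rewrite cuE// subrr.
- apply/funext => x; apply/funext => y.
  rewrite -[RHS]/(cmx_mul (cmx_star c) c x y + gram B v' x y).
  rewrite (Cu_mulE _ _ S0 fc' (nb_uniq hX S x))// !gramE// -big_split.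
  apply: eq_bigr => z _ /=; rewrite v'E /mx_star.
  by rewrite mulrC addrC subrK.
Qed.

(** Each elimination step clears one more position in all neighbourhoods, so after [nbN S] steps
    only null vectors remain. Each summand c^* c split off contributes the squared norm of
    [pi c xi]. *)
Lemma gram_pos v : gram_bounded v -> 0 <= vstate (gram B v).
Proof.
move=> hv.
have : forall z x, (nbN S <= index x (nb S z))%N -> snorm (B z) (v z x) = 0.
  move=> z x h; have [hS _] := hv; apply: hS; rewrite leNgt -(mem_nb hX)// -index_mem.
  by rewrite -leqNgt (leq_trans (nb_size hX S z)).
elim: (nbN S) v hv => [|n IH] v hv hn.
  have -> : gram B v = 0; last by rewrite vstate0.
  apply/funext => x; apply/funext => y; rewrite gramE// big1// => z _.
  by apply: sip_snorm0l => //; exact: hn.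
have [c [v' [uc hv' hn' ->]]] := gram_step hv hn.
have -> : cmx_mul (cmx_star c) c + gram B v' = 1 *: cmx_mul (cmx_star c) c + gram B v'.
  by rewrite scale1r.
rewrite vstate_lin; [|exact: Cu_mul (Cu_star uc) uc|exact: gram_Cu].
by rewrite mul1r addr_ge0 ?IH// vstate_square// ler0c sqr_ge0.
Qed.

End Bounded.
End GramPositivity.

(** * The representation induced along columns *)

Section InducedRepresentation.
Variables (R : realType) (X : metricType R) (H : hilbertType R).
Hypothesis hX : bounded_geometry X.
Variable e : H.
Hypothesis e1 : hdot e e = 1.
Variables (K : hilbertType R) (pi : Cu_alg X -> K -> K) (xi : K).
Hypothesis hpi : star_representation pi.
Local Notation nb := (nb hX).
Local Notation nbN := (nbN hX).
Local Notation UCA := (UC_alg X H).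
Local Notation opmx_mul := (mx_mul (fun f g : H -> H => f \o g)).
Local Notation opmx_star := (mx_star (@adjoint R H)).
Local Notation cmx := (X -> X -> R[i]^o).
Local Notation cmx_star := (mx_star (@Num.conj R[i])).
Local Notation omega := (vstate pi xi).

Let V : lmodType R[i] := linsub (column_is_linsub X H).
Implicit Types u v w : V.

(** This is b^* a, the [Cu]-valued inner product of UC[X] p, here linear in its first argument. *)
Definition col_form (a b : X -> X -> H) : cmx := fun x y => dotX (a^~ y) (b^~ x).

Lemma column_fsupp (a : X -> X -> H) y : column a -> fsupp (a^~ y).
Proof.
move=> [[S S0 h] _]; exists (nb S y); first exact: nb_uniq.
by move=> z; rewrite nb_sym// => zy; exact: fprop_nb h zy.
Qed.

Lemma col_formE (a b : X -> X -> H) S x y : 0 < S -> fprop S a ->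
  col_form a b x y = \sum_(z <- nb S y) hdot (a z y) (b z x).
Proof.
move=> S0 h; apply: dotX_supp; first exact: nb_uniq.
by move=> z; rewrite nb_sym// => zy; exact: fprop_nb h zy.
Qed.

Lemma col_form_Cu a b : column a -> column b -> Cu (col_form a b).
Proof.
move=> [[S S0 hS] [M M0 hM]] [[S' S'0 hS'] [M' M'0 hM']]; apply/CuP; split.
  exists (S + S'); first by rewrite addr_gt0.
  move=> x y xy; rewrite (col_formE _ _ _ S0 hS) big_seq big1// => z.
  rewrite mem_nb// => zy; rewrite hS' ?hdot0r//.
  have := le_trans xy (metric_triangle x z y); move: zy.
  rewrite [mdist z x]metric_sym [mdist y z]metric_sym.
  by move: (mdist x z) (mdist z y) => p q; lra.
exists ((nbN S)%:R * (M * M')) => [|x y]; first by rewrite !mulr_ge0.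
rewrite (col_formE _ _ _ S0 hS); apply: le_trans (rnorm_sum _ _ _) _.
apply: le_trans (sum_const_le (nb_size hX S y) _); last by rewrite mulr_ge0.
apply: ler_sum => z _; apply: le_trans (hdot_CS _ _) _.
by rewrite ler_pM ?rnorm_ge0.
Qed.

Lemma col_form_star a b : column a -> column b ->
  col_form b a = cmx_star (col_form a b).
Proof.
move=> [[S S0 hS] _] [[S' S'0 hS'] _]; apply/funext => x; apply/funext => y.
have SS : 0 < S + S' by rewrite addr_gt0.
have h : fprop (S + S') a by apply: fprop_le hS; rewrite lerDl ltW.
have h' : fprop (S + S') b by apply: fprop_le hS'; rewrite lerDr ltW.
rewrite (col_formE _ _ _ SS h') /mx_star (col_formE _ _ _ SS h).
rewrite rmorph_sum /=.
pose L := undup (nb (S + S') x ++ nb (S + S') y).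
have uL : uniq L by exact: undup_uniq.
rewrite -(dotX_supp (a^~ x) (nb_uniq hX (S + S') y)); last first.
  by move=> z; rewrite nb_sym// => zy; exact: fprop_nb h' zy.
rewrite (dotX_supp _ uL); last first.
  move=> z; rewrite mem_undup mem_cat negb_or => /andP[_].
  by rewrite nb_sym// => zy; exact: fprop_nb h' zy.
have -> : \sum_(z <- nb (S + S') x) Num.conj (hdot (a z x) (b z y)) =
    Num.conj (\sum_(z <- nb (S + S') x) hdot (a z x) (b z y)) :> R[i].
  by rewrite rmorph_sum.
rewrite -(dotX_supp (b^~ y) (nb_uniq hX (S + S') x)); last first.
  by move=> z; rewrite nb_sym// => zx; exact: fprop_nb h zx.
rewrite (dotX_supp (b^~ y) uL); last first.
  move=> z; rewrite mem_undup mem_cat negb_or => /andP[+ _].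
  by rewrite nb_sym// => zx; exact: fprop_nb h zx.
by rewrite rmorph_sum; apply: eq_bigr => z _; rewrite hdotC.
Qed.

Lemma dotX_linl (a b c : X -> H) l : fsupp a -> fsupp b ->
  dotX (l *: a + b) c = l * dotX a c + dotX b c.
Proof.
move=> [s us hs] [t ut ht]; pose L := undup (s ++ t).
have uL : uniq L by exact: undup_uniq.
have ha z : z \notin L -> a z = 0 by rewrite mem_undup mem_cat negb_or => /andP[/hs].
have hb z : z \notin L -> b z = 0 by rewrite mem_undup mem_cat negb_or => /andP[_ /ht].
rewrite !(dotX_supp _ uL)// => [|z zL]; last first.
  by rewrite fun_linE ha// hb// scaler0 addr0.
rewrite mulr_sumr -big_split; apply: eq_bigr => z _ /=.
by rewrite fun_linE hdotDl hdotZl.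
Qed.

(** Rieffel induction restricted to the tensors u (x) xi with [xi] fixed: their inner product is the
    value of the vector state on v^* u. No tensor product with [K] has to be formed, and one vector
    [xi] at a time is enough to compare operator norms. *)
Let form u v : R[i] := omega (col_form (val u) (val v)).

Lemma gram_boundedP (B : X -> H -> H -> R[i]) (a : X -> X -> H) (k : R) :
  (forall z, semi_inner (B z)) -> 0 <= k ->
  (forall z b, snorm (B z) b <= k * rnorm b) -> column a ->
  exists S M, [/\ 0 < S, 0 <= M & gram_bounded B S M a].
Proof.
move=> hB k0 hk [[S S0 hS] [M M0 hM]]; exists S, (k * M); split=> //; first by rewrite mulr_ge0.
split=> z x; first by move=> /hS ->; rewrite (snorm0 (hB z)).
by apply: le_trans (hk z _) _; rewrite ler_wpM2l.
Qed.

Let form_sip : semi_inner form.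
Proof.
split=> [l u v w|u v|u].
- rewrite /form -(vstate_lin xi hpi); try by exact: col_form_Cu (linsub_mem _) (linsub_mem _).
  congr omega; apply/funext => x; apply/funext => y.
  rewrite mx_linE -[RHS](dotX_linl _ l (column_fsupp y (linsub_mem u))
    (column_fsupp y (linsub_mem v))).
  by rewrite /col_form val_linsubP.
- rewrite /form (col_form_star (linsub_mem v) (linsub_mem u)) (vstate_star xi hpi)//.
  exact: col_form_Cu (linsub_mem _) (linsub_mem _).
- have hB (z : X) : semi_inner (fun x y : H => hdot x y) by exact: hdot_sip.
  have [z|S [M [S0 M0 h]]] := gram_boundedP hB ler01 _ (linsub_mem u).
    by move=> b; rewrite hnormE mul1r.
  exact: (gram_pos hX xi hpi hB S0 M0 h).
Qed.

Lemma act_column (T : X -> X -> H -> H) (a : X -> X -> H) : UC T -> column a ->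
  column (fun x y => act T (a^~ y) x).
Proof.
move=> uT [[r' r0' hr'] [M' M0' hM']]; have [[r r0 hr] lT [M M0 bT] _] := (UCP _).1 uT.
split.
  exists (r + r'); first by rewrite addr_gt0.
  move=> x y xy; rewrite (actE _ r0 hr (nb_uniq hX r x))// big_seq big1// => z zx.
  rewrite hr' ?(lin0 (lT x z))//; move: zx; rewrite mem_nb// => zx.
  have := le_trans xy (metric_triangle x z y); move: zx.
  by move: (mdist x z) (mdist z y) => p q; lra.
exists ((nbN r)%:R * (M * M')) => [|x y]; first by rewrite !mulr_ge0.
rewrite (actE _ r0 hr (nb_uniq hX r x))//; apply: le_trans (rnorm_sum _ _ _) _.
apply: le_trans (sum_const_le (nb_size hX r x) _); last by rewrite mulr_ge0.
apply: ler_sum => z _; apply: le_trans (bT _ _ _) _.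
by rewrite ler_wpM2l.
Qed.

Let rho (T : UCA) v : V :=
  if pselect (UC T) is left uT then to_linsub _ (act_column uT (linsub_mem v)) else 0.

Let rhoE T v : UC T -> val (rho T v) = fun x y => act T ((val v)^~ y) x.
Proof. by rewrite /rho; case: pselect. Qed.

Let rho_lin T : UC T -> linear (rho T).
Proof.
move=> uT l u v; apply/val_inj; rewrite val_linsubP !rhoE//.
apply/funext => x; apply/funext => y; rewrite mx_linE -[RHS]/((l *: _ + _) x).
have -> : (val (l *: u + v))^~ y = l *: (val u)^~ y + (val v)^~ y.
  by rewrite val_linsubP.
by rewrite (act_linr hX l _ _ uT).
Qed.

Let rho_linl l (S T : UCA) v : UC S -> UC T -> rho (l *: S + T) v = l *: rho S v + rho T v.
Proof.
move=> uS uT; have uST : UC (l *: S + T) by exact: (is_linsubP (UC_is_linsub X H)).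
apply/val_inj; rewrite val_linsubP !rhoE//.
by apply/funext => x; apply/funext => y; rewrite (act_linl hX l _ uS uT).
Qed.

Let rho_mul (S T : UCA) v : UC S -> UC T -> rho (opmx_mul S T) v = rho S (rho T v).
Proof.
move=> uS uT; have uST := UC_mul hX uS uT.
apply/val_inj; rewrite !rhoE//.
by apply/funext => x; apply/funext => y; rewrite (act_mul hX).
Qed.

Let rho_star (T : UCA) u v : UC T -> form (rho T u) v = form u (rho (opmx_star T) v).
Proof.
move=> uT; have uT' := UC_star uT; rewrite /form !rhoE//; congr omega.
apply/funext => x; apply/funext => y; rewrite /col_form.
by rewrite (act_adj hX)//; exact: column_fsupp (linsub_mem _).
Qed.

(** With [D] the diagonal square of the slice, k - D is a positive form at each point, so [gram_pos]
    applies to it and gives that the state of v^* D v is at most [k] times that of v^* v.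
    Diagonality is what lets the operator act inside the form at each point. *)
Let slice_bound S (T : X -> X -> H -> H) i : 0 < S -> fprop S T -> UC T ->
  exists c, forall v, snorm form (rho (slice hX S T i) v) <= c * snorm form v.
Proof.
move=> S0 hT uT; have [_ _ [M M0 bT] _] := (UCP _).1 uT.
set Ti := slice hX S T i.
have uTi : UC Ti by exact: slice_UC.
have uD := UC_mul hX (UC_star uTi) uTi.
have dD := slice_square_diagonal hX i S0 uT hT.
set D := opmx_mul (opmx_star Ti) Ti in uD dD.
have [_ lTi _ _] := (UCP _).1 uTi.
have DE z a b : hdot a (D z z b) = \sum_(w <- nb S z) hdot (Ti w z a) (Ti w z b).
  have hs : fprop S (opmx_star Ti) by exact: (slice_star_fprop hX i hT).
  rewrite /D (UC_mulE _ _ _ S0 hs (nb_uniq hX S z))// hdot_sumr.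
  by apply: eq_bigr => w _; rewrite -adjP.
pose k : R := (nbN S)%:R * (M * M).
have k0 : 0 <= k by rewrite !mulr_ge0.
have bD z := slice_square_bnd hX i S0 uT hT M0 bT z.
pose B z a b := k%:C * hdot a b - hdot a (D z z b).
have hB z : semi_inner (B z).
  split=> [l a b c|a b|a].
  - by rewrite /B hdotDl hdotZl hdotDl hdotZl; ring.
  - have A1 : Num.conj (k%:C * hdot b a) = k%:C * hdot a b.
      by rewrite mulrC conj_mulR (hdotC a b) mulrC.
    have A2 : Num.conj (hdot b (D z z a)) = hdot a (D z z b).
      by rewrite !DE rmorph_sum; apply: eq_bigr => w _; rewrite [RHS]hdotC.
    by rewrite /B rmorphB -A1 -A2.
  - rewrite /B hdotxx -rmorphM DE.
    have -> : \sum_(w <- nb S z) hdot (Ti w z a) (Ti w z a) =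
        (\sum_(w <- nb S z) rnorm (Ti w z a) ^+ 2)%:C.
      by rewrite rmorph_sum; apply: eq_bigr => w _; rewrite hdotxx.
    rewrite -rmorphB ler0c subr_ge0 /k -mulrA.
    apply: (@le_trans _ _ (\sum_(w <- nb S z) M * M * rnorm a ^+ 2)); last first.
      by apply: sum_const_le (nb_size hX S z) _; rewrite !mulr_ge0 ?rnorm_ge0.
    apply: ler_sum => w _; rewrite -expr2 -exprMn ler_pXn2r ?nnegrE ?mulr_ge0 ?rnorm_ge0//.
    rewrite /Ti /slice; case: ifP => _; first exact: bT.
    by rewrite -[X in rnorm X]/(0 : H) rnorm0 mulr_ge0 ?rnorm_ge0.
have kB z b : snorm (B z) b <= (k + 1) * rnorm b.
  rewrite -(@ler_pXn2r _ 2) ?nnegrE ?snorm_ge0 ?mulr_ge0 ?rnorm_ge0 ?addr_ge0//.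
  rewrite (snormE (hB z)) /B hdotxx -rmorphM.
  have DP : 0 <= complex.Re (hdot b (D z z b)).
    rewrite DE raddf_sum sumr_ge0// => w _; rewrite hdotxx /=; exact: sqr_ge0.
  rewrite raddfB /= exprMn.
  apply: (@le_trans _ _ (k * rnorm b ^+ 2)); first by rewrite gerBl.
  by rewrite ler_wpM2r ?sqr_ge0//; have := k0; nra.
exists (Num.sqrt k) => v.
rewrite -(@ler_pXn2r _ 2) ?nnegrE ?mulr_ge0 ?snorm_ge0 ?sqrtr_ge0//.
have kk : Num.sqrt k ^+ 2 = k by rewrite sqr_sqrtr.
rewrite exprMn kk -subr_ge0.
have [S' [M' [S'0 M'0 gb]]] := gram_boundedP hB (addr_ge0 k0 ler01) kB (linsub_mem v).
have := gram_pos hX xi hpi hB S'0 M'0 gb.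
have E : gram B (val v) = k%:C *: col_form (val v) (val v) - col_form (val v) (val (rho D v)).
  apply/funext => x; apply/funext => y.
  rewrite -[RHS]/(k%:C * col_form (val v) (val v) x y - col_form (val v) (val (rho D v)) x y).
  have [[r r0 hr] _] := linsub_mem v.
  rewrite !(col_formE _ _ _ r0 hr) mulr_sumr -sumrB /gram.
  rewrite (fsumE (nb_uniq hX r y)) => [|z]; last first.
    by rewrite nb_sym// => zy; rewrite (fprop_nb r0 hr zy) /B !hdot0l mulr0 subr0.
  apply: eq_bigr => z _; rewrite /B rhoE//; congr (_ - hdot _ _).
  rewrite (actE _ ltr01 (diagonal_fprop dD) (nb_uniq hX 1 z))//.
  rewrite (bigD1_seq z) ?nb_uniq ?nb_self//= big1 ?addr0// => w wz.
  by rewrite dD// => /esym/eqP; exact/negP.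
have uC u w : Cu (col_form (val u) (val w)) by exact: col_form_Cu (linsub_mem _) (linsub_mem _).
rewrite E (vstateB xi hpi _ (uC _ _) (uC _ _)).
rewrite -/(form v v) -/(form v (rho D v)).
have -> : form v (rho D v) = form (rho Ti v) (rho Ti v).
  by rewrite [RHS]rho_star// -rho_mul//; exact: UC_star.
move=> /Re_le /=.
by rewrite !(sipE form_sip) -rmorphM -rmorphB.
Qed.

Let rho_bound (T : X -> X -> H -> H) : UC T ->
  exists c, forall v, snorm form (rho T v) <= c * snorm form v.
Proof.
move=> uT; have [[S S0 hT] _ _ _] := (UCP _).1 uT.
have uTi i : UC (slice hX S T i) by exact: slice_UC.
have [c hc] : exists c : nat -> R, forall i v,
    snorm form (rho (slice hX S T i) v) <= c i * snorm form v.
  exists (fun i => sval (cid (slice_bound i S0 hT uT))) => i.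
  by case: cid.
exists (\sum_(i < nbN S) c i) => v.
have -> : rho T v = \sum_(i < nbN S) rho (slice hX S T i) v.
  rewrite {1}(slice_sum hX S0 hT).
  have rl l (S' T' : UCA) : UC S' -> UC T' ->
      (rho^~ v) (l *: S' + T') = l *: (rho^~ v) S' + (rho^~ v) T' by exact: rho_linl.
  by have [_ ->] := linear_on_sum (UC_is_linsub X H) rl (index_enum 'I_(nbN S))
    (fun i : 'I_(nbN S) => uTi i).
apply: le_trans (snorm_sum form_sip _ _ _) _; rewrite mulr_suml.
by apply: ler_sum => i _.
Qed.

(** The vector [w] is the class of p seen as a column. [corner e T] sends it to the column
    [vec e T], whose squared norm is the value of the state on T^* T, that is, the squared norm of
    [pi T xi]. *)
Lemma induced_representation : exists (H' : hilbertType R) (Pi : UCA -> H' -> H') (w : H'),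
  [/\ star_representation Pi, rnorm w <= rnorm xi &
    forall T, Cu T -> rnorm (Pi (corner e T) w) = rnorm (pi T xi)].
Proof.
have [H' [Pi [i [hPi il idot _ hact]]]] :=
  completed_representation (UC_closed H hX) form_sip rho_lin rho_bound rho_linl rho_mul rho_star.
pose p : V := to_linsub _ (vec_column e1 (Cu_one_mx X)).
have inorm v : rnorm (i v) = snorm form v by rewrite -hnormE /snorm idot.
have rhop T : Cu T -> val (rho (corner e T) p) = vec e T.
  move=> uT; have uc := corner_UC e1 uT; have [_ lc _ _] := (UCP _).1 uc.
  rewrite rhoE//; apply/funext => x; apply/funext => y.
  rewrite (@actE_supp _ _ _ _ _ x [:: y] lc)// ?big_seq1 => [|z].
    by rewrite to_linsubK /corner /ket /vec /one_mx eqxx scale1r e1 scale1r.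
  rewrite mem_seq1 => /negbTE zy.
  by rewrite to_linsubK /vec /one_mx zy scale0r.
have pE T : Cu T -> snorm form (rho (corner e T) p) = rnorm (pi T xi).
  move=> uT; have uc := corner_UC e1 uT.
  have /CuP[[S S0 hS] _] := uT.
  apply/eqP; rewrite -(@eqrXn2 _ 2) ?snorm_ge0 ?rnorm_ge0//; apply/eqP/(@complexI R).
  rewrite -(sipE form_sip) -(vstate_square xi hpi uT) /form; congr omega.
  rewrite (rhop _ uT).
  have hv : fprop S (vec e T) by move=> x y /hS; rewrite /vec => ->; rewrite scale0r.
  have hS' : fprop S (cmx_star T).
    by move=> x z; rewrite metric_sym => /hS; rewrite /mx_star => ->; exact: rmorph0.
  apply/funext => x; apply/funext => y.
  have SS : 0 < S + S by rewrite addr_gt0.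
  rewrite /col_form /dotX (fsumE (nb_uniq hX S x)) => [|z].
    rewrite (Cu_mulE _ _ S0 hS' (nb_uniq hX S x))//; apply: eq_bigr => z _.
    by rewrite /vec hdotZl hdotZr e1 mulr1 mulrC.
  by rewrite nb_sym// => zx; rewrite [vec e T z x](fprop_nb S0 hv zx) hdot0r.
exists H', Pi, (i p); split=> //.
  (* [pi] may be degenerate, sending the unit to a proper projection; the norm of [w] is that of the
     projected [xi]. *)
  have u1 := Cu_one_mx X.
  have -> : i p = i (rho (corner e (one_mx (X := X))) p).
    by congr i; apply/val_inj; rewrite rhop.
  rewrite inorm pE//.
  have := vstate_square xi hpi u1; rewrite one_mx_star (one_mx_mul hX) => h.
  have := hdot_CS (pi (one_mx (X := X)) xi) xi; rewrite -/(vstate _ _ _) h.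
  rewrite rnormR ger0_norm ?sqr_ge0// expr2.
  have [->|z0] := eqVneq (rnorm (pi (one_mx (X := X)) xi)) 0; first by rewrite rnorm_ge0.
  by rewrite ler_pM2l// lt_neqAle eq_sym z0 rnorm_ge0.
by move=> T uT; rewrite hact ?inorm ?pE//; exact: corner_UC.
Qed.

End InducedRepresentation.

(** * The maximal norm on the corner *)

Section MaxNorm.
Variables (R : realType) (X : metricType R) (H : hilbertType R).
Hypothesis hX : bounded_geometry X.
Variable e : H.
Hypothesis e1 : hdot e e = 1.

(** A representation of [UC] restricts along [corner e] to one of [Cu]; conversely, induction from a
    representation and a unit-ball vector recovers the norm of [pi T xi] at a vector that is no
    longer than [xi]. *)
Lemma max_norm_corner (T : Cu_alg X) : Cu T ->
  max_norm (corner e T : UC_alg X H) = max_norm T.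
Proof.
move=> uT; apply/eqP; rewrite eq_le; apply/andP; split.
  apply: ge_ereal_sup => _ [H' [Pi [hPi ->]]].
  apply: ereal_sup_ubound; exists H', (fun S => Pi (corner e S)); split=> //; split.
  - by move=> S uS; apply: (rep_bounded hPi); exact: corner_UC.
  - move=> l S S' uS uS'; rewrite corner_lin.
    by apply: (rep_linear hPi); exact: corner_UC.
  - move=> S S' uS uS'; rewrite (corner_mul hX e1)//.
    by apply: (rep_mul hPi); exact: corner_UC.
  - move=> S uS x y; rewrite corner_star.
    by apply: (rep_star hPi); exact: corner_UC.
apply: ge_ereal_sup => _ [K [pi [hpi ->]]].
apply: ge_ereal_sup => _ [xi /= xi1 <-].
have [H' [Pi [w [hPi w1 hw]]]] := induced_representation hX e1 xi hpi.
apply: (@le_trans _ _ (opnorm (Pi (corner e T)))); last first.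
  by apply: ereal_sup_ubound; exists H', Pi.
rewrite -hw//; apply: ereal_sup_ubound; exists w => //=.
exact: le_trans w1 xi1.
Qed.

End MaxNorm.

(** * The regular representation *)

Section L2.
Variables (R : realType) (X : metricType R).

Lemma l2norm_le (V : normedZmodType R[i]) (xi : X -> V) (c : R) : 0 <= c ->
  (l2norm xi <= c%:E)%E <->
  (forall s : seq X, uniq s -> \sum_(x <- s) rnorm (xi x) ^+ 2 <= c ^+ 2).
Proof.
move=> c0; set E := (\esum_(x in [set: X]) ((rnorm (xi x)) ^+ 2)%:E)%E.
have E0 : (0 <= E)%E by apply: esum_ge0 => x _; rewrite lee_fin sqr_ge0.
have -> : (l2norm xi <= c%:E)%E = (E <= (c ^+ 2)%:E)%E.
  rewrite /l2norm -/E; move: E0; case: E => [r r0||//].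
    rewrite poweR_EFin powR12_sqrt -?lee_fin// !lee_fin.
    by rewrite -[X in _ <= X]ger0_norm// -sqrtr_sqr ler_sqrt// sqr_ge0.
  by rewrite poweRyr// leNgt ltry leNgt ltry.
split=> [h s us|h].
  rewrite -lee_fin; apply: le_trans h; apply: esum_ge; exists [set` s].
    by split=> //; apply/finite_seqP; exists s.
  by rewrite -(@fsbig_seq _ _ _ _ _ _ us) sumEFin.
apply: ge_ereal_sup => _ [A [fA _] <-].
have /finite_seqP[s As] := fA.
have -> : (\sum_(x \in A) ((rnorm (xi x)) ^+ 2)%:E = (\sum_(x <- undup s) rnorm (xi x) ^+ 2)%:E)%E.
  have -> : A = [set` undup s] by rewrite As; apply/seteqP; split=> x /=; rewrite mem_undup.
  by rewrite -(@fsbig_seq _ _ _ _ _ _ (undup_uniq s)) sumEFin.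
by rewrite lee_fin h// undup_uniq.
Qed.

Lemma l2norm_mono (V W : normedZmodType R[i]) (xi : X -> V) (eta : X -> W) :
  (forall x, rnorm (xi x) <= rnorm (eta x)) -> (l2norm xi <= l2norm eta)%E.
Proof.
move=> h; have E0 (U : normedZmodType R[i]) (f : X -> U) :
    (0 <= \esum_(x in [set: X]) ((rnorm (f x)) ^+ 2)%:E)%E.
  by apply: esum_ge0 => x _; rewrite lee_fin sqr_ge0.
apply: gt0_ler_poweR => //; rewrite ?in_itv/= ?E0 ?leey//.
by apply: le_esum => x _; rewrite lee_fin ler_pXn2r ?nnegrE ?rnorm_ge0.
Qed.

Lemma l2_opnorm_ge0 (V : normedZmodType R[i]) (F : (X -> V) -> (X -> V)) :
  (0 <= l2_opnorm F)%E.
Proof.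
apply: (@le_trans _ _ (l2norm (F (fun=> 0)))); first exact: poweR_ge0.
apply: ereal_sup_ubound; exists (fun=> 0) => //=.
apply/l2norm_le => // s _; rewrite big1 ?expr1n// => x _.
by rewrite rnorm0 expr0n.
Qed.

End L2.

Section Reduced.
Variables (R : realType) (X : metricType R) (H : hilbertType R).
Hypothesis hX : bounded_geometry X.
Local Notation nb := (nb hX).
Local Notation UCA := (UC_alg X H).
Local Notation opmx_mul := (mx_mul (fun f g : H -> H => f \o g)).
Local Notation opmx_star := (mx_star (@adjoint R H)).

Lemma fsupp_is_linsub : is_linsub (@fsupp R X H).
Proof.
split=> [|l xi eta [s us hs] [t ut ht]]; first by exists [::].
exists (undup (s ++ t)); first exact: undup_uniq.
move=> z; rewrite mem_undup mem_cat negb_or => /andP[/hs xz /ht ez].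
by rewrite fun_linE xz ez scaler0 addr0.
Qed.

Let V : lmodType R[i] := linsub fsupp_is_linsub.
Implicit Types u v w : V.
Let form u v : R[i] := dotX (val u) (val v).

Let form_sip : semi_inner form.
Proof.
split=> [l u v w|u v|u].
- by rewrite /form val_linsubP dotX_linl//; exact: linsub_mem.
- have [s us hs] := linsub_mem u; have [t ut ht] := linsub_mem v.
  pose L := undup (s ++ t); have uL : uniq L by exact: undup_uniq.
  rewrite /form !(dotX_supp _ uL) ?rmorph_sum => [|z|z].
  + by apply: eq_bigr => z _; rewrite hdotC.
  + by rewrite mem_undup mem_cat negb_or => /andP[_ /ht].
  + by rewrite mem_undup mem_cat negb_or => /andP[/hs].
- have [s us hs] := linsub_mem u; rewrite /form (dotX_supp _ us hs).
  by rewrite sumr_ge0// => z _; rewrite hdotxx ler0c sqr_ge0.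
Qed.

Let form_norm u s : uniq s -> (forall z, z \notin s -> val u z = 0) ->
  snorm form u ^+ 2 = \sum_(z <- s) rnorm (val u z) ^+ 2.
Proof.
move=> us hs; rewrite (snormE form_sip) /form (dotX_supp _ us hs) raddf_sum.
by apply: eq_bigr => z _; rewrite hdotxx.
Qed.

Let form_norm_ge u s : uniq s -> \sum_(z <- s) rnorm (val u z) ^+ 2 <= snorm form u ^+ 2.
Proof.
move=> us; have [t ut ht] := linsub_mem u.
have uL : uniq (s ++ [seq x <- t | x \notin s]).
  rewrite cat_uniq us filter_uniq// andbT; apply/hasPn => x.
  by rewrite mem_filter => /andP[].
rewrite (form_norm uL) ?big_cat ?lerDl ?sumr_ge0// => [z _|z]; first exact: sqr_ge0.
by rewrite mem_cat mem_filter negb_or negb_and negbK => /andP[/negbTE -> /= /ht].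
Qed.

Let rho (T : UCA) v : V :=
  if pselect (UC T) is left uT then to_linsub _ (fsupp_act hX uT (linsub_mem v)) else 0.

Let rhoE T v : UC T -> val (rho T v) = act T (val v).
Proof. by rewrite /rho; case: pselect. Qed.

Let rho_lin T : UC T -> linear (rho T).
Proof.
move=> uT l u v; apply/val_inj.
by rewrite val_linsubP !rhoE// val_linsubP (act_linr hX l _ _ uT).
Qed.

Let rho_linl l (S T : UCA) v : UC S -> UC T -> rho (l *: S + T) v = l *: rho S v + rho T v.
Proof.
move=> uS uT; have uST : UC (l *: S + T) by exact: (is_linsubP (UC_is_linsub X H)).
by apply/val_inj; rewrite val_linsubP !rhoE// (act_linl hX l _ uS uT).
Qed.

Let rho_mul (S T : UCA) v : UC S -> UC T -> rho (opmx_mul S T) v = rho S (rho T v).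
Proof.
move=> uS uT; have uST := UC_mul hX uS uT.
by apply/val_inj; rewrite !rhoE// (act_mul hX).
Qed.

Let rho_star (T : UCA) u v : UC T -> form (rho T u) v = form u (rho (opmx_star T) v).
Proof.
move=> uT; have uT' := UC_star uT; rewrite /form !rhoE//.
by rewrite (act_adj hX)//; exact: linsub_mem.
Qed.

(** Supplied in the end by [compl_norm], which equates the norm with a real number. *)
Hypothesis hfin : forall T : UCA, UC T -> (UC_norm T < +oo)%E.

Let rho_norm T v : UC T -> snorm form (rho T v) <= fine (UC_norm T) * snorm form v.
Proof.
move=> uT; set N := fine _.
have NE : UC_norm T = N%:E by rewrite fineK// ge0_fin_numE ?hfin//; exact: l2_opnorm_ge0.
have N0 : 0 <= N by rewrite -lee_fin -NE; exact: l2_opnorm_ge0.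
have unit_case w : snorm form w <= 1 -> snorm form (rho T w) <= N.
  move=> w1; have [s us hs] := linsub_mem (rho T w).
  rewrite -(@ler_pXn2r _ 2) ?nnegrE ?snorm_ge0// (form_norm us hs) rhoE//.
  have : (l2norm (act T (val w)) <= N%:E)%E.
    rewrite -NE; apply: ereal_sup_ubound; exists (val w) => //=.
    apply/l2norm_le => // t ut; apply: le_trans (form_norm_ge w ut) _.
    by rewrite ler_pXn2r ?nnegrE ?snorm_ge0.
  by move=> /(l2norm_le _ N0); apply.
have [v0|v0] := eqVneq (snorm form v) 0.
  have [s us hs] := linsub_mem v.
  have vz : v = 0.
    apply/val_inj; rewrite raddf0; apply/funext => z; apply/rnorm_eq0/eqP.
    rewrite -sqrf_eq0; apply/eqP/le_anti; rewrite sqr_ge0 andbT.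
    have := @form_norm_ge v [:: z] isT.
    by rewrite big_seq1 v0 expr0n.
  by rewrite vz (lin0 (rho_lin uT)) !(snorm0 form_sip) mulr0.
have vp : 0 < snorm form v by rewrite lt_neqAle eq_sym v0 snorm_ge0.
have := unit_case (((snorm form v)^-1)%:C *: v).
rewrite (linZ (rho_lin uT)) !(snormZ form_sip) rnormR ger0_norm ?invr_ge0 ?snorm_ge0//.
by rewrite mulVf// => /(_ (lexx _)); rewrite ler_pdivrMl// mulrC.
Qed.

Let rho_bound (T : UCA) : UC T -> exists c, forall v, snorm form (rho T v) <= c * snorm form v.
Proof. by move=> uT; exists (fine (UC_norm T)) => v; exact: rho_norm. Qed.

(** The completion of the finitely supported families takes the place of l^2(X; H). Its operator
    norm has to be compared with [UC_norm], which ranges over all square-summable families. *)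
Lemma reduced_representation : exists (H' : hilbertType R) (La : UCA -> H' -> H'),
  star_representation La /\ forall T, UC T -> UC_norm T = opnorm (La T).
Proof.
have [H' [La [i [hLa il idot iden hact]]]] :=
  completed_representation (UC_closed H hX) form_sip rho_lin rho_bound rho_linl rho_mul rho_star.
exists H', La; split=> // T uT.
have inorm v : rnorm (i v) = snorm form v by rewrite -hnormE /snorm idot.
set N := fine (UC_norm T).
have NE : UC_norm T = N%:E by rewrite fineK// ge0_fin_numE ?hfin//; exact: l2_opnorm_ge0.
have N0 : 0 <= N by rewrite -lee_fin -NE; exact: l2_opnorm_ge0.
have [lLa bLa] := rep_bounded hLa uT.
have [_ [c c0 hc]] := (bounded_operatorP _).1 (rep_bounded hLa uT).
apply/eqP; rewrite eq_le; apply/andP; split; last first.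
  rewrite NE; apply: opnorm_le => // x.
  have [u Du ux] := dense_cvs x iden.
  have Lux := cvs_bounded lLa hc ux.
  apply/ler_addgt0Pl => e e0.
  have p : 0 < e / (N + 1) by rewrite divr_gt0// ltr_wpDl.
  have [M hM] := ux _ p.
  have A' : cvs (fun n => La T (u (n + M)%N)) (La T x).
    by move=> d /Lux[k hk]; exists k => n kn; apply: hk; exact: leq_trans (leq_addr _ _).
  apply: (cvs_le A') => n; have [v _ vu] := Du (n + M)%N.
  rewrite -vu hact// inorm; apply: le_trans (rho_norm v uT) _.
  rewrite -inorm vu -/N; have := hM (n + M)%N (leq_addl _ _).
  rewrite ltr_pdivlMr ?ltr_wpDl// => B.
  have := rnorm_distl (u (n + M)%N) x; have := rnorm_ge0 (u (n + M)%N - x).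
  move: (rnorm (u (n + M)%N - x)) (rnorm (u (n + M)%N)) (rnorm x) B N0 => a b d.
  move=> h1 h2 a0 /(ler_wpM2l h2) hb; apply: le_trans hb _.
  by move: h1; rewrite mulrDr mulr1 mulrDr [N * a]mulrC; move: (N * d) (a * N) => *; lra.
set N' := fine (opnorm (La T)).
have N'E : opnorm (La T) = N'%:E by rewrite fineK// ge0_fin_numE ?opnorm_ge0.
have N'0 : 0 <= N' by rewrite -lee_fin -N'E opnorm_ge0.
rewrite N'E; apply: ge_ereal_sup => _ [xi /= xi1 <-].
apply/l2norm_le => // s us; have [[r r0 hr] lT _ _] := (UCP _).1 uT.
(* By finite propagation the values of [act T xi] on the finite set [s] depend only on those of [xi]
   on [L], so [xi] may be cut off to [L]. *)
pose L := undup (flatten [seq nb r x | x <- s]); have uL : uniq L by exact: undup_uniq.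
have xL : fsupp (fun x => if x \in L then xi x else 0).
  by exists L => // z /negbTE ->.
pose v := to_linsub fsupp_is_linsub xL.
have -> : \sum_(x <- s) rnorm (act T xi x) ^+ 2 = \sum_(x <- s) rnorm (val (rho T v) x) ^+ 2.
  rewrite big_seq [RHS]big_seq; apply: eq_bigr => x xs; rewrite rhoE//.
  rewrite !(actE _ r0 hr (nb_uniq hX r x))//; congr (rnorm _ ^+ 2).
  rewrite big_seq [RHS]big_seq; apply: eq_bigr => z zx; rewrite to_linsubK.
  rewrite ifT// mem_undup; apply/flattenP; exists (nb r x) => //.
  by apply/mapP; exists x.
apply: le_trans (form_norm_ge _ us) _.
rewrite ler_pXn2r ?nnegrE ?snorm_ge0// -inorm -hact//.
have le' : (opnorm (La T) <= N'%:E)%E by rewrite N'E.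
have h := opnorm_bound (i v) lLa le'.
apply: le_trans h _; rewrite ler_piMr// inorm.
rewrite -(@ler_pXn2r _ 2) ?nnegrE ?snorm_ge0// (form_norm (s := L) uL); last first.
  by move=> z /negbTE zL; rewrite to_linsubK zL.
have -> : \sum_(z <- L) rnorm (val v z) ^+ 2 = \sum_(z <- L) rnorm (xi z) ^+ 2.
  by rewrite big_seq [RHS]big_seq; apply: eq_bigr => z zL; rewrite to_linsubK zL.
by move: xi1 => /(l2norm_le _ ler01); apply.
Qed.

End Reduced.

(** * The reduced norm on the corner *)

Section ReducedCorner.
Variables (R : realType) (X : metricType R) (H : hilbertType R).
Hypothesis hX : bounded_geometry X.
Variable e : H.
Hypothesis e1 : hdot e e = 1.

(** [corner e T] takes coordinates along [e], applies [T] and embeds the result along [e]. The first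
    map is contractive and the last isometric, so the two suprema bound each other. *)
Lemma reduced_norm_corner (T : Cu_alg X) : Cu T ->
  UC_norm (corner e T : UC_alg X H) = Cu_norm T.
Proof.
move=> uT; have uc := corner_UC e1 uT; have /CuP[[S S0 hS] _] := uT.
have hc : fprop S (corner e T).
  by move=> x y /hS Txy; apply/funext => v; rewrite /corner /ket /vec Txy scale0r scaler0.
have actc (xi : X -> H) x :
    act (corner e T) xi x = mx_act (H := R[i]^o) *%R T (fun z => hdot (xi z) e) x *: e.
  rewrite (actE _ S0 hc (nb_uniq hX S x))// /mx_act (fsumE (nb_uniq hX S x)).
    rewrite scaler_suml; apply: eq_bigr => z _.
    by rewrite /corner /ket /vec scalerA mulrC.
  by move=> z zx; rewrite (fprop_nb S0 hS zx) mul0r.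
have n1 : rnorm e = 1 by exact: rnorm_e.
have nact (xi : X -> H) :
    l2norm (act (corner e T) xi) = l2norm (mx_act (H := R[i]^o) *%R T (fun z => hdot (xi z) e)).
  apply/eqP; rewrite eq_le; apply/andP; split; apply: l2norm_mono => x;
    by rewrite actc rnormZ n1 mulr1.
apply/eqP; rewrite eq_le; apply/andP; split.
  apply: ge_ereal_sup => _ [xi /= xi1 <-]; rewrite [leLHS]nact.
  apply: ereal_sup_ubound; exists (fun z => hdot (xi z) e) => //=.
  apply: le_trans xi1; apply: l2norm_mono => x.
  by have := hdot_CS (xi x) e; rewrite n1 mulr1.
apply: ge_ereal_sup => _ [eta /= eta1 <-].
apply: ereal_sup_ubound; exists (fun z => eta z *: e) => /=.
  by apply: le_trans eta1; apply: l2norm_mono => x; rewrite rnormZ n1 mulr1.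
rewrite [LHS]nact; congr (l2norm (mx_act _ _ _)).
by apply/funext => z; rewrite hdotZl e1 mulr1.
Qed.

End ReducedCorner.

(** * Corners of C*-algebras *)

Section CStar.
Variables (R : realType) (A : cstarAlgType R).
Implicit Types a b c : A.

Lemma rnorm_cmul a b : rnorm (cmul a b) <= rnorm a * rnorm b.
Proof.
by rewrite /rnorm; have /Re_le := cnormM a b; rewrite !rnormE -rmorphM.
Qed.

Lemma rnorm_cstar_mul a : rnorm (cmul (cstar a) a) = rnorm a ^+ 2.
Proof. by rewrite /rnorm cnorm_star rnormE -rmorphXn. Qed.

Lemma rnorm_cstar a : rnorm (cstar a) = rnorm a.
Proof.
have le b : rnorm b <= rnorm (cstar b).
  have := rnorm_cmul (cstar b) b; rewrite rnorm_cstar_mul.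
  have := rnorm_ge0 b; have := rnorm_ge0 (cstar b).
  move: (rnorm b) (rnorm (cstar b)) => x y y0; rewrite le_eqVlt => /orP[/eqP <-//|x0].
  by rewrite expr2 ler_pM2r.
by apply/eqP; rewrite eq_le le andbT; have := le (cstar a); rewrite cstarK.
Qed.

Lemma cstarD a b : cstar (a + b) = cstar a + cstar b.
Proof. by have := cstar_semilinear 1 a b; rewrite !scale1r rmorph1 scale1r. Qed.

Lemma cstar0 : cstar 0 = 0 :> A.
Proof. by apply: (addrI (cstar 0)); rewrite -cstarD !addr0. Qed.

Lemma cstarZ (l : R[i]) a : cstar (l *: a) = Num.conj l *: cstar a.
Proof. by have := cstar_semilinear l a 0; rewrite cstar0 !addr0. Qed.

Lemma cstarZR (l : R) a : cstar (l%:C *: a) = l%:C *: cstar a.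
Proof. by rewrite cstarZ conjE conjc_real. Qed.

Lemma cstarB a b : cstar (a - b) = cstar a - cstar b.
Proof. by rewrite -scaleN1r addrC cstar_semilinear rmorphN rmorph1 scaleN1r addrC. Qed.

Lemma cmulDl a b c : cmul (a + b) c = cmul a c + cmul b c.
Proof. exact: (linD (cmul_linearl c)). Qed.
Lemma cmulDr a b c : cmul c (a + b) = cmul c a + cmul c b.
Proof. exact: (linD (cmul_linearr c)). Qed.
Lemma cmulBl a b c : cmul (a - b) c = cmul a c - cmul b c.
Proof. exact: (linB (cmul_linearl c)). Qed.
Lemma cmulBr a b c : cmul c (a - b) = cmul c a - cmul c b.
Proof. exact: (linB (cmul_linearr c)). Qed.
Lemma cmulZl (l : R[i]) a c : cmul (l *: a) c = l *: cmul a c.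
Proof. exact: (linZ (cmul_linearl c)). Qed.
Lemma cmulZr (l : R[i]) a c : cmul c (l *: a) = l *: cmul c a.
Proof. exact: (linZ (cmul_linearr c)). Qed.

Lemma cvs_cstar (u : nat -> A) a : cvs u a -> cvs (fun n => cstar (u n)) (cstar a).
Proof. by move=> ua r /ua[N hN]; exists N => n /hN; rewrite -cstarB rnorm_cstar. Qed.

Lemma cvs_cmul (u v : nat -> A) a b :
  cvs u a -> cvs v b -> cvs (fun n => cmul (u n) (v n)) (cmul a b).
Proof.
move=> ua vb; have [M M0 hM] := cauchys_bounded (cvs_cauchy ua).
have h1 : cvs (fun n => cmul (u n) b) (cmul a b).
  apply: (cvs_bounded (c := rnorm b) (cmul_linearl b) _ ua) => x.
  by rewrite mulrC; exact: rnorm_cmul.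
have h2 : cvs (fun n => cmul (u n) (v n - b)) 0.
  move=> r r0; have p : 0 < r / (M + 1) by rewrite divr_gt0// ltr_wpDl.
  have [N hN] := vb _ p; exists N => n /hN hn; rewrite subr0.
  apply: le_lt_trans (rnorm_cmul _ _) _; move: hn; rewrite ltr_pdivlMr ?ltr_wpDl//.
  have := hM n; have := rnorm_ge0 (u n); have := rnorm_ge0 (v n - b).
  move: (rnorm (v n - b)) (rnorm (u n)) => x y x0 y0 yM; apply: le_lt_trans.
  by rewrite mulrC ler_wpM2l// ler_wpDr.
have := cvsD h1 h2; rewrite addr0; apply: eq_cvs => n.
by rewrite cmulBr addrC subrK.
Qed.

Fixpoint sqrt_iter (t : A) (n : nat) : A :=
  if n is m.+1 then (2^-1)%:C *: (t + cmul (sqrt_iter t m) (sqrt_iter t m)) else 0.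

(** For |t| = 1 no geometric rate is available. The scalar iteration is monotone and bounded by 1,
    hence Cauchy, and it dominates both the iterates and their increments. *)
Fixpoint sqrt_majorant (n : nat) : R :=
  if n is m.+1 then 2^-1 * (1 + sqrt_majorant m ^+ 2) else 0.

Local Notation s := sqrt_majorant.

Lemma sqrt_majorant_ge0 n : 0 <= s n.
Proof. by case: n => [|n] //=; rewrite mulr_ge0 ?invr_ge0// addr_ge0// sqr_ge0. Qed.

Lemma sqrt_majorant_le1 n : s n <= 1.
Proof.
elim: n => [|n ih] //=; have := sqrt_majorant_ge0 n.
by move: (s n) ih => x x1 x0; nra.
Qed.

Lemma sqrt_majorant_le n : s n <= s n.+1.
Proof.
elim: n => [|n ih]; first exact: sqrt_majorant_ge0.
rewrite [s n.+1]/= [s n.+2]/= -/(s n.+1).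
rewrite ler_pM2l ?invr_gt0// lerD2l ler_pXn2r ?nnegrE ?sqrt_majorant_ge0//.
Qed.

Lemma sqrt_majorant_cauchy r : 0 < r ->
  exists N, forall n, (N <= n)%N -> `|s n - s N| < r.
Proof.
move=> r0; have nd : nondecreasing_seq s.
  by apply/nondecreasing_seqP => n; exact: sqrt_majorant_le.
have cs : cvgn s.
  apply: nondecreasing_is_cvgn => //; exists 1 => _ [n _ <-]; exact: sqrt_majorant_le1.
have /cvgrPdist_lt/(_ (r / 2)) := cs; rewrite divr_gt0// => /(_ isT)[N _ hN].
exists N => n Nn; have := hN n Nn; have := hN N (leqnn N).
rewrite !ltr_norml => /andP[? ?] /andP[? ?]; apply/andP; split; lra.
Qed.

(* The binomial series of [sqrt (p - t)] in disguise: [y = (t + y^2) / 2] has a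
   solution [y] dominated by the scalar case [t = 1], and [p - y] is the root. *)
Lemma projection_sqrt (p t : A) : cstar p = p -> cmul p p = p -> cstar t = t ->
    cmul p t = t -> cmul t p = t -> rnorm t <= 1 ->
  exists c, [/\ cstar c = c, cmul p c = c, cmul c p = c & cmul c c = p - t].
Proof.
move=> pS pp tS pt tp t1; pose y := sqrt_iter t.
have y_rec n : y n.+1 = (2^-1)%:C *: (t + cmul (y n) (y n)) by [].
have s_rec n : s n.+1 = 2^-1 * (1 + s n ^+ 2) by [].
have yS n : cstar (y n) = y n.
  elim: n => [|n ih] /=; first exact: cstar0.
  by rewrite cstarZR cstarD tS cstarM -/(y n) ih.
have yp n : cmul p (y n) = y n /\ cmul (y n) p = y n.
  elim: n => [|n [ih1 ih2]] /=.
    by rewrite (lin0 (cmul_linearr p)) (lin0 (cmul_linearl p)).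
  rewrite -/(y n) cmulZl cmulZr cmulDl cmulDr pt tp (cmulA p) ih1.
  by rewrite -(cmulA (y n)) ih2.
have half (v : A) : rnorm ((2^-1)%:C *: v) = 2^-1 * rnorm v.
  by rewrite rnormZ rnormR ger0_norm.
have ys n : rnorm (y n) <= s n.
  elim: n => [|n ih] /=; first by rewrite rnorm0.
  rewrite half ler_pM2l ?invr_gt0//; apply: le_trans (rnormD _ _) _.
  apply: lerD => //; apply: le_trans (rnorm_cmul _ _) _.
  by rewrite expr2 ler_pM ?rnorm_ge0.
have yB n : rnorm (y n.+1 - y n) <= s n.+1 - s n.
  elim: n => [|n ih].
    rewrite [y 0%N]/= subr0 [s 0%N]/= subr0; exact: ys.
  (* A difference of squares without commutativity. Its norm is at most half of (s n.+1 + s n) times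
     the increment, just as s n.+1 ^+ 2 - s n ^+ 2 factors in the scalar case. *)
  have -> : y n.+2 - y n.+1 =
      (2^-1)%:C *: (cmul (y n.+1) (y n.+1 - y n) + cmul (y n.+1 - y n) (y n)).
    rewrite 2!(y_rec _) -scalerBr -(y_rec n); congr (_ *: _).
    by rewrite cmulBr cmulBl addrA subrK opprD addrACA subrr add0r.
  rewrite half 2!(s_rec _) -mulrBr -(s_rec n) ler_pM2l ?invr_gt0//.
  apply: le_trans (rnormD _ _) _.
  apply: le_trans (lerD (rnorm_cmul _ _) (rnorm_cmul _ _)) _.
  have := ys n; have := ys n.+1; have := rnorm_ge0 (y n.+1 - y n).
  have := rnorm_ge0 (y n); have := rnorm_ge0 (y n.+1).
  move: ih; move: (rnorm (y n.+1 - y n)) (rnorm (y n.+1)) (rnorm (y n)) => d a b.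
  move: (s n) (s n.+1) => u v h1 h2 h3 h4 h5 h6; have h7 : 0 <= u + v by lra.
  have h8 : 0 <= (v - u - d) * (u + v) by rewrite mulr_ge0//; lra.
  have h9 : 0 <= d * (u + v - a - b) by rewrite mulr_ge0//; lra.
  by move: h8 h9; lra.
have yC : cauchys y.
  have tele n k : rnorm (y (n + k)%N - y n) <= s (n + k)%N - s n.
    elim: k => [|k ih]; first by rewrite addn0 !subrr rnorm0.
    rewrite addnS; apply: le_trans (rdistD (y (n + k)%N) _ _) _.
    by have := yB (n + k)%N; lra.
  move=> r r0; have r20 : 0 < r / 2 by rewrite divr_gt0.
  have [N hN] := sqrt_majorant_cauchy r20; exists N => m n Nm Nn.
  have h k : (N <= k)%N -> rnorm (y k - y N) < r / 2.
    move=> Nk; have := tele N (k - N)%N; rewrite subnKC// => /le_lt_trans; apply.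
    by apply: le_lt_trans (hN k Nk); exact: ler_norm.
  have := rdistD (y N) (y m) (y n); have := h _ Nm; have := h _ Nn.
  by rewrite (rdistC (y N)); lra.
have [z yz] := cauchys_cvs yC.
have zE : z = (2^-1)%:C *: (t + cmul z z).
  have y1z : cvs (fun n => y n.+1) z.
    by move=> r /yz[N hN]; exists N => n Nn; apply: hN; exact: leqW.
  apply: (cvs_unique y1z); apply: (cvsZ _ (cvsD (cvs_cst t) (cvs_cmul yz yz))).
have zS : cstar z = z.
  apply: (cvs_unique (cvs_cstar yz)); apply: eq_cvs yz => n; by rewrite yS.
have pz : cmul p z = z.
  apply: (cvs_unique (cvs_cmul (cvs_cst p) yz)); apply: eq_cvs yz => n.
  by have [] := yp n.
have zp : cmul z p = z.
  apply: (cvs_unique (cvs_cmul yz (cvs_cst p))); apply: eq_cvs yz => n.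
  by have [] := yp n.
exists (p - z); split; rewrite ?cstarB ?pS ?zS ?cmulBl ?cmulBr ?pp ?pz ?zp//.
have zz : cmul z z = z + z - t.
  rewrite {3 4}zE -scalerDl -rmorphD (_ : 2^-1 + 2^-1 = 1 :> R) ?scale1r; last by field.
  by rewrite [t + _]addrC addrK.
by rewrite zz opprB [z + z - t - z]addrAC addrK addrA subrK.
Qed.

End CStar.

(** * The imprimitivity bimodule of a full corner *)

Section CornerMorita.
Variables (R : realType) (A B : cstarAlgType R) (phi : B -> A) (p : A).
Hypotheses (pS : cstar p = p) (pp : cmul p p = p).
Hypotheses (phi_lin : linear phi) (phi_norm : forall b, rnorm (phi b) = rnorm b)
  (phi_mul : forall b c, phi (cmul b c) = cmul (phi b) (phi c))
  (phi_star : forall b, phi (cstar b) = cstar (phi b))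
  (phi_corner : forall b, cmul p (cmul (phi b) p) = phi b)
  (phi_surj : forall a, cmul p (cmul a p) = a -> exists b, phi b = a).
(** A general fact on C*-algebras, usually read off from functional calculus; it is verified for the
    completions by estimates in representations. *)
Hypothesis contractive : forall a, cmul a p = a -> rnorm a <= 1 ->
  rnorm (p - cmul (cstar a) a) <= 1.
Hypothesis full : dense (linear_span
  [set cmul a (cstar b) | a in [set a | cmul a p = a] & b in [set b | cmul b p = b]]).

Let phi_inj b c : phi b = phi c -> b = c.
Proof.
move=> bc; apply/eqP; rewrite -subr_eq0; apply/eqP/rnorm_eq0.
by rewrite -phi_norm (linB phi_lin) bc subrr rnorm0.
Qed.

Let D : set A := [set a | cmul a p = a].

Let D_linsub : is_linsub D.
Proof.
split=> [|l a b]; first exact: (lin0 (cmul_linearl p)).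
by rewrite /D /= cmulDl cmulZl => -> ->.
Qed.

Let D_closed (u : nat -> A) a : (forall n, D (u n)) -> cvs u a -> D a.
Proof.
move=> Du ua; apply: (cvs_unique (cvs_cmul ua (cvs_cst p))).
by apply: eq_cvs ua => n; rewrite Du.
Qed.

Let E := normsub_complete D_linsub D_closed.
Let vl (x : E) : A := val (x : linsub D_linsub).
Let mk a (Da : D a) : E := to_linsub D_linsub Da.
Let vlK a (Da : D a) : vl (mk Da) = a. Proof. exact: to_linsubK. Qed.
Let vl_inj x y : vl x = vl y -> x = y. Proof. exact: val_inj. Qed.
Let vlP x : cmul (vl x) p = vl x. Proof. exact: (linsub_mem (x : linsub D_linsub)). Qed.
Let vl_lin l x y : vl (l *: x + y) = l *: vl x + vl y.
Proof. exact: (@val_linsubP _ _ _ D_linsub). Qed.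
Let vl_norm x : rnorm x = rnorm (vl x). Proof. exact: rnorm_normsub. Qed.

Let phi_p b : cmul (phi b) p = phi b.
Proof. by rewrite -phi_corner -!cmulA pp. Qed.
Let p_phi b : cmul p (phi b) = phi b.
Proof. by rewrite -phi_corner !cmulA pp. Qed.

Let laD a x : D (cmul a (vl x)). Proof. by rewrite /D /= -cmulA vlP. Qed.
Let raD x b : D (cmul (vl x) (phi b)). Proof. by rewrite /D /= -cmulA phi_p. Qed.
Let ripD x y : cmul p (cmul (cmul (cstar (vl x)) (vl y)) p) = cmul (cstar (vl x)) (vl y).
Proof. by rewrite -(cmulA _ _ p) vlP cmulA -{1}pS -cstarM vlP. Qed.

Let la a x : E := mk (laD a x).
Let ra x b : E := mk (raD x b).
Let lip x y : A := cmul (vl x) (cstar (vl y)).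
Let rip x y : B := projT1 (cid (phi_surj (ripD x y))).
Let ripE x y : phi (rip x y) = cmul (cstar (vl x)) (vl y).
Proof. by rewrite /rip; case: cid. Qed.

Let norm_eq (V W : normedModType R[i]) (v : V) (w : W) :
  rnorm v ^+ 2 = rnorm w -> `|v| ^+ 2 = `|w|.
Proof. by rewrite !rnormE -rmorphXn => ->. Qed.

(** After normalising x to a, put t = p - a^* a, so that |t| <= 1 and [projection_sqrt] yields a
    self-adjoint c with c c = p - t = a^* a. As c lies in the corner, it comes from [B]; the norm of
    x is put back as a scalar. *)
Let rip_pos x : cpositive (rip x x).
Proof.
have [x0|x0] := eqVneq (rnorm (vl x)) 0.
  exists 0; apply: phi_inj; rewrite ripE (rnorm_eq0 x0) (lin0 (cmul_linearr _)).
  by rewrite (lin0 (cmul_linearr _)) (lin0 phi_lin).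
have xp : 0 < rnorm (vl x) by rewrite lt_neqAle eq_sym x0 rnorm_ge0.
set r := rnorm (vl x) in x0 xp.
pose a := (r^-1)%:C *: vl x.
have ra_ : vl x = r%:C *: a by rewrite scalerA -rmorphM divff// scale1r.
have ap : cmul a p = a by rewrite cmulZl vlP.
have a1 : rnorm a <= 1 by rewrite rnormZ rnormR ger0_norm ?invr_ge0 ?(ltW xp)// -/r mulVf.
have hS : cstar (cmul (cstar a) a) = cmul (cstar a) a by rewrite cstarM cstarK.
have hp : cmul (cmul (cstar a) a) p = cmul (cstar a) a by rewrite -cmulA ap.
have ph : cmul p (cmul (cstar a) a) = cmul (cstar a) a.
  by rewrite -{1}hS -{1}pS -cstarM hp hS.
have tS : cstar (p - cmul (cstar a) a) = p - cmul (cstar a) a by rewrite cstarB pS hS.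
have pt : cmul p (p - cmul (cstar a) a) = p - cmul (cstar a) a by rewrite cmulBr pp ph.
have tp : cmul (p - cmul (cstar a) a) p = p - cmul (cstar a) a by rewrite cmulBl pp hp.
have [c [cS pc cp cc]] := projection_sqrt pS pp tS pt tp (contractive ap a1).
have [b bc] : exists b, phi b = c by apply: phi_surj; rewrite cp pc.
exists (r%:C *: b); apply: phi_inj; rewrite ripE phi_mul phi_star (linZ phi_lin) bc.
rewrite cstarZR cmulZl cmulZr cS cc opprB addrC subrK ra_ cstarZR.
by rewrite cmulZl cmulZr.
Qed.

Theorem corner_morita : strongly_Morita_equivalent A B.
Proof.
exists E, la, ra, lip, rip; split.
- split.
  + by move=> x l a b; apply: vl_inj; rewrite vl_lin !vlK cmulDl cmulZl.
  + by move=> a l x y; apply: vl_inj; rewrite vl_lin !vlK vl_lin cmulDr cmulZr.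
  + by move=> a b x; apply: vl_inj; rewrite !vlK cmulA.
  + by move=> y l a b; rewrite /lip vl_lin cmulDl cmulZl.
  + by move=> a x y; rewrite /lip vlK cmulA.
  + by move=> x y; rewrite /lip cstarM cstarK.
  + by move=> x; exists (cstar (vl x)); rewrite cstarK.
  + move=> x; apply: norm_eq; rewrite vl_norm -rnorm_cstar -rnorm_cstar_mul.
    by rewrite cstarK.
  + apply/dense_dist => a e e0; have /dense_dist/(_ a e e0)[d [n [c [v [vS ->]]]] ad] := full.
    exists (\sum_(i < n) c i *: v i) => //; exists n, c, v; split=> // i.
    by have [x Dx [y Dy <-]] := vS i; exists (mk Dx) => //; exists (mk Dy); rewrite // /lip !vlK.
- split.
  + by move=> b l x y; apply: vl_inj; rewrite vl_lin !vlK vl_lin cmulDl cmulZl.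
  + by move=> x l b c; apply: vl_inj; rewrite vl_lin !vlK phi_lin cmulDr cmulZr.
  + by move=> x b c; apply: vl_inj; rewrite !vlK phi_mul cmulA.
  + by move=> x l y z; apply: phi_inj; rewrite phi_lin !ripE vl_lin cmulDr cmulZr.
  + by move=> x y b; apply: phi_inj; rewrite phi_mul !ripE vlK cmulA.
  + by move=> x y; apply: phi_inj; rewrite phi_star !ripE cstarM cstarK.
  + exact: rip_pos.
  + by move=> x; apply: norm_eq; rewrite vl_norm -rnorm_cstar_mul -phi_norm ripE.
  (* Fullness on the right is immediate because [p] belongs to the module: [b] is the inner product
     of [p] with [phi b]. *)
  + apply/dense_dist => b e e0; exists b; last by rewrite subrr rnorm0.
    have Dp : D p by [].
    exists 1%N, (fun=> 1), (fun=> b); split; last by rewrite big_ord1 scale1r.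
    move=> _; exists (mk Dp) => //; exists (mk (phi_p b)) => //.
    by apply: phi_inj; rewrite ripE !vlK pS p_phi.
- by move=> a x b; apply: vl_inj; rewrite !vlK cmulA.
- by move=> a x y; apply: phi_inj; rewrite !ripE !vlK cstarM cmulA.
- by move=> x b y; rewrite /lip !vlK cstarM phi_star cstarK cmulA.
- by move=> x y z; apply: vl_inj; rewrite !vlK ripE /lip cmulA.
Qed.

End CornerMorita.

(** Holds for the maximal norm by definition and for the reduced norm by the regular representation.
    Only representations dominated by [nrm] are tested, so in proving a bound the norms of other
    elements may be used in the representation. *)
Definition normed_by_reps (R : realType) (A : starAlg R) (nrm : A -> \bar R) : Prop :=
  forall T c, sa_set T -> 0 <= c ->
  (forall (K : hilbertType R) (pi : A -> K -> K), star_representation pi ->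
    (forall S, sa_set S -> (opnorm (pi S) <= nrm S)%E) ->
    forall xi, rnorm (pi T xi) <= c * rnorm xi) ->
  (nrm T <= c%:E)%E.

Section Contraction.
Variables (R : realType) (A : starAlg R) (K : hilbertType R) (pi : A -> K -> K).
Hypotheses (hA : sa_closed A) (hpi : star_representation pi).

(* As [pi T = pi T pi P], the cross term of [|P xi - T* T xi|^2] is [-2 |T xi|^2], which
   absorbs [|T* T xi|^2 <= m^2 |T xi|^2]. *)
Lemma rep_projection_sub (P T : A) (m : R) xi : sa_set P -> sa_set T ->
  sa_star P = P -> sa_mul P P = P -> pi T (pi P xi) = pi T xi ->
  0 <= m -> m ^+ 2 <= 2 -> (opnorm (pi T) <= m%:E)%E ->
  rnorm (pi (P - sa_mul (sa_star T) T) xi) <= rnorm xi.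
Proof.
move=> sP sT PS PP TPx m0 m2 Tm.
have sT' := sa_closed_star hA sT.
have [_ ->] := linear_on_B (sa_closed_lin hA) (rep_linear hpi) sP (sa_closed_mul hA sT' sT).
have [lT _] := rep_bounded hpi sT.
have PPx : pi P (pi P xi) = pi P xi.
  by rewrite -[LHS]/((pi P \o pi P) xi) -(rep_mul hpi)// PP.
have -> : (pi P - pi (sa_mul (sa_star T) T)) xi = pi P xi - pi (sa_star T) (pi T xi).
  by rewrite (rep_mul hpi).
have Pxi : rnorm (pi P xi) <= rnorm xi.
  have := hdot_CS xi (pi P xi).
  have -> : hdot xi (pi P xi) = hdot (pi P xi) (pi P xi).
    by rewrite (rep_star hpi)// PS PPx.
  rewrite hdotxx rnormR ger0_norm ?sqr_ge0// expr2.
  have [->|z0] := eqVneq (rnorm (pi P xi)) 0; first by rewrite rnorm_ge0.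
  by rewrite ler_pM2r// lt_neqAle eq_sym z0 rnorm_ge0.
have Ts eta : rnorm (pi (sa_star T) eta) <= m * rnorm eta.
  have := hdot_CS (pi T (pi (sa_star T) eta)) eta.
  rewrite (rep_star hpi)// hdotxx rnormR ger0_norm ?sqr_ge0// => h.
  have := opnorm_bound (pi (sa_star T) eta) lT Tm.
  have [->|z0] := eqVneq (rnorm (pi (sa_star T) eta)) 0; first by rewrite mulr_ge0 ?rnorm_ge0.
  have zp : 0 < rnorm (pi (sa_star T) eta) by rewrite lt_neqAle eq_sym z0 rnorm_ge0.
  move=> /(ler_wpM2r (rnorm_ge0 eta)) h'; have := le_trans h h'.
  by rewrite expr2 mulrAC [X in _ <= X]mulrC ler_pM2l.
rewrite -(@ler_pXn2r _ 2) ?nnegrE ?rnorm_ge0// -hnormE (snormB2 (hdot_sip _)) !hnormE.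
have -> : hdot (pi P xi) (pi (sa_star T) (pi T xi)) = (rnorm (pi T xi) ^+ 2)%:C.
  by rewrite -(rep_star hpi)// TPx hdotxx.
rewrite RecK.
have h1 : rnorm (pi P xi) ^+ 2 <= rnorm xi ^+ 2 by rewrite ler_pXn2r ?nnegrE ?rnorm_ge0.
have h2 : rnorm (pi (sa_star T) (pi T xi)) ^+ 2 <= (m * rnorm (pi T xi)) ^+ 2.
  by rewrite ler_pXn2r ?nnegrE ?mulr_ge0 ?rnorm_ge0// Ts.
have h3 : (m * rnorm (pi T xi)) ^+ 2 <= 2 * rnorm (pi T xi) ^+ 2.
  by rewrite exprMn ler_wpM2r ?sqr_ge0.
have h4 := le_trans h2 h3; move: h1 h4.
by move: (rnorm (pi P xi)) (rnorm (pi T xi)) (rnorm _) (rnorm xi) => *; lra.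
Qed.

End Contraction.

(** * The corner inside the completions, for an abstract pair of norms *)

Section CornerCompletion.
Variables (R : realType) (X : metricType R) (H : hilbertType R).
Hypothesis hX : bounded_geometry X.
Variable e : H.
Hypothesis e1 : hdot e e = 1.
Local Notation opmx_mul := (mx_mul (fun f g : H -> H => f \o g)).
Local Notation opmx_star := (mx_star (@adjoint R H)).
Variables (nA : UC_alg X H -> \bar R) (nB : Cu_alg X -> \bar R).
Variables (A B : cstarAlgType R) (iA : UC_alg X H -> A) (iB : Cu_alg X -> B).
Hypotheses (hA : completion_map nA iA) (hB : completion_map nB iB).
Hypothesis corner_norm : forall T : Cu_alg X, Cu T -> nA (corner e T) = nB T.
Hypothesis nA_reps : normed_by_reps nA.

Let jA (T : Cu_alg X) : A := iA (corner e T).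

Let iA_lin l (S T : X -> X -> H -> H) : UC S -> UC T -> iA (l *: S + T) = l *: iA S + iA T.
Proof. exact: (compl_linear hA). Qed.
Let iA_mul (S T : X -> X -> H -> H) : UC S -> UC T -> iA (opmx_mul S T) = cmul (iA S) (iA T).
Proof. exact: (compl_mul hA). Qed.
Let iA_star (T : X -> X -> H -> H) : UC T -> iA (opmx_star T) = cstar (iA T).
Proof. exact: (compl_star hA). Qed.
Let iB_lin l S T : Cu S -> Cu T -> iB (l *: S + T) = l *: iB S + iB T.
Proof. exact: (compl_linear hB). Qed.

Let jA_lin l S T : Cu S -> Cu T -> jA (l *: S + T) = l *: jA S + jA T.
Proof. by move=> uS uT; rewrite /jA corner_lin iA_lin//; exact: (corner_UC e1). Qed.

Let jA_iso S T : Cu S -> Cu T -> rnorm (jA S - jA T) = rnorm (iB S - iB T).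
Proof.
move=> uS uT; have [uST <-] := linear_on_B (Cu_is_linsub X) iB_lin uS uT.
have [_ <-] := linear_on_B (Cu_is_linsub X) jA_lin uS uT.
apply: EFin_inj; rewrite (compl_norm hB)// -corner_norm// (compl_norm hA)//.
exact: (corner_UC e1).
Qed.

Let P : X -> X -> H -> H := corner e (one_mx (X := X)).
Let uI : Cu (one_mx (X := X)) := Cu_one_mx X.
Let uP : UC P. Proof. exact: (corner_UC e1 uI). Qed.
Let p : A := iA P.

Let P_star : opmx_star P = P.
Proof. by rewrite -corner_star one_mx_star. Qed.
Let P_mul : opmx_mul P P = P.
Proof. by rewrite -(corner_mul hX e1)// one_mx_mul. Qed.

Let pS : cstar p = p. Proof. by rewrite -iA_star// P_star. Qed.
Let pp : cmul p p = p. Proof. by rewrite -iA_mul// P_mul. Qed.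

Let corner_extension : exists phi : B -> A, forall u (s : nat -> Cu_alg X),
  (forall n, Cu (s n)) -> cvs (iB \o s) u -> cvs (jA \o s) (phi u).
Proof.
apply: (lipschitz_extension (K := 1) (compl_dense hB)) => S T uS uT.
by rewrite mul1r jA_iso.
Qed.

Let A_seq a : exists2 t : nat -> X -> X -> H -> H,
  (forall n, UC (t n)) & cvs (fun n => iA (t n)) a.
Proof.
have [u Du ua] := dense_cvs a (compl_dense hA).
have /choice[t ht] n : exists T, UC T /\ iA T = u n by have [T uT <-] := Du n; exists T.
exists t => [n|]; first by have [] := ht n.
by apply: eq_cvs ua => n; have [_ ->] := ht n.
Qed.

Let B_seq b : exists2 s : nat -> Cu_alg X, (forall n, Cu (s n)) & cvs (iB \o s) b.
Proof.
have [u Du ub] := dense_cvs b (compl_dense hB).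
have /choice[t ht] n : exists T, Cu T /\ iB T = u n by have [T uT <-] := Du n; exists T.
exists t => [n|]; first by have [] := ht n.
by apply: eq_cvs ub => n; rewrite /=; have [_ ->] := ht n.
Qed.

Let p_contractive a : cmul a p = a -> rnorm a <= 1 -> rnorm (p - cmul (cstar a) a) <= 1.
Proof.
move=> ap a1; have [t ut ta] := A_seq a.
(* Multiplication by [P] makes the approximants satisfy the analogue of [cmul a p = a] exactly. *)
pose v n := opmx_mul (t n) P.
have uv n : UC (v n) by exact: UC_mul.
have va : cvs (fun n => iA (v n)) a.
  by rewrite -ap; apply: eq_cvs (cvs_cmul ta (cvs_cst p)) => n; rewrite iA_mul.
(* Within 1/5 of [a] the norm is at most 6/5, and (6/5)^2 <= 2 is within what [rep_projection_sub]
   tolerates, so the approximants need no rescaling. *)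
have p5 : 0 < 5^-1 :> R by rewrite invr_gt0.
have [N hN] := va _ p5.
have va' : cvs (fun n => iA (v (n + N)%N)) a.
  by move=> r /va[M hM]; exists M => n nM; apply: hM; exact: leq_trans (leq_addr _ _).
have lim := cvsB (cvs_cst p) (cvs_cmul (cvs_cstar va') va').
apply: (cvs_le lim) => n; set m := (n + N)%N.
have vm : rnorm (iA (v m)) <= 6 / 5.
  have := hN m (leq_addl _ _); have := rnorm_distl (iA (v m)) a.
  by move: a1; move: (rnorm (iA (v m) - a)) (rnorm a) (rnorm _) => *; lra.
have uv' := UC_star (uv m).
rewrite -iA_star// -iA_mul//.
have [uS <-] := linear_on_B (UC_is_linsub X H) iA_lin uP (UC_mul hX uv' (uv m)).
rewrite -lee_fin (compl_norm hA)//; apply: nA_reps => // K pi hpi pin xi.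
have piM S T eta : UC S -> UC T -> pi (opmx_mul S T) eta = pi S (pi T eta).
  by move=> uS' uT'; rewrite (rep_mul hpi).
have piP : pi (v m) (pi P xi) = pi (v m) xi by rewrite /v !piM// -(piM P P)// P_mul.
have pim : (opnorm (pi (v m)) <= (6 / 5)%:E)%E.
  by apply: le_trans (pin _ (uv m)) _; rewrite -(compl_norm hA (uv m)) lee_fin.
have m0 : 0 <= 6 / 5 :> R by lra.
have m2 : (6 / 5) ^+ 2 <= 2 :> R by lra.
rewrite mul1r.
exact: (rep_projection_sub (UC_closed H hX) hpi uP (uv m) P_star P_mul piP m0 m2 pim).
Qed.

Let UC_kets (T : X -> X -> H -> H) (r : R) : UC T -> 0 < r ->
  exists2 T0, UC0 T0 & rnorm (iA T - iA T0) <= r.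
Proof.
move=> uT r0; case: (uT) => [[S S0 hS] _ hT].
set k := (nbN hX S)%:R ^+ 2 : R; have k0 : 0 <= k by exact: sqr_ge0.
have q0 : 0 < r / (k + 1) by rewrite divr_gt0// ltr_wpDl.
have [T1 uT1 h1] := hT _ q0.
(* [T1] has a propagation of its own. Cutting it off at [S] keeps the difference at propagation [S],
   for which the constant [k] was fixed before the tolerance. *)
pose T0 : X -> X -> H -> H := fun x y => if mdist x y < S then T1 x y else 0.
have uT0 : UC0 T0.
  have [S1 [M [N [_ _ M0 hs]]]] := UC0_spec uT1.
  apply: (@UC0_intro _ _ _ _ S M N) => //.
  - by move=> x y xy; rewrite /T0 ltNge xy.
  - move=> x y v; rewrite /T0; case: ifP => _; first by have [s [_ _ h _]] := hs x y.
    by rewrite -[X in rnorm X]/(0 : H) rnorm0 mulr_ge0 ?rnorm_ge0.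
  - move=> x y; rewrite /T0; case: ifP => _.
      by have [s [sN Ts _ _]] := hs x y; exists s.
    by exists [::] => //; apply/funext => v; rewrite /frk big_nil.
exists T0 => //; have [uD <-] := linear_on_B (UC_is_linsub X H) iA_lin uT (UC0_UC uT0).
rewrite -lee_fin (compl_norm hA)//; apply: nA_reps => //; first exact: ltW.
move=> K pi hpi _ xi.
have hD : fprop S (T - T0).
  move=> x y xy; rewrite -[LHS]/(T x y - T0 x y) hS//.
  by rewrite /T0 ltNge xy subrr.
have bD x y : bnd ((T - T0) x y) (r / (k + 1)).
  move=> v; rewrite -[X in rnorm X]/(T x y v - T0 x y v) /T0; case: ltP => xy; last first.
    rewrite hS// -[X in rnorm X]/(0 - 0 : H) subr0 rnorm0.
    by rewrite mulr_ge0 ?rnorm_ge0// ltW.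
  have [_ lT _ _] := (UCP _).1 uT; have [_ lT1 _ _] := (UCP _).1 (UC0_UC uT1).
  have lD : linear (T1 x y - T x y).
    move=> l u w; rewrite -![(T1 x y - T x y) _]/(T1 x y _ - T x y _) lT lT1.
    by rewrite scalerBr opprD addrACA.
  by rewrite rdistC; exact: (opnorm_bound v lD (ltW (h1 x y))).
apply: le_trans (UC_rep_bound hX xi hpi S0 uD hD (ltW q0) bD) _.
rewrite ler_wpM2r ?rnorm_ge0// -/k mulrA ler_pdivrMr ?ltr_wpDl//.
by rewrite mulrDr mulr1 [k * r]mulrC lerDl ltW.
Qed.

Let span_kets : dense (linear_span
  [set cmul a (cstar b) | a in [set a | cmul a p = a] & b in [set b | cmul b p = b]]).
Proof.
apply/dense_dist => a r r0; have r2 : 0 < r / 2 by rewrite divr_gt0.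
have /dense_dist/(_ a _ r2)[_ [T uT <-] aT] := compl_dense hA.
have [T0 uT0 TT0] := UC_kets uT r2.
exists (iA T0); last first.
  by apply: le_lt_trans (rdistD (iA T) _ _) _; lra.
have [s [cs ->]] := UC0_span hX e1 uT0.
rewrite big_tnth; set t := in_tuple s.
have ct i : column (tnth t i).1 /\ column (tnth t i).2 by apply: cs; exact: mem_tnth.
have u1 i : UC (ket e (tnth t i).1) by apply: (ket_UC e1); have [] := ct i.
have u2 i : UC (ket e (tnth t i).2) by apply: (ket_UC e1); have [] := ct i.
have u3 i := UC_star (u2 i).
have [_ ->] := linear_on_sum (UC_is_linsub X H) iA_lin
  (index_enum _) (fun i => UC_mul hX (u1 i) (u3 i)).
exists (size s), (fun=> 1),
  (fun i => cmul (iA (ket e (tnth t i).1)) (cstar (iA (ket e (tnth t i).2)))).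
split=> [i|]; last by apply: eq_bigr => i _; rewrite scale1r iA_mul// iA_star.
have kp c : column c -> cmul (iA (ket e c)) p = iA (ket e c).
  by move=> cc; rewrite -iA_mul ?(ket_one hX e1)//; exact: (ket_UC e1).
exists (iA (ket e (tnth t i).1)); first by apply: kp; have [] := ct i.
by exists (iA (ket e (tnth t i).2)) => //; apply: kp; have [] := ct i.
Qed.

Theorem UC_morita : strongly_Morita_equivalent A B.
Proof.
have [phi hphi] := corner_extension.
have phi_lin : linear phi.
  move=> l b c; have [s us sb] := B_seq b; have [t ut tc] := B_seq c.
  have ust n : Cu (l *: s n + t n) by exact: (is_linsubP (Cu_is_linsub X)).
  have h : cvs (iB \o (fun n => l *: s n + t n)) (l *: b + c).
    by apply: eq_cvs (cvsD (cvsZ l sb) tc) => n; rewrite /= iB_lin.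
  apply: (cvs_unique (hphi _ _ ust h)).
  by apply: eq_cvs (cvsD (cvsZ l (hphi _ _ us sb)) (hphi _ _ ut tc)) => n; rewrite /= jA_lin.
have iso1 S : Cu S -> rnorm (jA S) = rnorm (iB S).
  move=> uS; apply: EFin_inj.
  by rewrite (compl_norm hA) ?(compl_norm hB)// ?corner_norm//; exact: (corner_UC e1).
apply: (@corner_morita _ A B phi p) => //.
- move=> b; have [s us sb] := B_seq b; apply: (cvs_lim_eq (hphi _ _ us sb)) => r r0.
  by have [N hN] := cvs_norm_cvg sb r0; exists N => n /hN; rewrite /= iso1.
- move=> b c; have [s us sb] := B_seq b; have [t ut tc] := B_seq c.
  have ust n : Cu (mx_mul (C := R[i]^o) *%R (s n) (t n)) by exact: Cu_mul.
  have h : cvs (iB \o (fun n => mx_mul (C := R[i]^o) *%R (s n) (t n))) (cmul b c).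
    by apply: eq_cvs (cvs_cmul sb tc) => n; rewrite /= -(compl_mul hB (us n) (ut n)).
  apply: (cvs_unique (hphi _ _ ust h)).
  apply: eq_cvs (cvs_cmul (hphi _ _ us sb) (hphi _ _ ut tc)) => n.
  by rewrite /= /jA (corner_mul hX e1)// iA_mul//; exact: (corner_UC e1).
- move=> b; have [s us sb] := B_seq b.
  have ust n : Cu (mx_star (@Num.conj R[i]) (s n)) by exact: Cu_star.
  have h : cvs (iB \o (fun n => mx_star (@Num.conj R[i]) (s n))) (cstar b).
    by apply: eq_cvs (cvs_cstar sb) => n; rewrite /= -(compl_star hB (us n)).
  apply: (cvs_unique (hphi _ _ ust h)).
  apply: eq_cvs (cvs_cstar (hphi _ _ us sb)) => n.
  by rewrite /= /jA corner_star iA_star//; exact: (corner_UC e1).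
- move=> b; have [s us sb] := B_seq b.
  apply: (cvs_unique (cvs_cmul (cvs_cst p) (cvs_cmul (hphi _ _ us sb) (cvs_cst p)))).
  apply: eq_cvs (hphi _ _ us sb) => n; rewrite /= /jA.
  have uc := corner_UC e1 (us n).
  rewrite -iA_mul// -iA_mul//; last exact: UC_mul.
  rewrite /P -!(corner_mul hX e1)// ?(one_mx_mul hX) ?(mul_one_mx hX)//.
- move=> a pap; have [t ut ta] := A_seq a.
  (* The compressions P (t n) P are corners of matrices in [Cu] and converge to p a p = a. The
     corner embedding is isometric, so these matrices are Cauchy in [B], and their limit is the
     preimage. *)
  pose s n := compress e (t n); have us n : Cu (s n) by exact: (compress_Cu e1).
  have ja : cvs (jA \o s) a.
    rewrite -pap; apply: eq_cvs (cvs_cmul (cvs_cst p) (cvs_cmul ta (cvs_cst p))) => n.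
    rewrite /= /jA /s -(corner_compress hX)// iA_mul//; last exact: UC_mul.
    by rewrite iA_mul.
  have [b sb] : exists b, cvs (iB \o s) b.
    apply: cauchys_cvs => r /(cvs_cauchy ja)[N hN]; exists N => m n Nm Nn.
    by have := hN _ _ Nm Nn; rewrite /= jA_iso.
  by exists b; apply: (cvs_unique (hphi _ _ us sb)).
Qed.

End CornerCompletion.

(** * The reduced and the maximal norm *)

Lemma max_norm_normed_by_reps (R : realType) (A : starAlg R) : normed_by_reps (@max_norm R A).
Proof.
move=> T c sT c0 h; apply: ge_ereal_sup => _ [K [pi [hpi ->]]].
apply: opnorm_le => // xi; apply: h => // S sS.
by apply: ereal_sup_ubound; exists K, pi.
Qed.

Lemma UC_norm_normed_by_reps (R : realType) (X : metricType R) (H : hilbertType R)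
    (hX : bounded_geometry X) :
  (forall T : UC_alg X H, UC T -> (UC_norm T < +oo)%E) -> normed_by_reps (@UC_norm R X H).
Proof.
move=> /(reduced_representation hX)[K [La [hLa LaE]]] T c uT c0 h.
rewrite LaE//; apply: opnorm_le => // xi; apply: h => // S uS.
by rewrite -LaE.
Qed.

Lemma infinite_dimensional_unit (R : realType) (H : hilbertType R) :
  infinite_dimensional H -> exists e : H, hdot e e = 1.
Proof.
move=> /(_ 0%N (fun=> 0)) h.
(* The empty family, whose span is 0, does not span [H]. *)
have [v v0] : exists v : H, v != 0.
  apply: contrapT => nv; apply: h; apply/seteqP; split=> // v _.
  exists 0%N, (fun=> 0), (fun=> 0); split; first by case.
  rewrite big_ord0; apply/eqP; apply: contrapT => /negP vn; apply: nv; by exists v.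
have r0 : rnorm v != 0 by apply: contra_neq v0 => /rnorm_eq0.
exists ((rnorm v)^-1%:C *: v).
rewrite hdotxx rnormZ rnormR ger0_norm ?invr_ge0 ?rnorm_ge0// mulVf//.
by rewrite expr1n.
Qed.

Theorem proposition4p7 (R : realType) (X : metricType R) (H0 : hilbertType R)
  (hX_discrete : uniformly_discrete X) (hX_geometry : bounded_geometry X)
  (hH0_separable : separable_space H0) (hH0_dim : infinite_dimensional H0)
  (UCstar Cstar_u UCstar_max Cstar_u_max : cstarAlgType R)
  (hUCstar : is_UCstar X H0 UCstar)
  (hCstar_u : is_Cstar_u X Cstar_u)
  (hUCstar_max : is_UCstar_max X H0 UCstar_max)
  (hCstar_u_max : is_Cstar_u_max X Cstar_u_max) :
  strongly_Morita_equivalent UCstar Cstar_u /\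
  strongly_Morita_equivalent UCstar_max Cstar_u_max.
Proof.
have [e e1] := infinite_dimensional_unit hH0_dim.
have [[iA hA] [iB hB]] := (hUCstar, hCstar_u).
have [[iA' hA'] [iB' hB']] := (hUCstar_max, hCstar_u_max).
split.
  apply: (UC_morita hX_geometry e1 hA hB) => [T|]; first exact: reduced_norm_corner.
  apply: UC_norm_normed_by_reps => // T uT.
  by rewrite -(compl_norm hA uT) ltry.
apply: (UC_morita hX_geometry e1 hA' hB') => [T|]; first exact: max_norm_corner.
exact: max_norm_normed_by_reps.
Qed.
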